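(* Let $(S_0,S_1,\dots)$ be a martingale relative to a nondecreasing sequence of $\sigma$-algebras $(H_{\le 0},H_{\le 1},\dots)$, with $S_0=0$ and $X_i:=S_i-S_{i-1}$, $i=1,2,\dots$, and let $M_n:=\max_{0\le k\le n}S_k$. Let $(s_i)_{i\ge1}$ be positive real numbers, and suppose that one of the following two conditions holds: (A) for every $i=1,2,\dots$ there exist $H_{\le(i-1)}$-measurable random variables $C_{i-1}$, $D_{i-1}$ such that $C_{i-1}\le X_i\le D_{i-1}$ and $D_{i-1}-C_{i-1}\le 2s_i$ with probability 1; or (B) for every $i=1,2,\dots$ there exists a positive $H_{\le(i-1)}$-measurable random variable $D_{i-1}$ such that $X_i\le D_{i-1}$ and $\frac12\Big(D_{i-1}+\dfrac{\mathsf{Var}_{i-1}X_i}{D_{i-1}}\Big)\le s_i$ with probability 1. Let $s:=\sqrt{s_1^2+\dots+s_n^2}$ and $Z\sim N(0,1)$. Then for all $n=0,1,\dots$ and all real $x$, each of the following successive expressions is an upper bound on $\mathsf{P}(M_n\ge x)$: $$\mathsf{P}(M_n\ge x)\le \inf_{f\in\mathcal{F}_+^{(5)}}\frac{\mathsf{E} f(sZ)}{f(x)}=\inf_{t\in(-\infty,x)}\frac{\mathsf{E}(sZ-t)_+^5}{(x-t)^5}\le\min\Big(c_{5,0}\,\mathsf{P}(sZ\ge x),\ \inf_{h>0}e^{-hx}\,\mathsf{E}e^{hsZ}\Big)$$ $$=\min\Big(c_{5,0}\,\overline{\Phi}\Big(\frac{x}{s}\Big),\ \exp\Big(-\frac{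x^2}{2s^2}\Big)\Big).$$
   Context: $\mathsf{Var}_{i-1}$ denotes the conditional variance given $H_{\le(i-1)}$. $\mathcal{F}_+^{(5)}$ denotes the class of all functions $f\colon\mathbb{R}\to\mathbb{R}$ of the form $f(x)=\int_{-\infty}^\infty (x-t)_+^5\,\mu(dt)$ for all $x\in\mathbb{R}$, where $\mu\ge 0$ is a Borel measure on $\mathbb{R}$, $x_+:=\max(0,x)$, and $x_+^5:=(x_+)^5$. The infimum over $f$ is over those $f$ with $f(x)>0$. $c_{5,0}:=5!(e/5)^5=5.699\dots$, and $\overline{\Phi}(u):=\mathsf{P}(Z\ge u)$ is the standard normal tail.
   Formalization: The last equality (with exp(-x²/(2s²))) is proved for x ≥ 0 only, since for x < 0 it is false: the left side is 1 and the right side is less than 1; for n = 0 (s = 0) the quotients by s are read as limits, with 0/0 = 0. *)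

(* Defs.v *)
From HB Require Import structures.
From mathcomp Require Export all_boot all_order all_algebra.
From mathcomp Require Export all_classical all_reals all_analysis.
From mathcomp Require Export measurable_realfun.

Set Implicit Arguments.
Unset Strict Implicit.
Unset Printing Implicit Defensive.

Import Order.TTheory GRing.Theory Num.Theory.
Import numFieldNormedType.Exports.

Local Open Scope classical_set_scope.
Local Open Scope ring_scope.

Definition sub_measurable d d' (T : measurableType d) (U : measurableType d')
    (G : set_system T) (f : T -> U) : Prop :=
  preimage_set_system setT f measurable `<=` G.

Definition filtration d (T : measurableType d) (H : nat -> set_system T) : Prop :=
  [/\ forall i, sigma_algebra setT (H i),
      forall i, H i `<=` measurable
    & forall i j, (i <= j)%N -> H i `<=` H j].

(* [g] is a version of E(f | G). To be used for [f] integrable or nonnegative;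
   [g] is then almost surely unique, and integrable, resp. almost surely
   nonnegative (test against the sets where [g] is >= 0 and where it is < 0). *)
Definition is_cond_exp d (T : measurableType d) (R : realType)
    (P : probability T R) (G : set_system T) (f g : T -> \bar R) : Prop :=
  sub_measurable G g /\
  forall A, G A -> (\int[P]_(w in A) g w = \int[P]_(w in A) f w)%E.

(* [V] is a version of Var(X | G) = E((X - E(X | G))^2 | G) for an integrable
   [X]. [V] takes values in [\bar R] because X^2 need not be integrable. *)
Definition is_cond_var d (T : measurableType d) (R : realType)
    (P : probability T R) (G : set_system T) (X : T -> R) (V : T -> \bar R)
    : Prop :=
  exists2 Y : T -> R, is_cond_exp P G (EFin \o X) (EFin \o Y) &
    is_cond_exp P G (fun w => ((X w - Y w) ^+ 2)%:E) V.

Definition martingale d (T : measurableType d) (R : realType)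
    (P : probability T R) (H : nat -> set_system T) (S : nat -> T -> R) : Prop :=
  [/\ forall i, sub_measurable (H i) (S i),
      forall i, P.-integrable setT (EFin \o S i)
    & forall i, is_cond_exp P (H i) (EFin \o S i.+1) (EFin \o S i)].

(* X_i, only meant for i >= 1. *)
Definition increment T (R : realType) (S : nat -> T -> R) (i : nat) (w : T) : R :=
  S i w - S i.-1 w.

Definition running_max T (R : realType) (S : nat -> T -> R) (n : nat) (w : T) : R :=
  \big[Num.max/S 0%N w]_(0 <= k < n.+1) S k w.

Definition condA d (T : measurableType d) (R : realType) (P : probability T R)
    (H : nat -> set_system T) (S : nat -> T -> R) (s : nat -> R) : Prop :=
  forall i, (0 < i)%N -> exists C D : T -> R,
    [/\ sub_measurable (H i.-1) C,
        sub_measurable (H i.-1) D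
      & {ae P, forall w, [/\ C w <= increment S i w,
                             increment S i w <= D w
                           & D w - C w <= 2 * s i]}].

Definition condB d (T : measurableType d) (R : realType) (P : probability T R)
    (H : nat -> set_system T) (S : nat -> T -> R) (s : nat -> R) : Prop :=
  forall i, (0 < i)%N -> exists (D : T -> R) (V : T -> \bar R),
    [/\ sub_measurable (H i.-1) D,
        forall w, 0 < D w,
        is_cond_var P (H i.-1) (increment S i) V
      & {ae P, forall w, increment S i w <= D w /\
          ((2^-1)%:E * ((D w)%:E + V w / (D w)%:E) <= (s i)%:E)%E}].

Definition pos5 (R : realType) (u : R) : R := (Num.max 0 u) ^+ 5.

Definition F5plus (R : realType) : set (R -> R) :=
  [set f | exists mu : {measure set (measurableTypeR R) -> \bar R},
     forall x, (f x)%:E = (\int[mu]_t (pos5 (x - t))%:E)%E].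

Definition c50 (R : realType) : R := 5`!%:R * (expR 1 / 5) ^+ 5.

(* P(Z >= u), Z ~ N(0,1), extended by its limits to u = -oo and u = +oo. *)
Definition normal_tail (R : realType) (u : \bar R) : \bar R :=
  normal_prob (0 : R) 1 [set z : R | (u <= z%:E)%E].

(* Main.v *)
From HB Require Import structures.
Require Import Defs.
From mathcomp Require Import all_boot all_order all_algebra.
From mathcomp Require Import all_classical all_reals all_analysis.
From mathcomp Require Import measurable_realfun ring lra.
Import Order.TTheory GRing.Theory Num.Theory.
Import numFieldNormedType.Exports.
Local Open Scope classical_set_scope.
Local Open Scope ring_scope.

(* Let g_t(u) = (u - t)_+^5. If D <= 2s, a mean-zero variable X <= D with variance
   at most D(2s - D) satisfies E g_t(X) <= E g_t(V) for the mean-zero law V on the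
   points D and D - 2s, because g_t lies on ]-oo, D] below the parabola that
   touches it at D - 2s and meets it at D. In turn E g_t(V) <= E g_t(sZ): after
   scaling to s = 1 this is a polynomial inequality in the weight of D and in t,
   once E g_t(Z) is bounded below by tangent lines that involve only even moments
   of Z. Both (A) and (B) put the conditional law of each increment in this
   situation, so Tonelli and the convolution of normal laws give, by induction
   on n and for all t, E g_t(S_n) <= E g_t(sZ); the convexity of g_t and Doob's
   argument replace S_n by M_n. A function of the class is a mixture of the g_t,
   so the two infima agree. The exponential bound takes t = x - 5/h. The bound by
   c_{5,0} P(sZ >= x) takes t = x - 5/l with l the hazard rate of the normal law at
   x, and compares the normal density, on t < z, with the exponential density
   of rate l having the same value at x and the same mass beyond x. *)

(** * Two-point laws against the normal law *)

(** No conditional distribution is ever formed. The coefficients of the parabola are bounded and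
    measurable with respect to the past, so only the integrals of X and of X^2 over past events
    enter; (A) and (B) differ only in how they bound the second. The coefficients are bounded
    because each X_i is at most 2 s_i, so that S_n is bounded from above almost surely; large
    negative values of S_n do no harm, since g_t vanishes to the left of t.

    The delicate point is the two-point inequality (s = 1). When t = -u lies below both points, the
    difference of its two sides is a cubic in u with leading coefficient 10 (1 - Var V), plus E (Z -
    u)_+^5. When V is nearly degenerate, with its lower point close to 0, this cubic is negative
    near that point, and only an explicit lower bound on E (Z - u)_+^5 saves the inequality. *)

Lemma pos5_ge0 (R : realType) (u : R) : 0 <= pos5 u.
Proof. by rewrite /pos5 exprn_ge0// le_max lexx. Qed.

Lemma pos5_id (R : realType) (u : R) : 0 <= u -> pos5 u = u ^+ 5.
Proof. by move=> u0; rewrite /pos5 max_r. Qed.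

Lemma pos5_eq0 (R : realType) (u : R) : u <= 0 -> pos5 u = 0.
Proof. by move=> u0; rewrite /pos5 max_l// expr0n. Qed.

Lemma pos5M (R : realType) (s u : R) : 0 <= s -> pos5 (s * u) = s ^+ 5 * pos5 u.
Proof.
by move=> s0; rewrite /pos5 -exprMn; congr (_ ^+ 5); rewrite maxr_pMr// mulr0.
Qed.

Lemma pos5_mono (R : realType) (u v : R) : u <= v -> pos5 u <= pos5 v.
Proof.
move=> uv; apply: lerXn2r; rewrite ?nnegrE ?le_max ?lexx//.
by case: (leP u 0) => u0; rewrite ?lexx ?uv ?orbT.
Qed.

(* Weighted AM-GM for [x] and five copies of [z / 5]; 67/2000 is slightly
   larger than the optimal constant 5^5 / (2 * 6^6). *)
Lemma amgm_one_five (R : realFieldType) (x z : R) : 0 <= x -> 0 <= z ->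
  x * z ^+ 5 / 2 <= 67 / 2000 * (x + z) ^+ 6.
Proof.
move=> x0 z0; pose r := z / 5.
have -> : z = 5 * r by rewrite /r; field.
have r0 : 0 <= r by rewrite divr_ge0.
have h : 6 ^+ 6 * (x * r ^+ 5) <= (x + 5 * r) ^+ 6.
  rewrite -subr_ge0.
  (* Equality holds at [x = r], hence the double root; the quartic cofactor has positive
     coefficients. *)
  have -> : (x + 5 * r) ^+ 6 - 6 ^+ 6 * (x * r ^+ 5) =
    (x - r) ^+ 2 * (x ^+ 4 + 32 * (x ^+ 3 * r) + 438 * (x ^+ 2 * r ^+ 2)
    + 3344 * (x * r ^+ 3) + 5 ^+ 6 * r ^+ 4) by ring.
  have p k (a : R) : 0 <= a -> 0 <= k%:R * a.
    by move=> a0; apply: mulr_ge0; rewrite ?ler0n.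
  have q i j : 0 <= x ^+ i * r ^+ j by apply: mulr_ge0; exact: exprn_ge0.
  apply: mulr_ge0; first exact: sqr_ge0.
  have c0 : 0 <= (5 : R) ^+ 6 by apply: exprn_ge0; exact: ler0n.
  apply: addr_ge0; last by apply: mulr_ge0; [exact: c0 | exact: exprn_ge0].
  apply: addr_ge0; last by apply/p; exact: (q 1%N 3%N).
  apply: addr_ge0; last by apply/p; exact: (q 2%N 2%N).
  apply: addr_ge0; last by apply/p; exact: (q 3%N 1%N).
  exact: exprn_ge0.
have xr : 0 <= x * r ^+ 5 by rewrite mulr_ge0 ?exprn_ge0.
apply: (@le_trans _ _ (67 / 2000 * (6 ^+ 6 * (x * r ^+ 5)))).
  rewrite (_ : x * (5 * r) ^+ 5 / 2 = (5 ^+ 5 / 2) * (x * r ^+ 5)); last by field.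
  rewrite [leRHS]mulrA; apply: ler_wpM2r; first exact: xr.
  by lra.
by apply: ler_wpM2l; [lra|exact: h].
Qed.

(* With [e = 1 - 2 * p], this is [u^5 + 10 * u^3 + 15 * u], which is
   E (Z + u)_+^5 - E (Z - u)_+^5, minus the expectation of [pos5 (V + u)] for the
   mean-zero [V] taking the values [2 * (1 - p)] and [- 2 * p] with probabilities
   [p] and [1 - p], when both values exceed [- u]. *)
Definition two_point_gap (R : realFieldType) (e u : R) :=
  10 * u * (u * e - (1 - e ^+ 2)) ^+ 2 + u * (10 * e ^+ 2 + 5 * e ^+ 4)
  - 4 * e * (1 - e ^+ 4).

(** The divided difference in [u] is two squares plus [10 e^2 + 5 e^4 - 10/3 c^2], and [e >= 1/2]
    makes this last part nonnegative. For small positive [e] monotonicity fails, which is why that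
    range is treated separately. *)
Lemma two_point_gap_nd (R : realFieldType) (e u v : R) : 2^-1 <= e <= 1 -> 0 <= v -> v <= u ->
  two_point_gap R e v <= two_point_gap R e u.
Proof.
move=> /andP[e1 e2] v0 vu; rewrite -subr_ge0.
pose c := 1 - e ^+ 2.
have -> : two_point_gap R e u - two_point_gap R e v = (u - v) *
  (10 / 4 * (e * (u - v)) ^+ 2 + 15 / 2 * (e * (u + v) - 4 / 3 * c) ^+ 2
   + (10 * e ^+ 2 + 5 * e ^+ 4 - 10 / 3 * c ^+ 2)).
  by rewrite /two_point_gap /c; field.
apply: mulr_ge0; first by rewrite subr_ge0.
apply: addr_ge0; first by rewrite addr_ge0// mulr_ge0 ?sqr_ge0//; lra.
rewrite /c.
have : 1 / 4 <= e ^+ 2 by nra.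
have : e ^+ 2 <= 1 by nra.
have -> : e ^+ 4 = (e ^+ 2) ^+ 2 by ring.
set y := e ^+ 2; move=> y1 y2; nra.
Qed.

Lemma two_point_gap_ge0_half (R : realFieldType) (e u : R) : 0 <= e <= 2^-1 -> 1 - e <= u ->
  0 <= two_point_gap R e u.
Proof.
move=> /andP[e1 e2] ue.
have u0 : 0 <= u by lra.
pose c := 1 - e ^+ 2.
have c0 : 0 <= c by rewrite /c; nra.
(* Above this threshold the linear term [u e (10 + 5 e^2)] alone beats [4 c (1 + e^2)]; below it,
   [(u e - c)^2] is at least [(7/15)^2 c^2]. *)
have [v1|v1] := leP (8 / 15 * c) (u * e).
  have [->|e0] := eqVneq e 0; first by rewrite /two_point_gap; nra.
  have {}e0 : 0 < e by rewrite lt_def e0.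
  rewrite -(pmulr_rge0 _ e0).
  have -> : e * two_point_gap R e u = 10 * (u * e) * (u * e - c) ^+ 2 +
     e ^+ 2 * ((u * e) * (10 + 5 * e ^+ 2) - 4 * c * (1 + e ^+ 2)).
    by rewrite /two_point_gap /c; ring.
  apply: addr_ge0.
    apply: mulr_ge0; last exact: sqr_ge0.
    by apply: mulr_ge0; [lra | apply: mulr_ge0; lra].
  apply: mulr_ge0; first exact: sqr_ge0.
  have h1 : e ^+ 2 <= 1 / 4 by nra.
  have h0 : 0 <= e ^+ 2 by nra.
  set y := e ^+ 2 in h1 h0 *; set v := u * e in v1 *.
  have h3 : v * (10 + 5 * y) >= 8 / 15 * c * (10 + 5 * y) by apply: ler_wpM2r; lra.
  nra.
have vc : (7 / 15) ^+ 2 * c ^+ 2 <= (u * e - c) ^+ 2.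
  rewrite -exprMn -(sqrrN (u * e - c)) opprB.
  by apply: lerXn2r; rewrite ?nnegrE; lra.
have h : 4 * e * (1 + e) * (1 + e ^+ 2) <=
  10 * ((7 / 15) ^+ 2 * c ^+ 2) + (10 * e ^+ 2 + 5 * e ^+ 4).
  rewrite /c.
  have -> : e ^+ 4 = (e ^+ 2) * (e ^+ 2) by ring.
  have : 0 <= (2^-1 - e) * e by apply: mulr_ge0; lra.
  have : 0 <= (2^-1 - e) ^+ 2 * e by apply: mulr_ge0; [exact: sqr_ge0|lra].
  have : 0 <= (2^-1 - e) * e ^+ 2 by apply: mulr_ge0; [lra|exact: sqr_ge0].
  nra.
have -> : two_point_gap R e u =
  u * (10 * (u * e - c) ^+ 2 + (10 * e ^+ 2 + 5 * e ^+ 4))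
   - (1 - e) * (4 * e * (1 + e) * (1 + e ^+ 2)) by rewrite /two_point_gap /c; ring.
have e20 : 0 <= e ^+ 2 by exact: sqr_ge0.
rewrite subr_ge0; apply: ler_pM; [lra| |exact: ue|lra].
by apply: mulr_ge0; [apply: mulr_ge0; lra|lra].
Qed.

Lemma two_point_gap_ge0_35 (R : realFieldType) (e : R) : 65 / 100 <= e <= 1 ->
  0 <= two_point_gap R e (35 / 100).
Proof.
move=> /andP[e1 e2]; rewrite /two_point_gap.
have : 0 <= (1 - e) * (e - 65/100) by apply: mulr_ge0; lra.
have : 0 <= (1 - e) * (e - 65/100) * e by rewrite !mulr_ge0//; lra.
have : 0 <= (1 - e) * (e - 65/100) * e ^+ 2 by rewrite !mulr_ge0//; lra.
have : 0 <= (1 - e) * (e - 65/100) * e ^+ 3 by rewrite !mulr_ge0//; lra.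
have : 0 <= e * (e - 73 / 100) ^+ 2 by rewrite mulr_ge0 ?sqr_ge0//; lra.
have : 0 <= e ^+ 2 * (e - 73 / 100) ^+ 2 by rewrite mulr_ge0 ?sqr_ge0//; lra.
have : 0 <= e ^+ 3 * (e - 73 / 100) ^+ 2.
  by apply: mulr_ge0; [apply: exprn_ge0; lra | exact: sqr_ge0].
nra.
Qed.

(** The edge [u = 1 - e] is the case where [t] sits at the lower point of the two-point law, the
    least [u] to consider. As [e] tends to 1 the quartic factor tends to -1, so the gap is really
    negative there and the first estimate is sharp to leading order. *)
Lemma two_point_gap_edge (R : realFieldType) (e : R) : 2^-1 <= e <= 1 ->
  - (1 - e) <= two_point_gap R e (1 - e) /\ (e <= 65 / 100 -> 0 <= two_point_gap R e (1 - e)).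
Proof.
move=> /andP[e1 e2].
have -> : two_point_gap R e (1 - e) =
   (1 - e) * (10 - 24 * e + 16 * e ^+ 2 - 4 * e ^+ 3 + e ^+ 4).
  rewrite /two_point_gap; ring.
split.
  suff : 0 <= (1 - e) * (11 - 24 * e + 16 * e ^+ 2 - 4 * e ^+ 3 + e ^+ 4) by nra.
  have -> : 11 - 24 * e + 16 * e ^+ 2 - 4 * e ^+ 3 + e ^+ 4 =
    (1 - e) ^+ 2 * ((1 - e) ^+ 2 + 10) by ring.
  apply: mulr_ge0; first lra.
  by apply: mulr_ge0; [exact: sqr_ge0 | apply: addr_ge0; [exact: sqr_ge0|lra]].
move=> e3; apply: mulr_ge0; first lra.
have : 0 <= (65 / 100 - e) * (e - 1/2) by apply: mulr_ge0; lra.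
nra.
Qed.

(** [F t] stands for E (Z - t)_+^5. [F_sextic] has the shape of the maximum over [p] of
    [p * (2 * (1 - p) - t) ^+ 5], the case in which only the upper point exceeds [t]; [F_cubic] is
    needed for small [u] only. *)
Section two_point_le.
Context (R : realType) (F : R -> R).
Hypothesis F_ge0 : forall t, 0 <= F t.
Hypothesis F_neg : forall u, 0 <= u ->
  F (- u) = u ^+ 5 + 10 * u ^+ 3 + 15 * u + F u.
Hypothesis F_cubic : forall u, 0 <= u ->
  259 / 100 - 15 / 2 * u + 5 * u ^+ 2 - 5 * u ^+ 3 <= F u.
Hypothesis F_sextic : forall t, 0 <= t <= 2 -> 67 / 2000 * (2 - t) ^+ 6 <= F t.

Lemma two_point_le_mid (p t : R) : 0 <= p <= 1 -> - (2 * p) <= t -> t <= 2 * (1 - p) ->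
  p * (2 * (1 - p) - t) ^+ 5 <= F t.
Proof.
move=> /andP[p0 p1] t1 t2.
have sextic : p * (2 * (1 - p) - t) ^+ 5 <= 67 / 2000 * (2 - t) ^+ 6.
  have := @amgm_one_five R (2 * p) (2 * (1 - p) - t).
  rewrite (_ : 2 * p + _ = 2 - t); last by ring.
  by rewrite mulrAC (mulrC 2 p) mulfK//; apply; lra.
have [t0|t0] := leP 0 t.
  by apply: le_trans sextic _; apply: F_sextic; lra.
pose u := - t; have -> : t = - u by rewrite opprK.
have u0 : 0 <= u by rewrite /u; lra.
rewrite F_neg//.
(* With [w = 2 * (1 - p) + u], the quantity [p * w ^+ 5] is largest over [p] at [w = 5 (2 + u) / 6],
   the equality case of the weighted AM-GM. This point satisfies the constraint [w <= 2] exactly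
   when [u <= 4 / 10]. *)
have [u4|u4] := leP u (4 / 10).
  move: sextic; rewrite (_ : t = - u); last by rewrite opprK.
  move=> /le_trans; apply.
  apply: (@le_trans _ _ (u ^+ 5 + 10 * u ^+ 3 + 15 * u +
     (259 / 100 - 15 / 2 * u + 5 * u ^+ 2 - 5 * u ^+ 3))); last by have := F_cubic _ u0; lra.
  rewrite opprK.
  have : 0 <= u * (4/10 - u) by apply: mulr_ge0; lra.
  have : 0 <= u ^+ 2 * (4/10 - u) by apply: mulr_ge0; [exact: sqr_ge0|lra].
  have : 0 <= u ^+ 3 * (4/10 - u) by apply: mulr_ge0; [exact: exprn_ge0|lra].
  have : 0 <= u ^+ 4 * (4/10 - u) by apply: mulr_ge0; [exact: exprn_ge0|lra].
  have : 0 <= u ^+ 5 * (4/10 - u) by apply: mulr_ge0; [exact: exprn_ge0|lra].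
  have : 0 <= u ^+ 2 by exact: exprn_ge0.
  have : 0 <= u ^+ 3 by exact: exprn_ge0.
  have : 0 <= u ^+ 5 by exact: exprn_ge0.
  nra.
pose w := 2 * (1 - p) + u.
have -> : 2 * (1 - p) - - u = w by rewrite opprK.
have -> : p = (2 + u - w) / 2 by rewrite /w; field.
have w0 : 0 <= w by rewrite /w; lra.
have w2 : w <= 2 by rewrite /w /u; lra.
(* For [u] beyond [4 / 10] the largest value is at the end [w = 2], that is [p = u / 2], and equals
   [16 * u]. The odd polynomial of [F_neg] exceeds it once [10 * u ^+ 2 >= 1]. *)
apply: (@le_trans _ _ (16 * u)).
  rewrite -subr_ge0.
  have -> : 16 * u - (2 + u - w) / 2 * w ^+ 5 = (2 - w) / 2 *
    (u * (w ^+ 4 + 2 * w ^+ 3 + 4 * w ^+ 2 + 8 * w + 16) - w ^+ 5) by field.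
  apply: mulr_ge0; first lra.
  rewrite subr_ge0; apply: (@le_trans _ _ (4 / 10 *
    (w ^+ 4 + 2 * w ^+ 3 + 4 * w ^+ 2 + 8 * w + 16))); last first.
    apply: ler_wpM2r; last exact: ltW.
    by rewrite !addr_ge0 ?mulr_ge0 ?exprn_ge0.
  have : w ^+ 5 <= 2 * w ^+ 4 by rewrite exprS ler_wpM2r ?exprn_ge0.
  have : w ^+ 4 <= 2 * w ^+ 3 by rewrite exprS ler_wpM2r ?exprn_ge0.
  have : w ^+ 3 <= 2 * w ^+ 2 by rewrite exprS ler_wpM2r ?exprn_ge0.
  have : w ^+ 2 <= 2 * w by rewrite exprS expr1 ler_wpM2r ?exprn_ge0.
  lra.
have : 0 <= u ^+ 5 by exact: exprn_ge0.
have : 0 <= u * (u ^+ 2 - (4 / 10) ^+ 2).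
  by apply: mulr_ge0; rewrite // subr_ge0; apply: lerXn2r; rewrite ?nnegrE; lra.
have := F_ge0 u; lra.
Qed.

Lemma two_point_le_low (p t : R) : 0 <= p <= 1 -> t <= - (2 * p) ->
  p * (2 * (1 - p) - t) ^+ 5 + (1 - p) * (- (2 * p) - t) ^+ 5 <= F t.
Proof.
move=> /andP[p0 p1] t1; pose u := - t; have -> : t = - u by rewrite opprK.
have u0 : 0 <= u by rewrite /u; lra.
rewrite F_neg// !opprK; pose e := 1 - 2 * p.
have ue : 1 - e <= u by rewrite /u /e; lra.
have -> : p * (2 * (1 - p) + u) ^+ 5 + (1 - p) * (- (2 * p) + u) ^+ 5 =
  u ^+ 5 + 10 * u ^+ 3 + 15 * u - two_point_gap R e u.
  by rewrite /two_point_gap /e; field.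
suff : 0 <= two_point_gap R e u + F u by lra.
have [e0|e0] := leP e 0.
  apply: addr_ge0 => //; rewrite /two_point_gap.
  have e1 : -1 <= e by rewrite /e; lra.
  have h1 : 0 <= u * (u * e - (1 - e ^+ 2)) ^+ 2 by rewrite mulr_ge0// sqr_ge0.
  have h2 : 0 <= u * (10 * e ^+ 2 + 5 * e ^+ 4).
    by rewrite mulr_ge0// addr_ge0// mulr_ge0// exprn_even_ge0.
  have h3 : 0 <= - e * (1 - e ^+ 4).
    apply: mulr_ge0; first lra.
    have : e ^+ 2 <= 1 by nra.
    have : 0 <= e ^+ 2 by exact: sqr_ge0.
    by rewrite (_ : e ^+ 4 = e ^+ 2 * e ^+ 2); [nra|ring].
  lra.
have [e5|e5] := leP e 2^-1.
  by apply: addr_ge0 => //; apply: two_point_gap_ge0_half; rewrite // ltW.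
have e1 : e <= 1 by rewrite /e; lra.
have ee : 2^-1 <= e <= 1 by rewrite ltW.
have [g1 g2] := @two_point_gap_edge R e ee.
have G1 : two_point_gap R e (1 - e) <= two_point_gap R e u by apply: two_point_gap_nd; rewrite ?subr_ge0.
have [e65|e65] := leP e (65 / 100).
  by apply: addr_ge0 => //; apply: le_trans G1; exact: g2.
have [u35|u35] := leP u (35 / 100); last first.
  apply: addr_ge0 => //; apply: le_trans (two_point_gap_nd _ _ _ _ ee _ (ltW u35)).
    by apply: two_point_gap_ge0_35; rewrite ltW.
  lra.
(* Here the gap is at least [- (1 - e) >= - u], and the cubic lower bound on [F u] still exceeds [u]
   at [35 / 100], which explains that number. *)
have := F_cubic _ u0.
have : 0 <= u * (35/100 - u) by apply: mulr_ge0; lra.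
have : 0 <= u ^+ 2 * (35/100 - u) by apply: mulr_ge0; [exact: sqr_ge0|lra].
nra.
Qed.

Lemma two_point_le (p t : R) : 0 <= p <= 1 ->
  p * pos5 (2 * (1 - p) - t) + (1 - p) * pos5 (- (2 * p) - t) <= F t.
Proof.
move=> p01; have /andP[p0 p1] := p01.
have [t1|t1] := leP t (- (2 * p)).
  by rewrite !pos5_id; [exact: two_point_le_low|lra|lra].
rewrite (@pos5_eq0 _ (- (2 * p) - t)) ?mulr0 ?addr0; last by lra.
have [t2|t2] := leP t (2 * (1 - p)).
  by rewrite pos5_id ?subr_ge0//; apply: two_point_le_mid => //; exact: ltW.
by rewrite pos5_eq0 ?mulr0//; lra.
Qed.

End two_point_le.

(** * Gaussian integrals *)

Lemma is_derive1_continuous (R : realType) (f : R -> R) (x a : R) :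
  is_derive x 1 f a -> {for x, continuous f}.
Proof.
by move=> [df _]; exact/differentiable_continuous/derivable1_diffP.
Qed.

Lemma cvg_powexp (R : realType) (k : nat) :
  (fun x : R => x ^+ k * expR (- x)) x @[x --> +oo] --> (0 : R).
Proof.
(* From [expR x >= (x / (k + 1)) ^ (k + 1)], one power more than has to be absorbed. *)
pose K : R := k.+1%:R ^+ k.+1.
apply: (@squeeze_cvgr _ _ _ _ (cst 0) (fun x => K * x^-1)).
- near=> x; have x0 : 0 < x by near: x; exact: nbhs_pinfty_gt.
  apply/andP; split; first by apply: mulr_ge0; [apply: exprn_ge0; exact: ltW|exact: expR_ge0].
  rewrite ler_pdivlMr// mulrAC -exprSr expRN ler_pdivrMr ?expR_gt0//.
  have k0 : 0 < k.+1%:R :> R by rewrite ltr0n.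
  have -> : x = k.+1%:R * (x / k.+1%:R) by rewrite mulrCA divff ?mulr1// gt_eqF.
  rewrite exprMn expRM_natl; apply: ler_wpM2l; first by rewrite exprn_ge0.
  have y0 : 0 <= x / k.+1%:R by apply: divr_ge0; exact: ltW.
  apply: lerXn2r; rewrite ?nnegrE ?expR_ge0//.
  by apply: le_trans (expR_ge1Dx _); rewrite lerDr.
- exact: cvg_cst.
- rewrite -[X in _ --> X](mulr0 K); apply: cvgM; first exact: cvg_cst.
  by apply/gtr0_cvgV0; [exact: nbhs_pinfty_gt|exact: cvg_id].
Unshelve. all: by end_near. Qed.

Lemma integral_cy_FTC (R : realType) (f F : R -> R) (a : R) :
  (forall x, a <= x -> 0 <= f x) -> continuous f ->
  (forall x : R, is_derive x 1 F (f x)) -> F x @[x --> +oo] --> (0 : R) ->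
  (\int[lebesgue_measure]_(x in `[a, +oo[) (f x)%:E = (- F a)%:E)%E.
Proof.
move=> f0 cf dF F0.
have dFx (x : R) : derivable F x 1 by have [] := dF x.
rewrite (@ge0_continuous_FTC2y R f F a 0)//.
- by rewrite -EFinB sub0r.
- exact: continuous_subspaceT.
- by apply: cvg_at_right_filter; apply: is_derive1_continuous (dF a).
- by move=> x _; rewrite derive1E; have [_ ->] := dF x.
Qed.

Lemma measurable_continuous (R : realType) (f : R -> R) (D : set R) :
  continuous f -> measurable_fun D f.
Proof. by move=> cf; apply: measurable_funTS => //; exact: continuous_measurable_fun. Qed.

Lemma measurable_EFin_continuous (R : realType) (f : R -> R) (D : set R) :
  continuous f -> measurable_fun D (EFin \o f).
Proof. by move=> cf; apply/measurable_EFinP; exact: measurable_continuous. Qed.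

Section gaussian.
Context {R : realType}.
Local Notation mu := (@lebesgue_measure R).

Definition gphi (z : R) : R := normal_peak 1 * expR (- z ^+ 2 / 2).

Lemma gphiE : normal_pdf 0 1 = gphi.
Proof.
rewrite normal_pdfE ?oner_neq0//; apply/funext => z.
by rewrite /gphi /normal_fun subr0 expr1n.
Qed.

Lemma gpeak_gt0 : 0 < normal_peak 1 :> R.
Proof. by apply: normal_peak_gt0; rewrite oner_neq0. Qed.

Lemma gphi_gt0 z : 0 < gphi z.
Proof. by rewrite mulr_gt0 ?gpeak_gt0 ?expR_gt0. Qed.

Lemma gphi_ge0 z : 0 <= gphi z. Proof. exact/ltW/gphi_gt0. Qed.

Lemma gphiN z : gphi (- z) = gphi z.
Proof. by rewrite /gphi sqrrN. Qed.

Lemma gphi_le z : gphi z <= normal_peak 1.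
Proof.
rewrite /gphi ler_piMr ?normal_peak_ge0// -expR0 ler_expR.
by rewrite mulNr oppr_le0 divr_ge0 ?sqr_ge0.
Qed.

Global Instance is_derive_gphi (z : R) : is_derive z 1 gphi (- z * gphi z).
Proof.
rewrite /gphi; apply: is_derive_eq.
by rewrite /GRing.scale/=; field.
Qed.

Lemma gphi_continuous : continuous gphi.
Proof. by move=> z; apply: is_derive1_continuous (is_derive_gphi z). Qed.

Lemma cvg_powgphi (k : nat) : (fun x => x ^+ k * gphi x) x @[x --> +oo] --> (0 : R).
Proof.
(* Since [- x ^ 2 / 2 <= 1 / 2 - x], the exponential decay just treated suffices. *)
pose K : R := normal_peak 1 * expR (2^-1).
apply: (@squeeze_cvgr _ _ _ _ (cst 0) (fun x => K * (x ^+ k * expR (- x)))).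
- near=> x; have x0 : 0 < x by near: x; exact: nbhs_pinfty_gt.
  have xk : 0 <= x ^+ k by apply: exprn_ge0; exact: ltW.
  apply/andP; split; first by apply: mulr_ge0; [|exact: gphi_ge0].
  rewrite [leRHS]mulrCA; apply: ler_wpM2l => //.
  rewrite /K /gphi -mulrA; apply: ler_wpM2l; first exact: normal_peak_ge0.
  rewrite -expRD ler_expR.
  rewrite -subr_ge0 (_ : _ - _ = (x - 1) ^+ 2 / 2); last by field.
  by rewrite divr_ge0 ?sqr_ge0.
- exact: cvg_cst.
- by rewrite -[X in _ --> X](mulr0 K); apply: cvgM; [exact: cvg_cst|exact: cvg_powexp].
Unshelve. all: by end_near. Qed.

Lemma integral_gphi : (\int[mu]_z (gphi z)%:E = 1)%E.
Proof. by rewrite -gphiE integral_normal_pdf. Qed.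

Lemma continuous_powgphi k : continuous (fun z : R => z ^+ k * gphi z).
Proof.
move=> z; apply: cvgM; last exact: gphi_continuous.
exact: exprn_continuous.
Qed.

Lemma integral_expN : (\int[mu]_(z in `[0%R, +oo[) (expR (- z))%:E = 1)%E.
Proof.
have dF (x : R) : is_derive x 1 (fun z => - expR (- z)) (expR (- x)).
  by apply: is_derive_eq; rewrite /GRing.scale/=; ring.
rewrite (@integral_cy_FTC R _ _ _ _ _ dF).
- by rewrite oppr0 expR0 opprK.
- by move=> x _; exact: expR_ge0.
- by move=> x; apply: continuous_comp; [exact: opp_continuous|exact: continuous_expR].
- rewrite -[X in _ --> X]oppr0; apply: cvgN; exact: cvgr_expR.
Qed.

(** Integration by parts: [(z ^ (k + 2) - (k + 1) z ^ k) * gphi z] is the derivative of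
    [- z ^ (k + 1) * gphi z], which vanishes at 0 and at infinity. *)
Lemma half_moment_rec k :
  (\int[mu]_(z in `[0%R, +oo[) (z ^+ k.+2 * gphi z)%:E =
  k.+1%:R%:E * \int[mu]_(z in `[0%R, +oo[) (z ^+ k * gphi z)%:E)%E.
Proof.
(* The added multiple of [expR (- z)] makes the integrand nonnegative. *)
pose C : R := normal_peak 1 * (k.+1%:R ^+ k.+1 * expR k.+1%:R).
have C0 : 0 <= C by rewrite !mulr_ge0 ?exprn_ge0 ?expR_ge0 ?normal_peak_ge0.
pose f (z : R) := (z ^+ k.+2 - k.+1%:R * z ^+ k) * gphi z + C * expR (- z).
pose F (z : R) := - (z ^+ k.+1 * gphi z) - C * expR (- z).
have cexp : continuous (fun z : R => expR (- z)).
  by move=> x; apply: continuous_comp; [exact: opp_continuous|exact: continuous_expR].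
have f0 (z : R) : 0 <= z -> 0 <= f z.
  move=> z0; rewrite /f.
  have [zk|zk] := leP k.+1%:R (z ^+ 2).
    apply: addr_ge0; last by apply: mulr_ge0; [exact: C0|exact: expR_ge0].
    apply: mulr_ge0; last exact: gphi_ge0.
    rewrite -addn2 exprD mulrC -mulrBl; apply: mulr_ge0; last exact: exprn_ge0.
    by rewrite subr_ge0.
  have zk1 : z <= k.+1%:R.
    have k1 : 1 <= k.+1%:R :> R by rewrite ler1n.
    by nra.
  rewrite mulrBl -addrA; apply: addr_ge0.
    by apply: mulr_ge0; [exact: exprn_ge0|exact: gphi_ge0].
  rewrite addrC subr_ge0 -mulrA.
  apply: (@le_trans _ _ (k.+1%:R * (k.+1%:R ^+ k * normal_peak 1))).
    apply: ler_wpM2l => //; apply: ler_pM; [exact: exprn_ge0|exact: gphi_ge0| |exact: gphi_le].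
    by apply: lerXn2r; rewrite ?nnegrE.
  have -> : k.+1%:R * (k.+1%:R ^+ k * normal_peak 1) =
      normal_peak 1 * (k.+1%:R ^+ k.+1 * 1) :> R by rewrite exprS; ring.
  rewrite /C -!mulrA; apply: ler_wpM2l; first exact: normal_peak_ge0.
  apply: ler_wpM2l; first exact: exprn_ge0.
  by rewrite -expRD; apply: le_trans (expR_ge1Dx _); rewrite lerDl subr_ge0.
have cf : continuous f.
  move=> z; apply: cvgD; last by apply: cvgM; [exact: cvg_cst|exact: cexp].
  apply: cvgM; last exact: gphi_continuous.
  apply: cvgB; first exact: exprn_continuous.
  by apply: cvgM; [exact: cvg_cst|exact: exprn_continuous].
have If : (\int[mu]_(z in `[0%R, +oo[) (f z)%:E = C%:E)%E.
  have dF (z : R) : is_derive z 1 F (f z).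
    rewrite /F /f.
    have dX : is_derive z 1 (fun z0 : R => z0 ^+ k.+1) (k.+1%:R * z ^+ k).
      have := @is_deriveX _ _ (@id R) k.+1 z 1 1 (is_derive_id _ _).
      rewrite /GRing.scale/= mulr1; congr (is_derive _ _ _ _).
      by rewrite exprfctE.
    apply: is_derive_eq; rewrite /GRing.scale/= !exprS.
    ring.
  rewrite (@integral_cy_FTC R _ _ _ f0 cf dF).
  - by rewrite /F oppr0 expR0 exprS !mul0r oppr0 sub0r opprK mulr1.
  - rewrite /F -[X in _ --> X]subr0 -{1}oppr0 -{2}(mulr0 C); apply: cvgB.
      by apply: cvgN; exact: cvg_powgphi.
    by apply: cvgM; [exact: cvg_cst|exact: cvgr_expR].
have mf (g : R -> R) : continuous g ->
    measurable_fun (`[0%R, +oo[%classic : set R) (EFin \o g).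
  exact: measurable_EFin_continuous.
have IC : (\int[mu]_(z in `[0%R, +oo[) (C * expR (- z))%:E = C%:E)%E.
  under eq_integral do rewrite EFinM.
  rewrite ge0_integralZl//=; last exact: mf.
  by rewrite integral_expN mule1.
have addI (u v : \bar R) : (C%:E + u = C%:E + v -> u = v)%E.
  by move=> /(congr1 (fun w => w - C%:E)%E); rewrite ![(C%:E + _)%E]addeC !addeK.
apply: addI.
pose g (z : R) := z ^+ k.+2 * gphi z.
pose h (z : R) := k.+1%:R * (z ^+ k * gphi z).
have cg : continuous g by exact: continuous_powgphi.
have ch : continuous h.
  by move=> z; apply: cvgM; [exact: cvg_cst|exact: continuous_powgphi].
have g0 z : 0 <= z -> 0 <= g z by move=> z0; rewrite mulr_ge0 ?gphi_ge0 ?exprn_ge0.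
have h0 (z : R) : 0 <= z -> 0 <= h z.
  move=> z0; apply: mulr_ge0 => //.
  by apply: mulr_ge0; [exact: exprn_ge0|exact: gphi_ge0].
have in0y (z : R) : `[0%R, +oo[%classic z -> 0 <= z by rewrite /= in_itv/= andbT.
have -> : (k.+1%:R%:E * \int[mu]_(z in `[0%R, +oo[) (z ^+ k * gphi z)%:E =
    \int[mu]_(z in `[0%R, +oo[) (h z)%:E)%E.
  under [RHS]eq_integral do rewrite EFinM.
  rewrite ge0_integralZl//=.
    by apply: mf; exact: continuous_powgphi.
  by move=> z /in0y z0; rewrite lee_fin mulr_ge0 ?gphi_ge0 ?exprn_ge0.
rewrite -{1}IC -If -!ge0_integralD//=; last 8 first.
- by move=> z /in0y z0; rewrite lee_fin f0.
- exact: mf.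
- by move=> z /in0y z0; rewrite lee_fin h0.
- exact: mf.
- by move=> z /in0y z0; rewrite lee_fin mulr_ge0 ?expR_ge0.
- by apply: mf => z; apply: cvgM; [exact: cvg_cst|exact: cexp].
- by move=> z /in0y z0; rewrite lee_fin g0.
- exact: mf.
apply: eq_integral => z _; rewrite -!EFinD; congr EFin.
rewrite /f /g /h; ring.
Qed.

Lemma continuous_comp_affine (f : R -> R) (a b : R) : continuous f ->
  continuous (fun x => f (a * x + b)).
Proof.
move=> cf x; apply: (@continuous_comp _ _ _ (fun x => a * x + b) f); last exact: cf.
by apply: cvgD; [apply: cvgM; [exact: cvg_cst|exact: cvg_id]|exact: cvg_cst].
Qed.

Lemma pos5_continuous : continuous (@pos5 R).
Proof.
move=> x.
apply: (@continuous_comp _ _ _ (cst 0 \max (@id R)) (fun u : R => u ^+ 5)).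
  by apply: continuous_max; [exact: cst_continuous|exact: cvg_id].
exact: exprn_continuous.
Qed.

Lemma integral_affine (G : R -> R) (a b : R) : 0 < a -> continuous G ->
  (forall x, 0 <= G x) ->
  (\int[mu]_x (G x)%:E = \int[mu]_x (G (a * x + b) * a)%:E)%E.
Proof.
move=> a0 cG G0; pose F (x : R) := a * x + b.
have dF (x : R) : is_derive x 1 F a.
  by rewrite /F; apply: is_derive_eq; rewrite /GRing.scale/=; ring.
have F'E : F^`()%classic = cst a.
  by apply/funext => x; rewrite derive1E; have [_ ->] := dF x.
rewrite (@increasing_ge0_integration_by_substitutionT R F G)//.
- by rewrite F'E.
- by move=> x y xy; rewrite /F ltrD2r ltr_pM2l.
- by rewrite F'E; exact: cst_continuous.
- by rewrite F'E; exact: is_cvg_cst.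
- by rewrite F'E; exact: is_cvg_cst.
- rewrite /F; apply/cvgrNyPle => A; near=> x.
  rewrite -lerBrDr -ler_pdivlMl//; near: x; exact: nbhs_ninfty_le.
- rewrite /F; apply/cvgryPge => A; near=> x.
  rewrite -lerBlDr -ler_pdivrMl//; near: x; exact: nbhs_pinfty_ge.
Unshelve. all: by end_near. Qed.

Lemma integral_gphi_fold (h : R -> R) : (forall x, 0 <= h x) -> measurable_fun [set: R] h ->
  (\int[mu]_z (h z * gphi z)%:E =
   \int[mu]_(z in `[0%R, +oo[) ((h z + h (- z)) * gphi z)%:E)%E.
Proof.
move=> h0 mh.
have mg : measurable_fun [set: R] gphi.
  by apply: continuous_measurable_fun; exact: gphi_continuous.
have mhg : measurable_fun [set: R] (fun z : R => (h z * gphi z)%:E).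
  by apply/measurable_EFinP/measurable_funM.
have mhN : measurable_fun [set: R] (fun z : R => (h (- z) * gphi z)%:E).
  apply/measurable_EFinP/measurable_funM => //.
  by apply: measurableT_comp => //; exact: oppr_measurable.
have hg0 z : 0 <= h z * gphi z by rewrite mulr_ge0 ?gphi_ge0.
have hN0 z : 0 <= h (- z) * gphi z by rewrite mulr_ge0 ?gphi_ge0.
rewrite -(setUv `[0%R, +oo[%classic) ge0_integral_setU//=; last 4 first.
- exact: measurableC.
- exact: measurable_funTS.
- by move=> z _; rewrite lee_fin.
- exact/disj_setPCl.
under [RHS]eq_integral do rewrite mulrDl EFinD.
rewrite ge0_integralD//=; last 4 first.
- by move=> z _; rewrite lee_fin.
- exact: measurable_funTS.
- by move=> z _; rewrite lee_fin.
- exact: measurable_funTS.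
congr (_ + _)%E.
rewrite setCitvr/= integral_itv_bndo_bndc; last exact: measurable_funTS.
rewrite (@ge0_integration_by_substitution0 R (fun z => (h (- z) * gphi z)%:E))//.
by apply: eq_integral => z _; rewrite opprK gphiN.
Qed.

Lemma half_moment0 : (\int[mu]_(z in `[0%R, +oo[) (gphi z)%:E = (2^-1)%:E)%E.
Proof.
have := integral_gphi.
have -> : (\int[mu]_z (gphi z)%:E = \int[mu]_z (cst 1 z * gphi z)%:E)%E.
  by apply: eq_integral => z _; rewrite /= mul1r.
rewrite integral_gphi_fold//=.
have -> : (\int[mu]_(z in `[0%R, +oo[) ((1 + 1) * gphi z)%:E =
   2%:E * \int[mu]_(z in `[0%R, +oo[) (gphi z)%:E)%E.
  under eq_integral do rewrite EFinM.
  rewrite ge0_integralZl//=.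
  - by apply: measurable_EFin_continuous; exact: gphi_continuous.
  - by move=> z _; rewrite lee_fin gphi_ge0.
case: (\int[mu]_(z in _) _)%E => [r|/=|/=].
- by rewrite -EFinM => -[h]; congr EFin; lra.
- by rewrite mulry gtr0_sg ?mul1e//; lra.
- by rewrite mulrNy gtr0_sg ?mul1e//; lra.
Qed.

Lemma half_moment1 : (\int[mu]_(z in `[0%R, +oo[) (z ^+ 1 * gphi z)%:E =
  (gphi 0)%:E)%E.
Proof.
have dF (z : R) : is_derive z 1 (fun z => - gphi z) (z ^+ 1 * gphi z).
  by apply: is_derive_eq; rewrite expr1; ring.
rewrite (@integral_cy_FTC R _ _ _ _ _ dF) ?opprK//.
- by move=> z z0; rewrite mulr_ge0 ?gphi_ge0.
- exact: continuous_powgphi.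
- rewrite -[X in _ --> X]oppr0; apply: cvgN.
  by have := cvg_powgphi 0; under eq_fun do rewrite expr0 mul1r.
Qed.

Lemma half_moment_fin k :
  (\int[mu]_(z in `[0%R, +oo[) (z ^+ k * gphi z)%:E < +oo)%E.
Proof.
elim/ltn_ind: k => -[_|[_|k IH]].
- under eq_integral do rewrite expr0 mul1r.
  by rewrite half_moment0 ltry.
- by rewrite half_moment1 ltry.
- rewrite half_moment_rec lte_mul_pinfty//; exact: IH.
Qed.

Lemma integrable_powgphi k :
  mu.-integrable `[0%R, +oo[ (EFin \o (fun z : R => z ^+ k * gphi z)).
Proof.
apply/integrableP; split.
  by apply: measurable_EFin_continuous; exact: continuous_powgphi.
apply: le_lt_trans (half_moment_fin k); rewrite le_eqVlt; apply/orP; left.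
apply/eqP/eq_integral => z; rewrite inE/= in_itv/= andbT => z0.
by rewrite /= ger0_norm// mulr_ge0 ?gphi_ge0 ?exprn_ge0.
Qed.

Definition half_gauss (h : R -> R) : R := \int[mu]_(z in `[0, +oo[) (h z * gphi z).

Lemma half_gauss_even : [/\ half_gauss (fun z => z ^+ 0) = 2^-1, half_gauss (fun z => z ^+ 2) = 2^-1,
  half_gauss (fun z => z ^+ 4) = 3 / 2 & half_gauss (fun z => z ^+ 6) = 15 / 2].
Proof.
have h0 : half_gauss (fun z => z ^+ 0) = 2^-1.
  rewrite /half_gauss /Rintegral; under eq_integral do rewrite expr0 mul1r.
  by rewrite half_moment0.
have hS k : half_gauss (fun z => z ^+ k.+2) = k.+1%:R * half_gauss (fun z => z ^+ k).
  by rewrite /half_gauss /Rintegral half_moment_rec fineM// integrable_fin_num//; exact: integrable_powgphi.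
by split; rewrite ?hS h0; field.
Qed.

(** The Radon-Nikodym derivative of the normal law and [gphi] have the same integral over every
    measurable set, so they agree almost everywhere and may be exchanged under the integral. *)
Lemma integral_density (h : R -> \bar R) :
  (forall x, (0 <= h x)%E) -> measurable_fun [set: R] h ->
  (\int[normal_prob (0 : R) 1]_z h z = \int[mu]_z (h z * (gphi z)%:E))%E.
Proof.
move=> h0 mh.
pose N : probability _ R := normal_prob (0 : R) 1.
have NU : N `<< mu by exact: normal_prob_dominates.
have gint : mu.-integrable [set: R] (EFin \o gphi).
  by have := @integrable_normal_pdf R 0 1; rewrite gphiE.
rewrite -[LHS](Radon_Nikodym_SigmaFinite.change_of_variables (nu := N) NU)//.
apply: ge0_ae_eq_integral => //.
- apply: emeasurable_funM => //.
  exact: measurable_int (Radon_Nikodym_SigmaFinite.f_integrable NU).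
- apply: emeasurable_funM => //; exact: measurable_int gint.
- by move=> x _; rewrite mule_ge0// Radon_Nikodym_SigmaFinite.f_ge0.
- by move=> x _; rewrite mule_ge0// lee_fin gphi_ge0.
apply: ae_eqe_mul2l => /=.
apply: integral_ae_eq => //.
- exact: Radon_Nikodym_SigmaFinite.f_integrable NU.
- exact: measurable_int gint.
- move=> E _ mE; rewrite -Radon_Nikodym_SigmaFinite.f_integral//.
  by rewrite -gphiE.
Qed.

Lemma integrable_even_poly_gphi (a b c e : R) : mu.-integrable `[0%R, +oo[
  (EFin \o (fun z : R => (a + b * z ^+ 2 + c * z ^+ 4 + e * z ^+ 6) * gphi z)).
Proof.
have i k (r : R) : mu.-integrable `[0%R, +oo[ (fun z : R => (r%:E * (z ^+ k * gphi z)%:E)%E).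
  by apply: integrableZl => //; exact: integrable_powgphi.
have := integrableD _ (integrableD _ (integrableD _ (i 0%N a) (i 2%N b)) (i 4%N c)) (i 6%N e).
move=> /(_ _ _ _) H.
apply: eq_integrable (H _ _ _) => //.
by move=> z _; rewrite /= -!EFinM -!EFinD; congr EFin; ring.
Qed.

Lemma half_gauss_even_poly (a b c e : R) :
  half_gauss (fun z => a + b * z ^+ 2 + c * z ^+ 4 + e * z ^+ 6) =
  a / 2 + b / 2 + c * (3 / 2) + e * (15 / 2).
Proof.
have [h0 h2 h4 h6] := half_gauss_even.
have i k : mu.-integrable `[0%R, +oo[ (EFin \o (fun z : R => z ^+ k * gphi z)).
  exact: integrable_powgphi.
have j k (r : R) : mu.-integrable `[0%R, +oo[ (EFin \o (fun z : R => r * (z ^+ k * gphi z))).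
  under [X in _.-integrable _ X]eq_fun do rewrite /= EFinM.
  by apply: integrableZl => //; exact: integrable_powgphi.
transitivity (a * half_gauss (fun z => z ^+ 0) + b * half_gauss (fun z => z ^+ 2) +
  c * half_gauss (fun z => z ^+ 4) + e * half_gauss (fun z => z ^+ 6)); last first.
  by rewrite h0 h2 h4 h6.
have D (f g : R -> R) : mu.-integrable `[0%R, +oo[ (EFin \o f) ->
    mu.-integrable `[0%R, +oo[ (EFin \o g) ->
    mu.-integrable `[0%R, +oo[ (EFin \o (fun z => f z + g z)).
  move=> fi gi; apply: eq_integrable (integrableD _ fi gi) => //.
rewrite /half_gauss -!RintegralZl//.
have ab := D _ _ (j 0%N a) (j 2%N b).
have abc := D _ _ ab (j 4%N c).
rewrite -(RintegralD _ (j 0%N a) (j 2%N b))// -(RintegralD _ ab (j 4%N c))//.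
rewrite -(RintegralD _ abc (j 6%N e))//.
by apply: eq_Rintegral => z _; rewrite /=; ring.
Qed.

Lemma integral_pos5B_half (u : R) : 0 <= u -> (\int[mu]_z (pos5 (z - u) * gphi z)%:E =
  \int[mu]_(z in `[0%R, +oo[) (pos5 (z - u) * gphi z)%:E)%E.
Proof.
move=> u0; rewrite (@integral_gphi_fold (fun z => pos5 (z - u))).
- apply: eq_integral => z; rewrite inE/= in_itv/= andbT => z0.
  by rewrite (@pos5_eq0 _ (- z - u)) ?addr0//; lra.
- by move=> z; exact: pos5_ge0.
- apply: measurable_continuous => z.
  apply: (@continuous_comp _ _ _ (fun z => z - u)); last exact: pos5_continuous.
  by apply: cvgB; [exact: cvg_id|exact: cvg_cst].
Qed.

Lemma continuous_pos5B (u : R) : continuous (fun z : R => pos5 (z - u)).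
Proof.
move=> z.
apply: (@continuous_comp _ _ _ (fun z => z - u)); last exact: pos5_continuous.
by apply: cvgB; [exact: cvg_id|exact: cvg_cst].
Qed.

Lemma continuous_Mgphi (f : R -> R) : continuous f -> continuous (fun z => f z * gphi z).
Proof. by move=> cf z; apply: cvgM; [exact: cf|exact: gphi_continuous]. Qed.

Lemma integrable_pos5B (u : R) : 0 <= u ->
  mu.-integrable `[0%R, +oo[ (EFin \o (fun z : R => pos5 (z - u) * gphi z)).
Proof.
move=> u0; apply: le_integrable (integrable_powgphi 5) => //.
- by apply: measurable_EFin_continuous; apply: continuous_Mgphi; exact: continuous_pos5B.
- move=> z; rewrite /= in_itv/= andbT => z0; rewrite lee_fin.
  have g0 := gphi_ge0 z; have p0 := @pos5_ge0 R (z - u).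
  rewrite ger0_norm; last by apply: mulr_ge0; [exact: p0|exact: g0].
  rewrite ger0_norm; last by apply: mulr_ge0; [exact: exprn_ge0|exact: g0].
  apply: ler_wpM2r; first exact: g0.
  by rewrite -(@pos5_id R z z0); apply: pos5_mono; rewrite gerBl.
Qed.

Definition gF (t : R) : R := \int[mu]_z (pos5 (z - t) * gphi z).

Lemma gF_ge0 t : 0 <= gF t.
Proof. by apply: Rintegral_ge0 => z _; rewrite mulr_ge0 ?pos5_ge0 ?gphi_ge0. Qed.

Lemma gF_pos (u : R) : 0 <= u -> gF u = half_gauss (fun z => pos5 (z - u)).
Proof. by move=> u0; rewrite /gF /Rintegral integral_pos5B_half. Qed.

(** For [z >= 0], (z + u)_+^5 + (u - z)_+^5 = (u + z)^5 + (u - z)^5 + (z - u)_+^5, and the first two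
    terms on the right add up to an even polynomial in [z], whose half-line moments are rational. *)
Lemma gFN_itv (u : R) : 0 <= u ->
  (\int[mu]_z (pos5 (z - - u) * gphi z)%:E =
   (u ^+ 5 + 10 * u ^+ 3 + 15 * u + gF u)%:E)%E.
Proof.
move=> u0; rewrite (@integral_gphi_fold (fun z => pos5 (z - - u))); last 2 first.
- by move=> z; exact: pos5_ge0.
- by apply: measurable_continuous; exact: continuous_pos5B.
have il := integrable_even_poly_gphi (2 * u ^+ 5) (20 * u ^+ 3) (10 * u) 0.
have ip := integrable_pos5B _ u0.
rewrite gF_pos//.
have -> : u ^+ 5 + 10 * u ^+ 3 + 15 * u =
   half_gauss (fun z => 2 * u ^+ 5 + 20 * u ^+ 3 * z ^+ 2 + 10 * u * z ^+ 4 + 0 * z ^+ 6).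
  by rewrite half_gauss_even_poly; field.
rewrite /half_gauss EFinD /Rintegral !fineK; try exact: integrable_fin_num.
rewrite -integralD//.
apply: eq_integral => z; rewrite inE/= in_itv/= andbT => z0; congr EFin.
rewrite -mulrDl; congr (_ * _).
rewrite (@pos5_id _ (z - - u)) ?subr_ge0; last by lra.
have [zu|zu] := leP z u.
  by rewrite (@pos5_eq0 _ (z - u)) ?(@pos5_id _ (- z - - u)); [ring|lra|lra].
by rewrite (@pos5_id _ (z - u)) ?(@pos5_eq0 _ (- z - - u)); [ring|lra|lra].
Qed.

Lemma gF_neg (u : R) : 0 <= u -> gF (- u) = u ^+ 5 + 10 * u ^+ 3 + 15 * u + gF u.
Proof. by move=> u0; rewrite {1}/gF /Rintegral gFN_itv. Qed.

(** [gF] is a real-valued integral, which would read 0 if the integral were infinite; what is gained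
    here is finiteness. *)
Lemma gFE (t : R) : (\int[mu]_z (pos5 (z - t) * gphi z)%:E = (gF t)%:E)%E.
Proof.
have [t0|t0] := leP 0 t.
  rewrite integral_pos5B_half// gF_pos// /half_gauss /Rintegral fineK//.
  by apply: integrable_fin_num => //; exact: integrable_pos5B.
have u0 : 0 <= - t by rewrite oppr_ge0 ltW.
by rewrite -(opprK t) gFN_itv// (gF_neg _ u0).
Qed.

(* Tangent-line lower bounds, at [17/10] for [z^5 = (z^2)^(5/2)] and at [1] for
   [z^3 = (z^2)^(3/2)], leave only even powers of [z]. *)
Lemma expr5_ge_even (z : R) : 0 <= z ->
  51 / 20 * z ^+ 4 - (17 / 10) ^+ 3 / 2 * z ^+ 2 <= z ^+ 5.
Proof.
move=> z0; rewrite -subr_ge0.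
have -> : z ^+ 5 - (51 / 20 * z ^+ 4 - (17 / 10) ^+ 3 / 2 * z ^+ 2) =
  z ^+ 2 * ((z - 17 / 10) ^+ 2 * (z + 17 / 20)) by field.
by apply: mulr_ge0; [exact: sqr_ge0|apply: mulr_ge0; [exact: sqr_ge0|lra]].
Qed.

(** The first four terms of the binomial expansion of [(z - u) ^ 5] bound it from below for
    [z >= u], the rest being [u ^ 4 (5 z - u)], and are nonpositive in sum for [z <= u]. The tangent
    lines then remove [z ^ 5] and [z ^ 3]. *)
Lemma pos5B_ge_even (u z : R) : 0 <= u -> 0 <= z ->
  - 5 * u ^+ 2 + (- (17 / 10) ^+ 3 / 2 + 15 * u ^+ 2 - 10 * u ^+ 3) * z ^+ 2
  + (51 / 20 - 5 * u) * z ^+ 4 + 0 * z ^+ 6 <= pos5 (z - u).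
Proof.
move=> u0 z0; have h5 := expr5_ge_even _ z0.
have h3 : 3 / 2 * z ^+ 2 - 2^-1 <= z ^+ 3.
  rewrite -subr_ge0.
  have -> : z ^+ 3 - (3 / 2 * z ^+ 2 - 2^-1) = (z - 1) ^+ 2 * (z + 2^-1) by field.
  by apply: mulr_ge0; [exact: sqr_ge0|lra].
apply: (@le_trans _ _ (z ^+ 5 - 5 * u * z ^+ 4 + 10 * u ^+ 2 * z ^+ 3 - 10 * u ^+ 3 * z ^+ 2)).
  have : u ^+ 2 * (3 / 2 * z ^+ 2 - 2^-1) <= u ^+ 2 * z ^+ 3.
    by apply: ler_wpM2l => //; exact: sqr_ge0.
  lra.
have [zu|zu] := leP z u.
  rewrite pos5_eq0 ?subr_le0//.
  pose y := u - z; have y0 : 0 <= y by rewrite subr_ge0.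
  have -> : u = z + y by rewrite /y; ring.
  rewrite -subr_ge0.
  have -> : 10 * (z + y) ^+ 3 * z ^+ 2 - (z ^+ 5 - 5 * (z + y) * z ^+ 4 + 10 * (z + y) ^+ 2 * z ^+ 3) =
    z ^+ 2 * (4 * z ^+ 3 + 15 * (z ^+ 2 * y) + 20 * (z * y ^+ 2) + 10 * y ^+ 3) by ring.
  apply: mulr_ge0; first exact: sqr_ge0.
  have zy : 0 <= z ^+ 2 * y by apply: mulr_ge0; [exact: sqr_ge0|].
  have yz : 0 <= z * y ^+ 2 by apply: mulr_ge0; [|exact: sqr_ge0].
  have z3 : 0 <= z ^+ 3 by exact: exprn_ge0.
  have y3 : 0 <= y ^+ 3 by exact: exprn_ge0.
  lra.
rewrite pos5_id ?subr_ge0; last exact: ltW.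
rewrite -subr_ge0.
have -> : (z - u) ^+ 5 - (z ^+ 5 - 5 * u * z ^+ 4 + 10 * u ^+ 2 * z ^+ 3 - 10 * u ^+ 3 * z ^+ 2)
  = u ^+ 4 * (4 * z + (z - u)) by ring.
by apply: mulr_ge0; [exact: exprn_ge0|lra].
Qed.

(** [259 / 100] rounds down [51/20 * 3/2 - (17/10)^3 / 4 = 2.59675], the lower bound on the
    half-line fifth moment given by the tangent line at [17 / 10]. *)
Lemma gF_ge_cubic (u : R) : 0 <= u ->
  259 / 100 - 15 / 2 * u + 5 * u ^+ 2 - 5 * u ^+ 3 <= gF u.
Proof.
move=> u0; rewrite gF_pos//.
apply: (@le_trans _ _ (half_gauss (fun z => - 5 * u ^+ 2 +
  (- (17 / 10) ^+ 3 / 2 + 15 * u ^+ 2 - 10 * u ^+ 3) * z ^+ 2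
  + (51 / 20 - 5 * u) * z ^+ 4 + 0 * z ^+ 6))).
  by rewrite half_gauss_even_poly; lra.
apply: le_Rintegral => //; [exact: integrable_even_poly_gphi|exact: integrable_pos5B|].
move=> z; rewrite /= in_itv/= andbT => z0; apply: ler_wpM2r; first exact: gphi_ge0.
exact: pos5B_ge_even.
Qed.

Lemma gF_shift (t : R) :
  (\int[mu]_(z in `[0%R, +oo[) (z ^+ 5 * gphi (z + t))%:E = (gF t)%:E)%E.
Proof.
rewrite -gFE (@integral_affine (fun z => pos5 (z - t) * gphi z) 1 t)//; last 2 first.
- by apply: continuous_Mgphi; exact: continuous_pos5B.
- by move=> x; rewrite mulr_ge0 ?pos5_ge0 ?gphi_ge0.
pose h (w : R) := pos5 w * gphi (w + t).
have ch : continuous h.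
  move=> w; apply: cvgM; first exact: pos5_continuous.
  have := @continuous_comp_affine gphi 1 t gphi_continuous w.
  by under eq_fun do rewrite mul1r.
have -> : (\int[mu]_x (pos5 (1 * x + t - t) * gphi (1 * x + t) * 1)%:E =
    \int[mu]_x (h x)%:E)%E.
  by apply: eq_integral => w _; rewrite mulr1 mul1r addrK.
have hE (z : R) : h z = (h z / gphi z) * gphi z by rewrite divfK// gt_eqF ?gphi_gt0.
under [RHS]eq_integral do rewrite hE.
rewrite (@integral_gphi_fold (fun z => h z / gphi z)).
- apply: eq_integral => z; rewrite inE/= in_itv/= andbT => z0.
  rewrite mulrDl divfK ?gt_eqF ?gphi_gt0// /h pos5_id//.
  by rewrite (@pos5_eq0 _ (- z)) ?oppr_le0// !mul0r addr0.
- by move=> z; rewrite divr_ge0 ?gphi_ge0// mulr_ge0 ?pos5_ge0 ?gphi_ge0.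
- apply: measurable_continuous => z; apply: cvgM; first exact: ch.
  by apply: cvgV; [rewrite gt_eqF ?gphi_gt0|exact: gphi_continuous].
Qed.

(* [gphi (w + t) = gphi w * expR (- t * w - t^2 / 2)], and the exponential is above
   its tangent line at [w = 29/10], which exceeds the mean of [w] under the
   weight [w^5 * gphi w]. *)
Lemma gF_ge_exp (t : R) : 0 <= t ->
  259 / 100 * expR (- (29 / 10 * t) - t ^+ 2 / 2) <= gF t.
Proof.
move=> t0; pose m : R := 29 / 10; pose k := expR (- (m * t) - t ^+ 2 / 2).
have k0 : 0 < k by exact: expR_gt0.
have tm : 0 <= 1 + t * m by rewrite addr_ge0// mulr_ge0//; rewrite /m; lra.
pose b := - (k * ((17 / 10) ^+ 3 / 2 * (1 + t * m))).
pose c := k * (51 / 20 * (1 + t * m)).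
pose f (z : R) := 0 + b * z ^+ 2 + c * z ^+ 4 + (- (k * t)) * z ^+ 6.
pose g (z : R) := z ^+ 5 * gphi (z + t).
have fle (z : R) : 0 <= z -> f z * gphi z <= g z.
  move=> z0; rewrite /g.
  have -> : gphi (z + t) = expR (- (t * (z - m))) * k * gphi z.
    by rewrite /gphi /k -expRD mulrCA -expRD; congr (_ * expR _); field.
  rewrite mulrA; apply: ler_wpM2r; first exact: gphi_ge0.
  have -> : f z = (- ((17 / 10) ^+ 3 / 2 * (1 + t * m)) * z ^+ 2
     + 51 / 20 * (1 + t * m) * z ^+ 4 - t * z ^+ 6) * k by rewrite /f /b /c; ring.
  rewrite mulrA; apply: ler_wpM2r; first exact: ltW.
  have e1 : 1 - t * (z - m) <= expR (- (t * (z - m))).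
    by apply: le_trans (expR_ge1Dx _).
  apply: (@le_trans _ _ (z ^+ 5 * (1 - t * (z - m)))); last first.
    by apply: ler_wpM2l => //; exact: exprn_ge0.
  have := ler_wpM2l tm (expr5_ge_even _ z0); lra.
have cg : continuous g.
  move=> w; apply: cvgM; first exact: exprn_continuous.
  have := @continuous_comp_affine gphi 1 t gphi_continuous w.
  by under eq_fun do rewrite mul1r.
have gi : mu.-integrable `[0%R, +oo[ (EFin \o g).
  apply/integrableP; split; first exact: measurable_EFin_continuous.
  apply: (@le_lt_trans _ _ (gF t)%:E); last exact: ltry.
  rewrite -gF_shift le_eqVlt; apply/orP; left; apply/eqP/eq_integral => z.
  rewrite inE/= in_itv/= andbT => z0; rewrite ger0_norm//.
  by apply: mulr_ge0; [exact: exprn_ge0|exact: gphi_ge0].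
rewrite -/k.
have -> : gF t = \int[mu]_(z in `[0%R, +oo[) g z by rewrite /Rintegral gF_shift.
apply: (@le_trans _ _ (half_gauss f)).
  rewrite half_gauss_even_poly.
  have -> : 0 / 2 + b / 2 + c * (3 / 2) + - (k * t) * (15 / 2) =
    ((51 / 20 * (3 / 2) - (17 / 10) ^+ 3 / 4) * (1 + t * m) - 15 / 2 * t) * k.
    by rewrite /b /c; field.
  (* The coefficient of [t] is [2.59675 * m - 15 / 2]; [m = 29 / 10] is just large enough to make it
     nonnegative. *)
  by apply: ler_wpM2r; [exact: ltW|rewrite /m; lra].
apply: le_Rintegral => //; first exact: integrable_even_poly_gphi.
by move=> z; rewrite /= in_itv/= andbT; exact: fle.
Qed.

(** With [t = 2 * v], taking sixth roots in the exponential bound leaves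
    [1 - v <= expR (- 29/30 v - v^2 / 3)], because [64 * 67 / 2000 < 259 / 100]. *)
Lemma gF_ge_sextic (t : R) : 0 <= t <= 2 -> 67 / 2000 * (2 - t) ^+ 6 <= gF t.
Proof.
move=> /andP[t0 t2]; apply: le_trans (gF_ge_exp _ t0).
pose v := t / 2; have -> : t = 2 * v by rewrite /v; field.
have v0 : 0 <= v by rewrite /v; lra.
have v1 : v <= 1 by rewrite /v; lra.
have h1 : 1 - v <= expR (- (29 / 30 * v) - v ^+ 2 / 3).
  (* The linear exponent is halved before [1 + y <= expR y] is applied; without halving the bound
     would already fail at [v = 1 / 2]. *)
  apply: (@le_trans _ _ ((1 - 29 / 60 * v) ^+ 2 * (1 - v ^+ 2 / 3))).
    have : 0 <= v ^+ 3 * (1 - v) by apply: mulr_ge0; [exact: exprn_ge0|lra].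
    have : 0 <= v * (v - 1 / 5) ^+ 2 by apply: mulr_ge0; [|exact: sqr_ge0].
    have : 0 <= v * (1 - v) by apply: mulr_ge0; lra.
    have : 0 <= v ^+ 2 * (1 - v) by apply: mulr_ge0; [exact: sqr_ge0|lra].
    have : 0 <= v ^+ 2 by exact: sqr_ge0.
    lra.
  rewrite expRD; apply: ler_pM.
  - exact: sqr_ge0.
  - by rewrite subr_ge0; nra.
  - have -> : - (29 / 30 * v) = 2%:R * (- (29 / 60 * v)) by field.
    rewrite expRM_natl; apply: lerXn2r; rewrite ?nnegrE ?expR_ge0//; first lra.
    by apply: le_trans (expR_ge1Dx _).
  - by apply: le_trans (expR_ge1Dx _).
have h6 : (1 - v) ^+ 6 <= expR (- (29 / 10 * (2 * v)) - (2 * v) ^+ 2 / 2).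
  have -> : - (29 / 10 * (2 * v)) - (2 * v) ^+ 2 / 2 =
     6%:R * (- (29 / 30 * v) - v ^+ 2 / 3) by field.
  by rewrite expRM_natl; apply: lerXn2r; rewrite ?nnegrE ?expR_ge0//; lra.
have -> : 2 - 2 * v = 2 * (1 - v) by ring.
rewrite exprMn.
have : 0 <= (1 - v) ^+ 6 by apply: exprn_ge0; lra.
lra.
Qed.

End gaussian.

(** * Scaling, convolution and tail of normal laws *)

Section scaled_gaussian.
Context {R : realType}.
Local Notation mu := (@lebesgue_measure R).

Lemma normal_peakE (s : R) : 0 < s -> normal_peak s = normal_peak 1 / s.
Proof.
move=> s0; rewrite /normal_peak expr1n mul1r -mulrnAr sqrtrM ?sqr_ge0//.
by rewrite sqrtr_sqr gtr0_norm// invfM mulrC.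
Qed.

Lemma normal_pdf_exp (m s z : R) : 0 < s ->
  normal_pdf m s z = normal_peak 1 / s * expR (- (z - m) ^+ 2 / (2 * s ^+ 2)).
Proof.
move=> s0; rewrite normal_pdfE ?gt_eqF// normal_peakE// /normal_fun.
by congr (_ * expR (_ / _)); rewrite mulr_natl.
Qed.

Definition gG (s t : R) : R := \int[mu]_z (pos5 (s * z - t) * gphi z).

Lemma gG0 (t : R) : (\int[mu]_z (pos5 (0 * z - t) * gphi z)%:E = (pos5 (- t))%:E)%E.
Proof.
transitivity (\int[mu]_z ((pos5 (- t))%:E * (gphi z)%:E))%E.
  by apply: eq_integral => z _; rewrite mul0r sub0r.
rewrite ge0_integralZl//=.
- by rewrite integral_gphi mule1.
- by apply: measurable_EFin_continuous; exact: gphi_continuous.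
- by move=> z _; rewrite lee_fin gphi_ge0.
- by rewrite lee_fin pos5_ge0.
Qed.

Lemma gG_pos (s t : R) : 0 < s ->
  (\int[mu]_z (pos5 (s * z - t) * gphi z)%:E = (s ^+ 5 * gF (t / s))%:E)%E.
Proof.
move=> s0.
transitivity (\int[mu]_z ((s ^+ 5)%:E * (pos5 (z - t / s) * gphi z)%:E))%E.
  apply: eq_integral => z _; rewrite -EFinM; congr EFin.
  have -> : s * z - t = s * (z - t / s) by field; rewrite gt_eqF.
  by rewrite pos5M ?mulrA// ltW.
rewrite ge0_integralZl//=.
- by rewrite gFE.
- by apply: measurable_EFin_continuous; apply: continuous_Mgphi; exact: continuous_pos5B.
- by move=> z _; rewrite lee_fin mulr_ge0 ?pos5_ge0 ?gphi_ge0.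
- by rewrite lee_fin exprn_ge0// ltW.
Qed.

Lemma gGE (s t : R) : 0 <= s ->
  (\int[mu]_z (pos5 (s * z - t) * gphi z)%:E = (gG s t)%:E)%E.
Proof.
rewrite le_eqVlt => /predU1P[<-|s0].
  by rewrite gG0 /gG /Rintegral gG0.
by rewrite gG_pos// /gG /Rintegral gG_pos.
Qed.

Lemma gGE_pos (s t : R) : 0 < s -> gG s t = s ^+ 5 * gF (t / s).
Proof. by move=> s0; apply: EFin_inj; rewrite -gGE ?gG_pos// ltW. Qed.

Lemma gG_ge0 (s t : R) : 0 <= gG s t.
Proof. by apply: Rintegral_ge0 => z _; rewrite mulr_ge0 ?pos5_ge0 ?gphi_ge0. Qed.

(* [D] and [- b] are the values of a mean-zero two-point variable. *)
Lemma two_point_le_gG (s D b t : R) : 0 < s -> 0 <= D -> 0 <= b -> D + b = 2 * s ->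
  (b * pos5 (D - t) + D * pos5 (- b - t)) / (2 * s) <= gG s t.
Proof.
move=> s0 D0 b0 Db; rewrite gGE_pos//.
have p01 : 0 <= b / (2 * s) <= 1.
  by rewrite divr_ge0 ?ler_pdivrMr ?mul1r; lra.
have := @two_point_le R gF gF_ge0 gF_neg gF_ge_cubic gF_ge_sextic (b / (2 * s)) (t / s) p01.
move=> /(ler_wpM2l (exprn_ge0 5 (ltW s0))); apply: le_trans.
have sn0 : s != 0 by rewrite gt_eqF.
have e1 : s ^+ 5 * pos5 (2 * (1 - b / (2 * s)) - t / s) = pos5 (D - t).
  rewrite -pos5M; last exact: ltW.
  by congr pos5; rewrite (_ : D = 2 * s - b); [field|lra].
have e2 : s ^+ 5 * pos5 (- (2 * (b / (2 * s))) - t / s) = pos5 (- b - t).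
  by rewrite -pos5M; [congr pos5; field|exact: ltW].
have kE (k c e x y : R) : k * (c * x + e * y) = c * (k * x) + e * (k * y) by ring.
rewrite kE e1 e2.
have -> : 1 - b / (2 * s) = D / (2 * s).
  have -> : D = 2 * s - b by lra.
  by field.
by rewrite le_eqVlt; apply/orP; left; apply/eqP; field.
Qed.

Lemma mgf_gphi (h : R) :
  (\int[mu]_z (expR (h * z) * gphi z)%:E = (expR (h ^+ 2 / 2))%:E)%E.
Proof.
transitivity (\int[mu]_z ((expR (h ^+ 2 / 2))%:E * (normal_pdf h 1 z)%:E))%E.
  apply: eq_integral => z _; rewrite -EFinM; congr EFin.
  rewrite normal_pdf_exp// /gphi divr1 mulrCA [RHS]mulrCA -!expRD.
  by congr (_ * expR _); rewrite expr1n; field.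
rewrite ge0_integralZl//=.
- by rewrite integral_normal_pdf mule1.
- by apply/measurable_EFinP; exact: measurable_normal_pdf.
- by move=> z _; rewrite lee_fin normal_pdf_ge0.
Qed.

(** The joint density of [(a X + b Y, Y)], for independent standard normal X and Y, factored in the
    other order: the law of the sum times the conditional law of Y given that the sum is [u]. *)
Lemma normal_pdf_conv (a b s u y : R) : 0 < a -> 0 < s -> s ^+ 2 = a ^+ 2 + b ^+ 2 ->
  gphi ((u - b * y) / a) / a * gphi y =
  normal_pdf 0 s u * normal_pdf (b * u / s ^+ 2) (a / s) y.
Proof.
move=> a0 s0 sE; rewrite !normal_pdf_exp ?divr_gt0// /gphi.
have an0 : a != 0 by rewrite gt_eqF.
have sn0 : s != 0 by rewrite gt_eqF.
have s2n0 : a ^+ 2 + b ^+ 2 != 0 by rewrite -sE expf_neq0.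
have -> : normal_peak 1 / s * expR (- (u - 0) ^+ 2 / (2 * s ^+ 2)) *
  (normal_peak 1 / (a / s) * expR (- (y - b * u / s ^+ 2) ^+ 2 / (2 * (a / s) ^+ 2))) =
  normal_peak 1 ^+ 2 / a * (expR (- (u - 0) ^+ 2 / (2 * s ^+ 2)) *
    expR (- (y - b * u / s ^+ 2) ^+ 2 / (2 * (a / s) ^+ 2))) by field; apply/andP.
have -> : normal_peak 1 * expR (- ((u - b * y) / a) ^+ 2 / 2) / a *
  (normal_peak 1 * expR (- y ^+ 2 / 2)) =
  normal_peak 1 ^+ 2 / a * (expR (- ((u - b * y) / a) ^+ 2 / 2) *
    expR (- y ^+ 2 / 2)) by field.
congr (_ * _); rewrite -!expRD; congr expR.
rewrite [(a / s) ^+ 2]expr_div_n sE subr0; field.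
by rewrite an0 -sE expf_neq0.
Qed.

Lemma integral_exp_tail (l a : R) : 0 < l ->
  (\int[mu]_(z in `[a, +oo[) (expR (- (l * (z - a))))%:E = (l^-1)%:E)%E.
Proof.
move=> l0; have ln0 : l != 0 by rewrite gt_eqF.
have dF (z : R) : is_derive z 1 (fun z => - (l^-1 * expR (- (l * (z - a)))))
    (expR (- (l * (z - a)))).
  by apply: is_derive_eq; rewrite /GRing.scale/=; field.
rewrite (@integral_cy_FTC R _ _ _ _ _ dF).
- by rewrite subrr mulr0 oppr0 expR0 mulr1 opprK.
- by move=> z _; exact: expR_ge0.
- move=> z; apply: continuous_comp; last exact: continuous_expR.
  apply: cvgN; apply: cvgM; first exact: cvg_cst.
  by apply: cvgB; [exact: cvg_id|exact: cvg_cst].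
- rewrite -[X in _ --> X]oppr0 -(mulr0 l^-1); apply: cvgN; apply: cvgM; first exact: cvg_cst.
  apply: (@cvg_comp _ _ _ (fun z => l * (z - a)) (fun w => expR (- w))); last exact: cvgr_expR.
  apply/cvgryPge => A; near=> z.
  rewrite -ler_pdivrMl// lerBrDr.
  by near: z; apply: nbhs_pinfty_ge; rewrite num_real.
Unshelve. all: by end_near. Qed.

Lemma integral_pow5exp_tail (l t : R) : 0 < l ->
  (\int[mu]_(z in `[t, +oo[) ((z - t) ^+ 5 * expR (- (l * (z - t))))%:E =
   (5`!%:R / l ^+ 6)%:E)%E.
Proof.
move=> l0; have ln0 : l != 0 by rewrite gt_eqF.
(* Five integrations by parts: the coefficients are [5! / k!], and [- p] is a primitive of
   [w ^ 5 * expR (- w)]. *)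
pose p (w : R) := w ^+ 5 * expR (- w) + 5 * (w ^+ 4 * expR (- w))
  + 20 * (w ^+ 3 * expR (- w)) + 60 * (w ^+ 2 * expR (- w))
  + 120 * (w ^+ 1 * expR (- w)) + 120 * (w ^+ 0 * expR (- w)).
have p0 : p w @[w --> +oo] --> (0 : R).
  have -> : (0 : R) = 0 + 5 * 0 + 20 * 0 + 60 * 0 + 120 * 0 + 120 * 0 by ring.
  by do 5 (apply: cvgD; last by apply: cvgM; [exact: cvg_cst|exact: cvg_powexp]);
    exact: cvg_powexp.
have dp (w : R) : is_derive w 1 p (- (w ^+ 5 * expR (- w))).
  rewrite /p; under eq_fun do rewrite expr0 expr1.
  by apply: is_derive_eq; rewrite /GRing.scale/=; ring.
pose q (z : R) := - (l ^- 6 * p (l * (z - t))).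
have dF (z : R) : is_derive z 1 q ((z - t) ^+ 5 * expR (- (l * (z - t)))).
  rewrite /q.
  have d1 : is_derive z 1 (fun z => l * (z - t)) l.
    by apply: is_derive_eq; rewrite /GRing.scale/=; ring.
  have d2 := @is_derive1_comp R p _ z _ _ (dp (l * (z - t))) d1.
  have := is_deriveN (is_deriveZ (l ^- 6) d2).
  rewrite /GRing.scale/=; congr (is_derive _ _ _ _).
  by field.
rewrite (@integral_cy_FTC R _ _ _ _ _ dF).
- rewrite /q subrr mulr0 /p !expr0n/= oppr0 expR0 opprK; congr EFin.
  by rewrite (_ : 5`! = 120%N)//; field.
- by move=> z zt; rewrite mulr_ge0 ?expR_ge0 ?exprn_ge0 ?subr_ge0.
- move=> z; apply: cvgM.
    apply: (@continuous_comp _ _ _ (fun z => z - t) (fun u => u ^+ 5)).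
      by apply: cvgB; [exact: cvg_id|exact: cvg_cst].
    exact: exprn_continuous.
  apply: continuous_comp; last exact: continuous_expR.
  apply: cvgN; apply: cvgM; first exact: cvg_cst.
  by apply: cvgB; [exact: cvg_id|exact: cvg_cst].
- rewrite -[X in _ --> X]oppr0 -(mulr0 (l ^- 6)); apply: cvgN; apply: cvgM; first exact: cvg_cst.
  apply: (@cvg_comp _ _ _ (fun z => l * (z - t)) p); last exact: p0.
  apply/cvgryPge => A; near=> z.
  rewrite -ler_pdivrMl// lerBrDr.
  by near: z; apply: nbhs_pinfty_ge; rewrite num_real.
Unshelve. all: by end_near. Qed.

(** For [a > 0] both sides are the integral of the kernel [K], taken in either order. The case
    [a = 0], where there is no density, is the one met at the first step of the martingale. *)
Lemma gG_convolution (a b t : R) : 0 <= a -> 0 <= b ->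
  (\int[mu]_y (gG a (t - b * y) * gphi y)%:E = (gG (Num.sqrt (a ^+ 2 + b ^+ 2)) t)%:E)%E.
Proof.
rewrite le_eqVlt => /predU1P[<-|a0] b0.
  rewrite expr0n/= add0r sqrtr_sqr ger0_norm// -gGE//.
  apply: eq_integral => y _; congr ((_ * _)%:E).
  by apply: EFin_inj; rewrite -gGE// gG0 opprB.
set s := Num.sqrt _.
have an0 : a != 0 by rewrite gt_eqF.
have a20 : 0 < a ^+ 2 + b ^+ 2 by rewrite ltr_pwDl ?exprn_gt0 ?exprn_ge0.
have s0 : 0 < s by rewrite sqrtr_gt0.
have sn0 : s != 0 by rewrite gt_eqF.
have sE : s ^+ 2 = a ^+ 2 + b ^+ 2 by rewrite sqr_sqrtr// ltW.
pose K (u y : R) := pos5 (u - t) * (gphi ((u - b * y) / a) / a * gphi y).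
have K0 u y : 0 <= K u y.
  apply: mulr_ge0; first exact: pos5_ge0.
  apply: mulr_ge0; last exact: gphi_ge0.
  by apply: divr_ge0; [exact: gphi_ge0|exact: ltW].
have mgphi : measurable_fun [set: R] (@gphi R).
  by apply: measurable_continuous; exact: gphi_continuous.
have mpos5 : measurable_fun [set: R] (@pos5 R).
  by apply: measurable_continuous; exact: pos5_continuous.
have step1 y : (gG a (t - b * y) * gphi y)%:E = (\int[mu]_u (K u y)%:E)%E.
  pose G (u : R) := pos5 (u - t) * (gphi ((u - b * y) / a) / a).
  have cG : continuous G.
    move=> u; apply: cvgM; first exact: continuous_pos5B.
    apply: cvgM; last exact: cvg_cst.
    apply: (@continuous_comp _ _ _ (fun u => (u - b * y) / a)); last exact: gphi_continuous.
    by apply: cvgM; [apply: cvgB; [exact: cvg_id|exact: cvg_cst]|exact: cvg_cst].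
  have G0 u : 0 <= G u.
    apply: mulr_ge0; first exact: pos5_ge0.
    by apply: divr_ge0; [exact: gphi_ge0|exact: ltW].
  transitivity ((\int[mu]_u (G u)%:E) * (gphi y)%:E)%E.
    rewrite EFinM -gGE; last exact: ltW.
    rewrite (@integral_affine R G a (b * y))//; congr (_ * _)%E.
    apply: eq_integral => x _; congr EFin.
    rewrite /G addrK (mulrC a x) mulfK// -mulrA divfK//.
    by congr (pos5 _ * _); ring.
  rewrite -ge0_integralZr//=.
  - by apply: eq_integral => u _; rewrite -EFinM /G /K -!mulrA.
  - exact: measurable_EFin_continuous.
  - by move=> u _; rewrite lee_fin.
  - by rewrite lee_fin gphi_ge0.
under eq_integral do rewrite step1.
have mK : measurable_fun [set: R * R] (fun p : R * R => (K p.2 p.1)%:E).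
  have m1 : measurable_fun [set: R * R] (@fst R R) by exact: measurable_fst.
  have m2 : measurable_fun [set: R * R] (@snd R R) by exact: measurable_snd.
  apply/measurable_EFinP; apply: measurable_funM.
    by apply: (measurableT_comp mpos5); apply: measurable_funB.
  apply: measurable_funM; last exact: (measurableT_comp mgphi).
  apply: measurable_funM => //; apply: (measurableT_comp mgphi).
  apply: measurable_funM => //; apply: measurable_funB => //.
  exact: measurable_funM.
rewrite (@fubini_tonelli _ _ _ _ R lebesgue_measure lebesgue_measure
  (fun p : R * R => (K p.2 p.1)%:E))//=; last by move=> p; rewrite lee_fin.
transitivity (\int[mu]_u (pos5 (u - t) * normal_pdf 0 s u)%:E)%E.
  apply: eq_integral => u _.
  transitivity (\int[mu]_y ((pos5 (u - t) * normal_pdf 0 s u)%:E *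
      (normal_pdf (b * u / s ^+ 2) (a / s) y)%:E))%E.
    by apply: eq_integral => y _; rewrite /K (@normal_pdf_conv a b s)// -EFinM mulrA.
  rewrite ge0_integralZl//=.
  - by rewrite integral_normal_pdf mule1.
  - by apply/measurable_EFinP; exact: measurable_normal_pdf.
  - by move=> z _; rewrite lee_fin normal_pdf_ge0.
  - by rewrite lee_fin mulr_ge0 ?pos5_ge0 ?normal_pdf_ge0.
rewrite -gGE; last exact: ltW.
rewrite (@integral_affine R _ s 0)//.
- apply: eq_integral => z _; congr EFin; rewrite addr0 -mulrA; congr (_ * _).
  rewrite normal_pdf_exp// /gphi mulrAC divfK//; congr (_ * expR _).
  by field.
- move=> u; apply: cvgM; first exact: continuous_pos5B.
  by apply: continuous_normal_pdf.
- by move=> u; rewrite mulr_ge0 ?pos5_ge0 ?normal_pdf_ge0.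
Qed.

(** This integrates [f1 - f2 <= g2 - g1], whose right-hand side has integral zero; the form with
    sums keeps every integrand nonnegative. *)
Lemma le_integral_balance (D : set R) (f1 f2 g1 g2 : R -> R) (c : R) :
  measurable D -> continuous f1 -> continuous f2 -> continuous g1 -> continuous g2 ->
  (forall z, D z -> 0 <= f1 z) -> (forall z, D z -> 0 <= f2 z) ->
  (forall z, D z -> 0 <= g1 z) -> (forall z, D z -> 0 <= g2 z) ->
  (forall z, D z -> f1 z + g1 z <= f2 z + g2 z) ->
  (\int[mu]_(z in D) (g1 z)%:E = c%:E)%E -> (\int[mu]_(z in D) (g2 z)%:E = c%:E)%E ->
  (\int[mu]_(z in D) (f1 z)%:E <= \int[mu]_(z in D) (f2 z)%:E)%E.
Proof.
move=> mD cf1 cf2 cg1 cg2 f10 f20 g10 g20 fg h1 h2.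
have mE (f : R -> R) : continuous f -> measurable_fun D (EFin \o f).
  exact: measurable_EFin_continuous.
rewrite -(@leeD2rE _ c%:E)// -{1}h1 -h2 -!ge0_integralD//=; try exact: mE;
  try by move=> z Dz; rewrite lee_fin ?f10 ?f20 ?g10 ?g20.
apply: ge0_le_integral => //=.
- by move=> z Dz; rewrite lee_fin addr_ge0 ?f10 ?g10.
- by apply: emeasurable_funD; exact: mE.
- by apply: emeasurable_funD; exact: mE.
Qed.

(* Hazard rate [l] of the normal law at [x]: the density lies below
   [gphi x * expR (- l * (z - x))] exactly outside [x, 2 * l - x], and both have
   the same mass on [x, +oo[. *)
Lemma gF_le_tail (x : R) : exists2 t, t < x &
  ((gF t)%:E <= (c50 R * (x - t) ^+ 5)%:E * \int[mu]_(z in `[x, +oo[) (gphi z)%:E)%E.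
Proof.
have mg (D : set R) : measurable_fun D (EFin \o @gphi R).
  by apply: measurable_EFin_continuous; exact: gphi_continuous.
have q1 : (\int[mu]_(z in `[x, +oo[) (gphi z)%:E <= 1)%E.
  rewrite -(@integral_gphi R); apply: ge0_subset_integral => //; first exact: mg.
  by move=> z _; rewrite lee_fin gphi_ge0.
have q0 : (0 < \int[mu]_(z in `[x, +oo[) (gphi z)%:E)%E.
  have sq (z : R) : x <= z -> z <= x + 1 -> z ^+ 2 <= (`|x| + 1) ^+ 2.
    have := ler_norm x; have := ler_norm (- x); rewrite normrN => n1 n2 z1 z2.
    rewrite -subr_ge0 (_ : _ - _ = (`|x| + 1 - z) * (`|x| + 1 + z)); last by ring.
    by apply: mulr_ge0; lra.
  pose m : R := normal_peak 1 * expR (- (`|x| + 1) ^+ 2 / 2).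
  have m0 : 0 < m by rewrite mulr_gt0 ?expR_gt0 ?gpeak_gt0.
  apply: (@lt_le_trans _ _ (\int[mu]_(z in `[x, (x + 1)%R]) m%:E)%E).
    rewrite integral_cst//= lebesgue_measure_itv/= lte_fin ltrDl ltr01.
    by rewrite -EFinB addrAC subrr add0r mule1 lte_fin.
  apply: (@le_trans _ _ (\int[mu]_(z in `[x, (x + 1)%R]) (gphi z)%:E)%E).
    apply: ge0_le_integral => //=.
    - by move=> z _; rewrite lee_fin ltW.
    - exact: mg.
    - move=> z; rewrite in_itv/= => /andP[z1 z2]; rewrite lee_fin.
      apply: ler_wpM2l; first exact: normal_peak_ge0.
      rewrite ler_expR !mulNr lerN2 ler_pM2r ?invr_gt0//.
      exact: sq.
  apply: ge0_subset_integral => //.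
  - exact: mg.
  - by move=> z _; rewrite lee_fin gphi_ge0.
  - by move=> z/=; rewrite !in_itv/= => /andP[->].
have [q qE] : exists q, (\int[mu]_(z in `[x, +oo[) (gphi z)%:E)%E = q%:E.
  case: (\int[mu]_(z in _) _)%E q0 q1 => [r _ _|//|//]; by exists r.
rewrite qE; move: q0 q1; rewrite qE lte_fin lee_fin => q0 q1.
pose l := gphi x / q.
have l0 : 0 < l by rewrite divr_gt0 ?gphi_gt0.
pose g (z : R) := gphi x * expR (- (l * (z - x))).
have g0 z : 0 <= g z by rewrite mulr_ge0 ?expR_ge0 ?gphi_ge0.
have cgk (k : R) : continuous (fun z => gphi x * expR (- (k * (z - x)))).
  move=> z; apply: cvgM; first exact: cvg_cst.
  apply: continuous_comp; last exact: continuous_expR.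
  apply: cvgN; apply: cvgM; first exact: cvg_cst.
  by apply: cvgB; [exact: cvg_id|exact: cvg_cst].
have Ig (k : R) : 0 < k -> (\int[mu]_(z in `[x, +oo[) (gphi x * expR (- (k * (z - x))))%:E =
    (gphi x / k)%:E)%E.
  move=> k0; under eq_integral do rewrite EFinM.
  rewrite ge0_integralZl//= ?integral_exp_tail// ?lee_fin ?gphi_ge0//.
  - apply: measurable_EFin_continuous => z.
    apply: continuous_comp; last exact: continuous_expR.
    apply: cvgN; apply: cvgM; first exact: cvg_cst.
    by apply: cvgB; [exact: cvg_id|exact: cvg_cst].
(* The classical bound on the Mills ratio: beyond a positive [x] the density lies below the
   exponential one of rate [x]. *)
have lx : x <= l.
  have [x0|x0] := leP x 0; first by apply: le_trans x0 _; exact: ltW.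
  rewrite /l ler_pdivlMr// mulrC -ler_pdivlMr// -lee_fin -qE -Ig//.
  apply: ge0_le_integral => //=.
  - by move=> z _; rewrite lee_fin gphi_ge0.
  - exact: mg.
  - by apply: measurable_EFin_continuous; exact: cgk.
  - move=> z; rewrite in_itv/= andbT => xz; rewrite lee_fin /gphi -mulrA -expRD.
    apply: ler_wpM2l; first exact: normal_peak_ge0.
    rewrite ler_expR -subr_ge0 (_ : _ - _ = (z - x) ^+ 2 / 2); last by field.
    by rewrite divr_ge0 ?sqr_ge0.
have gle z : z <= x -> gphi z <= g z.
  move=> zx; rewrite /g /gphi -mulrA -expRD.
  apply: ler_wpM2l; first exact: normal_peak_ge0.
  rewrite ler_expR -subr_ge0 (_ : _ - _ = (x - z) * (l - (z + x) / 2)); last by field.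
  by apply: mulr_ge0; lra.
have gcross z : x <= z -> (z - (2 * l - x)) * (gphi z - g z) <= 0.
  move=> xz; rewrite /g /gphi -mulrA -expRD -mulrBr mulrCA.
  rewrite pmulr_rle0 ?gpeak_gt0//.
  have [zl|zl] := leP z (2 * l - x).
    apply: mulr_le0_ge0; first by rewrite subr_le0.
    rewrite subr_ge0 ler_expR -subr_ge0 (_ : _ - _ = (z - x) * (l - (z + x) / 2)); last by field.
    by apply: mulr_ge0; lra.
  apply: mulr_ge0_le0; first by rewrite subr_ge0 ltW.
  rewrite subr_le0 ler_expR -subr_ge0 (_ : _ - _ = (z - x) * ((z + x) / 2 - l)); last by field.
  by apply: mulr_ge0; lra.
(* Over [[t, +oo[] the integral of [(z - t) ^ 5] against the exponential density is [5! e^y / y^5]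
   times [(x - t) ^ 5] times the mass beyond [x], with [y = l (x - t)]. This factor is least at
   [y = 5], where it is [c50]. *)
pose t := x - 5 / l.
have tx : t < x by rewrite /t ltrBlDr ltrDl divr_gt0.
exists t => //.
(* [K] is the weight [(z - t) ^ 5] at the crossing point [2 * l - x]. As both densities have the
   same mass beyond [x], the weight may be lowered by [K], after which it changes sign together with
   [g - gphi]. *)
pose K := (2 * l - x - t) ^+ 5.
have K0 : 0 <= K by apply: exprn_ge0; lra.
have keyD z : x <= z -> (z - t) ^+ 5 * gphi z + K * g z <= (z - t) ^+ 5 * g z + K * gphi z.
  move=> xz; rewrite -subr_ge0.
  have -> : (z - t) ^+ 5 * g z + K * gphi z - ((z - t) ^+ 5 * gphi z + K * g z) =
    - (((z - t) ^+ 5 - K) * (gphi z - g z)) by ring.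
  rewrite oppr_ge0; have := gcross z xz.
  have [zl|zl] := leP z (2 * l - x).
    have h : (z - t) ^+ 5 <= K by apply: lerXn2r; rewrite ?nnegrE; lra.
    have [->|zn] := eqVneq z (2 * l - x); first by move=> _; rewrite /K subrr mul0r.
    have zl' : z - (2 * l - x) < 0 by rewrite subr_lt0 lt_neqAle zn.
    by rewrite nmulr_rle0// => hh; apply: mulr_le0_ge0; rewrite ?subr_le0.
  have h : K <= (z - t) ^+ 5 by apply: lerXn2r; rewrite ?nnegrE; lra.
  have zl' : 0 < z - (2 * l - x) by rewrite subr_gt0.
  by rewrite pmulr_rle0// => hh; apply: mulr_ge0_le0; rewrite ?subr_ge0.
have cg : continuous g by exact: cgk.
have cpow : continuous (fun z : R => (z - t) ^+ 5).
  move=> z; apply: (@continuous_comp _ _ _ (fun z => z - t) (fun u => u ^+ 5)).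
    by apply: cvgB; [exact: cvg_id|exact: cvg_cst].
  exact: exprn_continuous.
have mM (D : set R) (f h : R -> R) : continuous f -> continuous h ->
    measurable_fun D (fun z => (f z * h z)%:E).
  move=> cf ch; apply: (@measurable_EFin_continuous R (fun z => f z * h z)) => z.
  by apply: cvgM; [exact: cf|exact: ch].
have pow0 z : t <= z -> 0 <= (z - t) ^+ 5 by move=> tz; rewrite exprn_ge0 ?subr_ge0.
have gF_itv : (gF t)%:E = (\int[mu]_(z in `[t, +oo[) ((z - t) ^+ 5 * gphi z)%:E)%E.
  rewrite -gFE [RHS]integral_mkcond; apply: eq_integral => z _.
  rewrite patchE; case: ifPn => [|]; rewrite ?inE ?notin_setE/= in_itv/= andbT.
    by move=> tz; rewrite pos5_id ?subr_ge0.
  by move=> /negP; rewrite -ltNge => zt; rewrite pos5_eq0 ?mul0r// subr_le0 ltW.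
have split (f : R -> R) : continuous f -> (forall z, 0 <= f z) ->
   (\int[mu]_(z in `[t, +oo[) ((z - t) ^+ 5 * f z)%:E =
    \int[mu]_(z in `[t, x[) ((z - t) ^+ 5 * f z)%:E +
    \int[mu]_(z in `[x, +oo[) ((z - t) ^+ 5 * f z)%:E)%E.
  move=> cf f0; rewrite -ge0_integral_setU//=.
  - by rewrite (@itv_bndbnd_setU _ _ (BLeft t) (BLeft x) +oo%O)// bnd_simp ltW.
  - exact: mM.
  - move=> z [|]; rewrite in_itv/= ?andbT.
      by move=> /andP[tz _]; rewrite lee_fin mulr_ge0 ?pow0.
    by move=> xz; rewrite lee_fin mulr_ge0 ?pow0// (le_trans _ xz)// ltW.
  - apply/disj_setPS => z [/=]; rewrite !in_itv/= andbT => /andP[_ zx] xz.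
    by move: (lt_le_trans zx xz); rewrite ltxx.
rewrite gF_itv.
apply: (@le_trans _ _ (\int[mu]_(z in `[t, +oo[) ((z - t) ^+ 5 * g z)%:E)%E); last first.
  have -> : (\int[mu]_(z in `[t, +oo[) ((z - t) ^+ 5 * g z)%:E =
     (gphi x * expR 5)%:E * \int[mu]_(z in `[t, +oo[) ((z - t) ^+ 5 * expR (- (l * (z - t))))%:E)%E.
    rewrite -ge0_integralZl//=.
    - apply: eq_integral => z _; rewrite -EFinM; congr EFin.
      have -> : g z = gphi x * expR 5 * expR (- (l * (z - t))).
        rewrite /g -mulrA -expRD; congr (_ * expR _); rewrite /t; field.
        by rewrite gt_eqF.
      by ring.
    - apply: mM => // z; apply: continuous_comp; last exact: continuous_expR.
      apply: cvgN; apply: cvgM; first exact: cvg_cst.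
      by apply: cvgB; [exact: cvg_id|exact: cvg_cst].
    - move=> z; rewrite in_itv/= andbT => tz.
      by rewrite lee_fin mulr_ge0 ?pow0 ?expR_ge0.
    - by rewrite lee_fin mulr_ge0 ?gphi_ge0 ?expR_ge0.
  rewrite integral_pow5exp_tail// -!EFinM lee_fin le_eqVlt; apply/orP; left; apply/eqP.
  have qn0 : q != 0 by rewrite gt_eqF.
  have pn0 : gphi x != 0 by rewrite gt_eqF ?gphi_gt0.
  have -> : expR 5 = expR 1 ^+ 5 :> R by rewrite -expRM_natl mulr1.
  rewrite /c50 /t /l.
  by field; rewrite qn0 pn0.
rewrite (split _ (@gphi_continuous R) (@gphi_ge0 R)) (split _ cg g0).
apply: leeD.
    apply: ge0_le_integral => //=.
    - by move=> z; rewrite in_itv/= => /andP[tz _]; rewrite lee_fin mulr_ge0 ?pow0 ?gphi_ge0.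
    - by apply: mM => //; exact: gphi_continuous.
    - exact: mM.
    - move=> z; rewrite in_itv/= => /andP[tz zx]; rewrite lee_fin.
      by apply: ler_wpM2l; [exact: pow0|apply: gle; exact: ltW].
  have KI (f : R -> R) : continuous f -> (forall z, 0 <= f z) ->
     (\int[mu]_(z in `[x, +oo[) (f z)%:E = q%:E)%E ->
     (\int[mu]_(z in `[x, +oo[) (K * f z)%:E = (K * q)%:E)%E.
    move=> cf f0 fq; under eq_integral do rewrite EFinM.
    rewrite ge0_integralZl//= ?fq//.
    - exact: measurable_EFin_continuous.
    - by move=> z _; rewrite lee_fin.
  have Kg : (\int[mu]_(z in `[x, +oo[) (K * g z)%:E = (K * q)%:E)%E.
    apply: KI => //; rewrite /g Ig//; congr EFin; rewrite /l; field.
    by rewrite !gt_eqF ?gphi_gt0.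
  have Kphi : (\int[mu]_(z in `[x, +oo[) (K * gphi z)%:E = (K * q)%:E)%E.
    by apply: KI => //; [exact: gphi_continuous|exact: gphi_ge0].
  have tz z : `[x, +oo[%classic z -> t <= z.
    by rewrite /= in_itv/= andbT; apply: le_trans; exact: ltW.
  apply: (@le_integral_balance _ (fun z => (z - t) ^+ 5 * gphi z)
    (fun z => (z - t) ^+ 5 * g z) _ _ _ _ _ _ _ _ _ _ _ _ _ Kg Kphi) => //.
  + by move=> z; apply: cvgM; [exact: cpow|exact: gphi_continuous].
  + by move=> z; apply: cvgM; [exact: cpow|exact: cg].
  + by move=> z; apply: cvgM; [exact: cvg_cst|exact: cg].
  + by move=> z; apply: cvgM; [exact: cvg_cst|exact: gphi_continuous].
  + by move=> z zx; rewrite mulr_ge0 ?gphi_ge0// pow0 ?tz.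
  + by move=> z zx; rewrite mulr_ge0// pow0 ?tz.
  + by move=> z zx; rewrite mulr_ge0.
  + by move=> z zx; rewrite mulr_ge0 ?gphi_ge0.
  + by move=> z; rewrite /= in_itv/= andbT; exact: keyD.
Qed.

End scaled_gaussian.

(** * One conditional step *)

(** The sum is the integer part of [y], written as a sum of indicators so that each term becomes the
    indicator of a level set. *)
Lemma floor_sum (R : realType) (K : nat) (y : R) : 0 <= y -> y <= K%:R ->
  `|y - \sum_(j < K) (j.+1%:R <= y)%R%:R| <= 1.
Proof.
move=> y0; elim: K => [|K IH] yK.
  by rewrite big_ord0 subr0 ger0_norm//; lra.
rewrite big_ord_recr/=; have [yK'|yK'] := leP y K%:R.
  rewrite (_ : (K.+1%:R <= y) = false) ?addr0 ?IH//.
  by apply/negbTE; rewrite -ltNge (le_lt_trans yK')// ltr_nat.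
rewrite (eq_bigr (fun=> 1)).
  rewrite sumr_const card_ord.
  have K1 : K.+1%:R = K%:R + 1 :> R by rewrite -natr1.
  rewrite K1 in yK *; rewrite ler_norml.
  by have [h|h] := leP (K%:R + 1) y; rewrite ?mulr1n ?mulr0n; apply/andP; split; lra.
move=> j _; rewrite (_ : (j.+1%:R <= y) = true)//.
by apply: le_trans (ltW yK'); rewrite ler_nat.
Qed.

Section bounded_factor.
Context d (T : measurableType d) (R : realType) (P : probability T R).

Lemma integrable_bounded (f : T -> R) (M : R) : measurable_fun setT f ->
  (forall w, `|f w| <= M) -> P.-integrable setT (EFin \o f).
Proof.
move=> mf fM; apply: measurable_bounded_integrable => //.
  by rewrite (le_lt_trans (probability_le1 _ _))// ltry.
exists M; split; first exact: num_real.
by move=> x Mx w _; exact: le_trans (fM w) (ltW Mx).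
Qed.

Lemma integrable_boundedM (f Y : T -> R) (M : R) : measurable_fun setT f ->
  (forall w, `|f w| <= M) -> P.-integrable setT (EFin \o Y) ->
  P.-integrable setT (EFin \o (fun w => f w * Y w)).
Proof.
move=> mf fM iY.
have iMY : P.-integrable setT (EFin \o (fun w => M * Y w)).
  by apply: eq_integrable (integrableZl _ M iY).
apply: le_integrable iMY => //.
- apply/measurable_EFinP; apply: measurable_funM => //.
  by apply/measurable_EFinP; exact: measurable_int iY.
- move=> w _; rewrite lee_fin !normrM; apply: ler_wpM2r => //.
  by apply: le_trans (fM w) _; exact: ler_norm.
Qed.

Lemma integrableN_EFin (Y : T -> R) (D : set T) : measurable D ->
  P.-integrable D (EFin \o Y) -> P.-integrable D (EFin \o (fun w => - Y w)).
Proof.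
move=> mD iY; apply: eq_integrable (integrableZl _ (-1) iY) => // w _.
by rewrite /= -EFinM mulN1r.
Qed.

Lemma RintegralN_integrable (Y : T -> R) (D : set T) : measurable D ->
  P.-integrable D (EFin \o Y) ->
  \int[P]_(w in D) (- Y w) = - \int[P]_(w in D) Y w.
Proof.
move=> mD iY; rewrite -[RHS]mulN1r -RintegralZl//.
by apply: eq_Rintegral => w _; rewrite mulN1r.
Qed.

End bounded_factor.

(** * Integrals over the sets of a sub-sigma-algebra *)

Section subalgebra.
Context d (T : measurableType d) (R : realType) (P : probability T R).
Variable (G : set_system T).
Hypotheses (sG : sigma_algebra setT G) (GT : G `<=` measurable).

Lemma sub_measurableP d' (U : measurableType d') (f : T -> U) :
  sub_measurable G f <->
  measurable_fun [set: g_sigma_algebraType G] (f : g_sigma_algebraType G -> U).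
Proof.
have GE : <<s G >> = G by exact: sigma_algebra_id.
split=> [mf _ B mB|mf A [B mB <-]].
  rewrite /measurable/= GE; apply: mf; exists B => //.
have := mf measurableT B mB; by rewrite {1}/measurable/= GE.
Qed.

Lemma sub_measurable_fun d' (U : measurableType d') (f : T -> U) :
  sub_measurable G f -> measurable_fun [set: T] f.
Proof. by move=> mf _ B mB; apply/GT/mf; exists B. Qed.

Lemma sub_measurable_preimage (f : T -> R) (B : set R) : measurable B ->
  sub_measurable G f -> G (f @^-1` B).
Proof. by move=> mB mf; rewrite -[_ @^-1` _]setTI; apply: mf; exists B. Qed.

Lemma sub_algebra_setT : G setT.
Proof. by case: sG => G0 GC _; rewrite -(setD0 setT); exact: GC. Qed.

(* The level sets of [be] lie in [G], and sums of their indicators approximate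
   [be] uniformly. *)
Lemma cond_le0 (Y be : T -> R) (M : R) :
  P.-integrable setT (EFin \o Y) ->
  (forall A, G A -> \int[P]_(w in A) Y w <= 0) ->
  sub_measurable G be -> (forall w, 0 <= be w <= M) ->
  \int[P]_w (be w * Y w) <= 0.
Proof.
move=> iY hY mbe bM.
pose A (N j : nat) := be @^-1` `[(j.+1%:R / N.+1%:R), +oo[%classic.
have GA N j : G (A N j) by exact: sub_measurable_preimage.
pose f (N K : nat) (w : T) := \sum_(j < K) (Y \_ (A N j)) w.
have iA N j : P.-integrable setT (EFin \o (Y \_ (A N j))).
  rewrite -restrict_EFin; apply: (iffLR (integrable_mkcond _ _)); first exact/GT/GA.
  by apply: integrableS iY => //; exact/GT/GA.
have fK N K : P.-integrable setT (EFin \o f N K) /\ \int[P]_w f N K w <= 0.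
  elim: K => [|K [iK leK]].
    rewrite /f; under eq_fun do rewrite big_ord0.
    split; first exact: integrable0.
    by rewrite Rintegral_cst// mul0r.
  have fS : f N K.+1 = (fun w => f N K w + (Y \_ (A N K)) w).
    by apply/funext => w; rewrite /f big_ord_recr.
  rewrite fS; split.
    by apply: eq_integrable (integrableD _ iK (iA N K)).
  rewrite RintegralD//; apply: ler_wnDr => //.
  by rewrite -Rintegral_mkcond; exact: hY.
have iaY : P.-integrable setT (EFin \o (fun w => `|Y w|)).
  by apply: integrable_norm.
have mbeT := sub_measurable_fun _ _ _ mbe.
have ibY : P.-integrable setT (EFin \o (fun w => be w * Y w)).
  apply: (@integrable_boundedM _ _ _ _ _ _ M) => // w.
  by have /andP[b0 b1] := bM w; rewrite ger0_norm.
(* Rounding [be] to multiples of [1 / (N + 1)] costs at most [|Y| / (N + 1)], and the rounded factor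
   contributes a nonpositive integral. *)
suff H (N : nat) : \int[P]_w (be w * Y w) <= N.+1%:R^-1 * \int[P]_w `|Y w|.
  rewrite leNgt; apply/negP => I0.
  have := H (Num.truncn ((\int[P]_w `|Y w|) / (\int[P]_w (be w * Y w)))).
  rewrite ler_pdivlMl ?ltr0n// -ler_pdivlMr//.
  by apply/negP; rewrite -ltNge; exact: truncnS_gt.
pose K := (Num.truncn (M * N.+1%:R)).+1.
have [iK leK] := fK N K.
have n0 : 0 < N.+1%:R^-1 :> R by rewrite invr_gt0 ltr0n.
have iDK : P.-integrable setT (EFin \o (fun w => f N K w + `|Y w|)).
  by apply: eq_integrable (integrableD _ iK iaY).
apply: (@le_trans _ _ (\int[P]_w (N.+1%:R^-1 * (f N K w + `|Y w|)))).
  apply: le_Rintegral => //.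
    by apply: eq_integrable (integrableZl _ N.+1%:R^-1 iDK).
  move=> w _.
  have -> : f N K w = (\sum_(j < K) (j.+1%:R <= be w * N.+1%:R)%R%:R) * Y w.
    rewrite /f mulr_suml; apply: eq_bigr => j _; rewrite patchE.
    case: ifPn; rewrite ?inE ?notin_setE /A/= in_itv/= andbT ler_pdivrMr ?ltr0n//.
      by move=> ->; rewrite mul1r.
    by move=> /negP/negbTE ->; rewrite mul0r.
  have /andP[b0 b1] := bM w.
  have := @floor_sum R K (be w * N.+1%:R).
  set F := \sum_(j < K) _ => /(_ _ _) hF.
  have {}hF : `|be w * N.+1%:R - F| <= 1.
    apply: hF; first by rewrite mulr_ge0.
    apply: (@le_trans _ _ (M * N.+1%:R)); first by rewrite ler_wpM2r.
    by apply: ltW; exact: truncnS_gt.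
  rewrite ler_pdivlMl ?ltr0n// -lerBlDl.
  have -> : N.+1%:R * (be w * Y w) - F * Y w = (be w * N.+1%:R - F) * Y w by ring.
  apply: le_trans (ler_norm _) _; rewrite normrM ler_piMl//.
rewrite RintegralZl// RintegralD// mulrDr ler_wnDl//.
by rewrite pmulr_rle0.
Qed.

(** The shifted factor [be + M] is nonnegative, so the one-sided lemma applies to it with [Y] and
    with [- Y]; the constant [M] is then removed by taking the whole space as the test set. *)
Lemma cond_eq0 (Y be : T -> R) (M : R) :
  P.-integrable setT (EFin \o Y) ->
  (forall A, G A -> \int[P]_(w in A) Y w = 0) ->
  sub_measurable G be -> (forall w, `|be w| <= M) ->
  \int[P]_w (be w * Y w) = 0.
Proof.
move=> iY Y0 mbe bM.
have mY : measurable_fun setT Y by apply/measurable_EFinP; exact: measurable_int iY.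
have mbT := sub_measurable_fun _ _ _ mbe.
have iAY A : G A -> P.-integrable A (EFin \o Y).
  by move=> GA; apply: integrableS iY => //; exact: GT.
have ipos (b : T -> R) : sub_measurable G b -> (forall w, 0 <= b w <= 2 * M) ->
    \int[P]_w (b w * Y w) = 0.
  move=> mb b0; have mbT' := sub_measurable_fun _ _ _ mb.
  have ib : P.-integrable setT (EFin \o (fun w => b w * Y w)).
    apply: (@integrable_boundedM _ _ _ _ _ _ (2 * M)) => // w.
    by have /andP[b1 b2] := b0 w; rewrite ger0_norm.
  apply/eqP; rewrite eq_le; apply/andP; split.
    by apply: cond_le0 mb b0 => // A GA; rewrite Y0.
  have iYN := integrableN_EFin _ _ _ _ _ _ measurableT iY.
  have YN0 A : G A -> \int[P]_(w in A) (- Y w) <= 0.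
    by move=> GA; rewrite RintegralN_integrable ?Y0 ?oppr0//; [exact: GT|exact: iAY].
  have := cond_le0 (fun w => - Y w) b (2 * M) iYN YN0 mb b0.
  have -> : \int[P]_w (b w * - Y w) = \int[P]_w (- (b w * Y w)).
    by apply: eq_Rintegral => w _; ring.
  by rewrite RintegralN_integrable// oppr_le0.
have msum : sub_measurable G (fun w => be w + M).
  by apply/sub_measurableP/measurable_funD => //; exact/sub_measurableP.
have bM' w : - M <= be w <= M by rewrite -ler_norml.
have h1 : \int[P]_w ((be w + M) * Y w) = 0.
  by apply: ipos => // w; have /andP[b1 b2] := bM' w; apply/andP; split; lra.
have h2 : \int[P]_w (M * Y w) = 0.
  by rewrite RintegralZl// Y0 ?mulr0//; exact: sub_algebra_setT.
have ib : P.-integrable setT (EFin \o (fun w => be w * Y w)).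
  exact: (@integrable_boundedM _ _ _ _ _ _ M).
have iM : P.-integrable setT (EFin \o (fun w => M * Y w)).
  by apply: eq_integrable (integrableZl _ M iY).
have := RintegralD _ ib iM; rewrite h2 addr0 => /(_ measurableT) <-.
by rewrite -h1; apply: eq_Rintegral => w _; ring.
Qed.

End subalgebra.

(* On [x <= D] the function [pos5 (a + x)] lies below the parabola that touches
   it at [- b] and meets it at [D]. *)
Section parabola.
Context (R : realType).
Implicit Types a b D s x : R.

Definition pos4 (u : R) : R := (Num.max 0 u) ^+ 4.

(** With [c = a - b] and [D = 2 * s - b], the parabola is [pos5 c + 5 pos4 c (x + b) + gamma (x +
    b)^2], and [gamma] makes it meet [pos5 (a + x)] at [x = D]. [beta] and [alpha] are its lower
    coefficients after expansion in powers of [x], the form in which it is integrated. *)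
Definition gamma s b a : R :=
  (pos5 (a + (2 * s - b)) - pos5 (a - b) - 5 * pos4 (a - b) * (2 * s)) / (2 * s) ^+ 2.

Definition beta s b a : R := 5 * pos4 (a - b) + 2 * gamma s b a * b.

Definition alpha s b a : R := pos5 (a - b) + 5 * pos4 (a - b) * b + gamma s b a * b ^+ 2.

Lemma pos4_ge0 (u : R) : 0 <= pos4 u.
Proof. by rewrite /pos4 exprn_ge0// le_max lexx. Qed.

(** Convexity, with [5 * pos4] as the derivative. It gives both the sign of [gamma] and the
    submartingale inequality. *)
Lemma pos5_tangent (u v : R) : pos5 u + 5 * pos4 u * v <= pos5 (u + v).
Proof.
have [u0|u0] := leP u 0.
  by rewrite (@pos5_eq0 _ u)// /pos4 max_l// expr0n/= mulr0 mul0r add0r pos5_ge0.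
rewrite pos5_id; last exact: ltW.
rewrite /pos4 max_r; last exact: ltW.
have [uv|uv] := leP (u + v) 0.
  rewrite pos5_eq0//.
  have -> : u ^+ 5 + 5 * u ^+ 4 * v = u ^+ 4 * (5 * (u + v) - 4 * u) by ring.
  by apply: mulr_ge0_le0; [exact: exprn_ge0 (ltW u0)|lra].
rewrite pos5_id; last exact: ltW.
pose w := u + v; have -> : v = w - u by rewrite /w; ring.
rewrite (_ : u + (w - u) = w); last by ring.
have w0 : 0 < w by [].
rewrite -subr_ge0.
have -> : w ^+ 5 - (u ^+ 5 + 5 * u ^+ 4 * (w - u)) =
  (w - u) ^+ 2 * (w ^+ 3 + 2 * (u * w ^+ 2) + 3 * (u ^+ 2 * w) + 4 * u ^+ 3) by ring.
apply: mulr_ge0; first exact: sqr_ge0.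
have ? : 0 <= w ^+ 3 by apply: exprn_ge0; exact: ltW.
have ? : 0 <= u ^+ 3 by apply: exprn_ge0; exact: ltW.
have ? : 0 <= u * w ^+ 2 by apply: mulr_ge0; [exact: ltW|exact: sqr_ge0].
have ? : 0 <= u ^+ 2 * w by apply: mulr_ge0; [exact: sqr_ge0|exact: ltW].
lra.
Qed.

Lemma gamma_ge0 s b a : 0 < s -> 0 <= gamma s b a.
Proof.
move=> s0; apply: divr_ge0; last exact: sqr_ge0.
have := pos5_tangent (a - b) (2 * s).
by rewrite (_ : a - b + 2 * s = a + (2 * s - b)); [lra|ring].
Qed.

(* The second difference quotient of [pos5] at [c] is nondecreasing. *)
Lemma pos5_quotient (c y w : R) : y <= w -> 0 < w ->
  (pos5 (c + y) - pos5 c - 5 * pos4 c * y) * w ^+ 2 <=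
  (pos5 (c + w) - pos5 c - 5 * pos4 c * w) * y ^+ 2.
Proof.
move=> yw w0; have [c0|c0] := leP c 0.
  rewrite (@pos5_eq0 _ c)// /pos4 max_l// expr0n/= mulr0 !mul0r !subr0.
  have [cy|cy] := leP (c + y) 0.
    by rewrite pos5_eq0// mul0r mulr_ge0 ?pos5_ge0 ?sqr_ge0.
  have y0 : 0 < y by lra.
  rewrite !pos5_id; [|lra|lra].
  rewrite -subr_ge0.
  (* With [c = - m], [y = m + p] and [w = m + p + r], the claim compares [p ^ 5 / (m + p) ^ 2] at
     [p] and at [p + r]; both [p / (m + p)] and [p ^ 3] increase. *)
  pose m := - c; have m0 : 0 <= m by rewrite /m; lra.
  pose p := c + y; pose r := w - y.
  have p0 : 0 <= p by exact: ltW.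
  have r0 : 0 <= r by rewrite /r; lra.
  have -> : w = m + p + r by rewrite /m /p /r; ring.
  have -> : y = m + p by rewrite /m /p; ring.
  have -> : c = - m by rewrite /m opprK.
  have -> : - m + (m + p + r) = p + r by ring.
  have -> : - m + (m + p) = p by ring.
  have h1 : p * (m + p + r) <= (p + r) * (m + p).
    by rewrite -subr_ge0 (_ : _ - _ = r * m); [exact: mulr_ge0|ring].
  have h2 : p ^+ 2 * (m + p + r) ^+ 2 <= (p + r) ^+ 2 * (m + p) ^+ 2.
    rewrite -!exprMn; apply: lerXn2r => //; rewrite nnegrE mulr_ge0//; lra.
  have h3 : p ^+ 3 <= (p + r) ^+ 3 by apply: lerXn2r; rewrite ?nnegrE; lra.
  rewrite subr_ge0.
  have -> : p ^+ 5 * (m + p + r) ^+ 2 = p ^+ 3 * (p ^+ 2 * (m + p + r) ^+ 2) by ring.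
  have -> : (p + r) ^+ 5 * (m + p) ^+ 2 = (p + r) ^+ 3 * ((p + r) ^+ 2 * (m + p) ^+ 2) by ring.
  apply: ler_pM => //; first exact: exprn_ge0.
  by apply: mulr_ge0; exact: sqr_ge0.
rewrite /pos4 max_r; last exact: ltW.
have cw : 0 < c + w by lra.
rewrite (@pos5_id _ (c + w)) ?(@pos5_id _ c); try exact: ltW.
have -> : (c + w) ^+ 5 - c ^+ 5 - 5 * c ^+ 4 * w =
  w ^+ 2 * (10 * c ^+ 3 + 10 * c ^+ 2 * w + 5 * c * w ^+ 2 + w ^+ 3) by ring.
pose A (v : R) := 10 * c ^+ 3 + 10 * c ^+ 2 * v + 5 * c * v ^+ 2 + v ^+ 3.
rewrite -/(A w) (_ : w ^+ 2 * A w * y ^+ 2 = y ^+ 2 * A w * w ^+ 2); last by ring.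
apply: ler_wpM2r; first exact: sqr_ge0.
have [cy|cy] := leP (c + y) 0; last first.
  rewrite pos5_id; last exact: ltW.
  have -> : (c + y) ^+ 5 - c ^+ 5 - 5 * c ^+ 4 * y = y ^+ 2 * A y by rewrite /A; ring.
  apply: ler_wpM2l; first exact: sqr_ge0.
  rewrite -subr_ge0 (_ : A w - A y = (w - y) * (3 / 4 * (w + y + 10 / 3 * c) ^+ 2 +
    5 / 3 * c ^+ 2 + (w - y) ^+ 2 / 4)); last by rewrite /A; field.
  apply: mulr_ge0; first by rewrite subr_ge0.
  have ? := sqr_ge0 (w + y + 10 / 3 * c).
  have ? := sqr_ge0 c.
  have ? := sqr_ge0 (w - y).
  lra.
rewrite pos5_eq0// sub0r.
have c3 : 0 <= c ^+ 3 by apply: exprn_ge0; exact: ltW.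
apply: (@le_trans _ _ (y ^+ 2 * (4 * c ^+ 3))).
  rewrite -subr_ge0 (_ : _ - _ = c ^+ 3 * ((- (4 * y + c)) * (- (c + y)))); last by ring.
  by apply: mulr_ge0 => //; apply: mulr_ge0; lra.
apply: ler_wpM2l; first exact: sqr_ge0.
have ? : 0 <= c ^+ 2 * w by apply: mulr_ge0; [exact: sqr_ge0|exact: ltW].
have ? : 0 <= c * w ^+ 2 by apply: mulr_ge0; [exact: ltW|exact: sqr_ge0].
have ? : 0 <= w ^+ 3 by apply: exprn_ge0; exact: ltW.
by rewrite /A; lra.
Qed.

Lemma parabola_above s b a x : 0 < s -> x <= 2 * s - b ->
  pos5 (a + x) <= alpha s b a + beta s b a * x + gamma s b a * x ^+ 2.
Proof.
move=> s0 xD.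
have xb : x + b <= 2 * s by lra.
have s2 : 0 < 2 * s by lra.
have := pos5_quotient (a - b) (x + b) (2 * s) xb s2.
have -> : a - b + (x + b) = a + x by ring.
have -> : a - b + 2 * s = a + (2 * s - b) by ring.
have s20 : 0 < (2 * s) ^+ 2 by exact: exprn_gt0.
rewrite -ler_pdivlMr// [leRHS]mulrAC -/(gamma s b a) /beta /alpha.
set g := gamma s b a; lra.
Qed.

(** The mean-zero law on [D = 2 * s - b] and [- b] has second moment [D * b], and the parabola
    agrees with [pos5 (a + x)] at both points. *)
Lemma parabola_mean s b a : 0 < s ->
  alpha s b a + gamma s b a * ((2 * s - b) * b) =
  (b * pos5 (a + (2 * s - b)) + (2 * s - b) * pos5 (a - b)) / (2 * s).
Proof.
move=> s0; rewrite /alpha /gamma; field.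
by rewrite gt_eqF.
Qed.

End parabola.

Arguments sub_measurableP {d T G} sG {d' U f}.

Section one_step_le.
Context d (T : measurableType d) (R : realType) (P : probability T R).
Variable (G : set_system T).
Hypotheses (sG : sigma_algebra setT G) (GT : G `<=` measurable).

Lemma measurable_pos4 : measurable_fun [set: R] (@pos4 R).
Proof.
apply: measurable_continuous => x.
apply: (@continuous_comp _ _ _ (cst 0 \max (@id R)) (fun u : R => u ^+ 4)).
  by apply: continuous_max; [exact: cst_continuous|exact: cvg_id].
exact: exprn_continuous.
Qed.

Lemma measurable_pos5 : measurable_fun [set: R] (@pos5 R).
Proof. by apply: measurable_continuous; exact: pos5_continuous. Qed.

Lemma measurable_gamma d' (T' : measurableType d') (s : R) (b a : T' -> R) :
  measurable_fun setT b -> measurable_fun setT a ->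
  measurable_fun setT (fun w => gamma R s (b w) (a w)).
Proof.
move=> mb ma; rewrite /gamma.
apply: measurable_funM => //; apply: measurable_funB; first apply: measurable_funB.
- apply: (measurableT_comp measurable_pos5); apply: measurable_funD => //.
  by apply: measurable_funB.
- by apply: (measurableT_comp measurable_pos5); apply: measurable_funB.
- apply: measurable_funM => //; apply: measurable_funM => //.
  by apply: (measurableT_comp measurable_pos4); apply: measurable_funB.
Qed.

Lemma measurable_beta d' (T' : measurableType d') (s : R) (b a : T' -> R) :
  measurable_fun setT b -> measurable_fun setT a ->
  measurable_fun setT (fun w => beta R s (b w) (a w)).
Proof.
move=> mb ma; rewrite /beta; apply: measurable_funD.
  apply: measurable_funM => //.
  by apply: (measurableT_comp measurable_pos4); apply: measurable_funB.
by do 2 (apply: measurable_funM => //); exact: measurable_gamma.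
Qed.

Lemma measurable_alpha d' (T' : measurableType d') (s : R) (b a : T' -> R) :
  measurable_fun setT b -> measurable_fun setT a ->
  measurable_fun setT (fun w => alpha R s (b w) (a w)).
Proof.
move=> mb ma; rewrite /alpha; apply: measurable_funD; first apply: measurable_funD.
- by apply: (measurableT_comp measurable_pos5); apply: measurable_funB.
- apply: measurable_funM => //; apply: measurable_funM => //.
  by apply: (measurableT_comp measurable_pos4); apply: measurable_funB.
- by apply: measurable_funM; [exact: measurable_gamma|exact: measurable_funX].
Qed.

Lemma max0X_le (n : nat) (u L : R) : 0 <= L -> u <= L -> (Num.max 0 u) ^+ n <= L ^+ n.
Proof.
by move=> L0 uL; apply: lerXn2r; rewrite ?nnegrE ?le_max ?lexx// ge_max L0.
Qed.

Lemma measurable_gG (S : T -> R) (s t : R) : 0 <= s -> measurable_fun setT S ->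
  measurable_fun setT (fun w => (gG s (t - S w))%:E).
Proof.
move=> s0 mS; under eq_fun do rewrite -gGE//.
apply: (@measurable_fun_fubini_tonelli_F _ _ _ _ R lebesgue_measure
  (fun p : T * R => (pos5 (s * p.2 - (t - S p.1)) * gphi p.2)%:E)).
  apply/measurable_EFinP; apply: measurable_funM.
    apply: (measurableT_comp measurable_pos5); apply: measurable_funB.
      by apply: measurable_funM => //; exact: measurable_snd.
    by apply: measurable_funB => //; apply: (measurableT_comp mS); exact: measurable_fst.
  have mg : measurable_fun [set: R] (@gphi R).
    by apply: measurable_continuous; exact: gphi_continuous.
  by apply: (measurableT_comp mg); exact: measurable_snd.
by move=> p; rewrite lee_fin mulr_ge0 ?pos5_ge0 ?gphi_ge0.
Qed.

(** The parabola at [X] is integrated with random coefficients: the linear term has integral zero,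
    and in the quadratic one [gamma >= 0] lets the variance bound replace [X ^ 2]. What is left is
    the two-point mean. The bound [K] on [S] makes the coefficients bounded. *)
Lemma one_step_le (S X D : T -> R) (s K t : R) : 0 < s ->
  sub_measurable G S -> sub_measurable G D ->
  (forall w, S w <= K) -> (forall w, 0 < D w <= 2 * s) -> (forall w, X w <= D w) ->
  P.-integrable setT (EFin \o X) -> (forall A, G A -> \int[P]_(w in A) X w = 0) ->
  P.-integrable setT (EFin \o (fun w => X w ^+ 2)) ->
  (forall A, G A ->
    \int[P]_(w in A) X w ^+ 2 <= \int[P]_(w in A) (D w * (2 * s - D w))) ->
  (\int[P]_w (pos5 (S w + X w - t))%:E <= \int[P]_w (gG s (t - S w))%:E)%E.
Proof.
move=> s0 GS GD SK Ds XD iX X0 iX2 X2.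
pose a w := S w - t; pose b w := 2 * s - D w.
pose al w := alpha R s (b w) (a w); pose be w := beta R s (b w) (a w).
pose ga w := gamma R s (b w) (a w).
have mS := sub_measurable_fun _ _ _ GT _ _ _ GS.
have mD := sub_measurable_fun _ _ _ GT _ _ _ GD.
have mX : measurable_fun setT X by apply/measurable_EFinP; exact: measurable_int iX.
have ma : measurable_fun setT a by apply: measurable_funB.
have mb : measurable_fun setT b by apply: measurable_funB.
have mpos5 := measurable_pos5.
have Gbe : sub_measurable G be.
  by apply/(sub_measurableP sG)/measurable_beta; apply: measurable_funB => //; exact/(sub_measurableP sG).
have Gga : sub_measurable G ga.
  by apply/(sub_measurableP sG)/measurable_gamma; apply: measurable_funB => //; exact/(sub_measurableP sG).
pose L := `|K| + `|t| + 2 * s.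
have L0 : 0 <= L by rewrite /L !addr_ge0//; lra.
have KL : K - t + 2 * s <= L.
  by rewrite /L lerD2r; apply: lerD; [exact: ler_norm|rewrite -normrN; exact: ler_norm].
have b0 w : 0 <= b w < 2 * s by have /andP[? ?] := Ds w; rewrite /b; apply/andP; split; lra.
have aL w : a w - b w <= L.
  by have := SK w; have /andP[? ?] := b0 w; rewrite /a; lra.
have aDL w : a w + (2 * s - b w) <= L.
  by have := SK w; have /andP[? ?] := b0 w; rewrite /a; lra.
pose M := L ^+ 5 / (2 * s) ^+ 2.
have s20 : 0 < (2 * s) ^+ 2 by apply: exprn_gt0; lra.
have ga0 w : 0 <= ga w by exact: gamma_ge0.
have gaM w : 0 <= ga w <= M.
  rewrite ga0/= /ga /gamma /M ler_pM2r ?invr_gt0//.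
  have := @max0X_le 5 _ _ L0 (aDL w); rewrite -/(pos5 _) => h1.
  have h2 := @pos5_ge0 R (a w - b w).
  have h3 : 0 <= 5 * pos4 R (a w - b w) * (2 * s).
    by apply: mulr_ge0; [apply: mulr_ge0; [lra|exact: pos4_ge0]|lra].
  by lra.
have p4L w : 0 <= pos4 R (a w - b w) <= L ^+ 4.
  by rewrite pos4_ge0/=; exact: max0X_le.
have beM w : `|be w| <= 5 * L ^+ 4 + 2 * M * (2 * s).
  have /andP[p1 p2] := p4L w; have /andP[g1 g2] := gaM w; have /andP[b1 b2] := b0 w.
  have h : 0 <= ga w * b w <= M * (2 * s).
    by rewrite mulr_ge0//= ler_pM// ltW.
  have /andP[h1 h2] := h.
  by rewrite ger0_norm /be /beta -/(ga w); lra.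
have M0 : 0 <= M by rewrite divr_ge0 ?exprn_ge0//; lra.
pose r w := al w + ga w * (D w * b w).
have rE w : r w = (b w * pos5 (D w - (t - S w)) + D w * pos5 (- b w - (t - S w))) / (2 * s).
  have := @parabola_mean R s (b w) (a w) s0.
  have -> : 2 * s - b w = D w by rewrite /b; ring.
  have -> : a w + D w = D w - (t - S w) by rewrite /a; ring.
  by have -> : a w - b w = - b w - (t - S w) by rewrite /a; ring.
have r0 w : 0 <= r w.
  have /andP[? ?] := Ds w; have /andP[? ?] := b0 w.
  rewrite rE divr_ge0//; last lra.
  by rewrite addr_ge0// mulr_ge0 ?pos5_ge0// ltW.
have rG w : r w <= gG s (t - S w).
  have /andP[? ?] := Ds w; have /andP[? ?] := b0 w.
  by rewrite rE; apply: two_point_le_gG; rewrite // ?ltW//; rewrite /b; ring.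
have mal : measurable_fun setT al by exact: measurable_alpha.
have mbe : measurable_fun setT be by exact: measurable_beta.
have mga : measurable_fun setT ga by exact: measurable_gamma.
have mr : measurable_fun setT r.
  by apply: measurable_funD => //; do 2 (apply: measurable_funM => //).
have ir : P.-integrable setT (EFin \o r).
  apply: (@integrable_bounded _ _ _ _ _ (2 * L ^+ 5)) => // w.
  rewrite ger0_norm// rE ler_pdivrMr; last lra.
  have /andP[d1 d2] := Ds w; have /andP[b1 b2] := b0 w.
  have h1 : pos5 (D w - (t - S w)) <= L ^+ 5.
    by apply: max0X_le => //; have := aDL w; rewrite /a /b; lra.
  have h2 : pos5 (- b w - (t - S w)) <= L ^+ 5.
    by apply: max0X_le => //; have := aL w; rewrite /a /b; lra.
  have h3 : b w * pos5 (D w - (t - S w)) <= 2 * s * L ^+ 5.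
    by apply: ler_pM; rewrite ?pos5_ge0// ltW.
  have h4 : D w * pos5 (- b w - (t - S w)) <= 2 * s * L ^+ 5.
    by apply: ler_pM; rewrite ?pos5_ge0// ltW.
  lra.
pose Y w := X w ^+ 2 - D w * (2 * s - D w).
have iDb : P.-integrable setT (EFin \o (fun w => D w * (2 * s - D w))).
  apply: (@integrable_bounded _ _ _ _ _ (2 * s * (2 * s))).
    by apply: measurable_funM.
  move=> w; have /andP[d1 d2] := Ds w; have /andP[b1 b2] := b0 w.
  rewrite ger0_norm; last by rewrite mulr_ge0 ?subr_ge0// ltW.
  by apply: ler_pM => //; lra.
have iY : P.-integrable setT (EFin \o Y) by apply: eq_integrable (integrableB _ iX2 iDb).
have iS A (f : T -> R) : G A -> P.-integrable setT (EFin \o f) -> P.-integrable A (EFin \o f).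
  by move=> GA; apply: integrableS => //; exact: GT.
have Y0 A : G A -> \int[P]_(w in A) Y w <= 0.
  by move=> GA; rewrite RintegralB ?subr_le0 ?X2//; [exact: GT|exact: iS|exact: iS].
have bX := @cond_eq0 _ _ _ P G sG GT X be _ iX X0 Gbe beM.
have gY := @cond_le0 _ _ _ P G GT Y ga _ iY Y0 Gga gaM.
have ibX : P.-integrable setT (EFin \o (fun w => be w * X w)).
  exact: integrable_boundedM beM iX.
have igY : P.-integrable setT (EFin \o (fun w => ga w * Y w)).
  apply: (@integrable_boundedM _ _ _ _ _ _ M) => // w.
  by have /andP[? ?] := gaM w; rewrite ger0_norm.
(* The parabola at [X], regrouped as the two-point mean plus one term of integral zero and one of
   nonpositive integral. *)
pose h w := r w + be w * X w + ga w * Y w.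
have irb : P.-integrable setT (EFin \o (fun w => r w + be w * X w)).
  by apply: eq_integrable (integrableD _ ir ibX).
have ih : P.-integrable setT (EFin \o h) by apply: eq_integrable (integrableD _ irb igY).
have hge w : pos5 (S w + X w - t) <= h w.
  have -> : h w = al w + be w * X w + ga w * X w ^+ 2 by rewrite /h /r /Y /b; ring.
  have -> : S w + X w - t = a w + X w by rewrite /a; ring.
  by apply: parabola_above => //; rewrite /b; have := XD w; lra.
apply: (@le_trans _ _ (\int[P]_w (h w)%:E)%E).
  apply: ge0_le_integral => //=.
  - by move=> w _; rewrite lee_fin pos5_ge0.
  - apply/measurable_EFinP; apply: (measurableT_comp mpos5).
    by apply: measurable_funB => //; apply: measurable_funD.
  - exact: measurable_int ih.
  - by move=> w _; rewrite lee_fin.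
apply: (@le_trans _ _ (\int[P]_w (r w)%:E)%E).
  rewrite -(fineK (integrable_fin_num measurableT ih)) -(fineK (integrable_fin_num measurableT ir)).
  rewrite lee_fin -/(Rintegral _ _ _) -/(Rintegral P setT r).
  by rewrite /h RintegralD// RintegralD// bX addr0 gerDl.
apply: ge0_le_integral => //=.
- by move=> w _; rewrite lee_fin.
- exact: measurable_int ir.
- by apply: measurable_gG => //; exact: ltW.
- by move=> w _; rewrite lee_fin.
Qed.

End one_step_le.

(** * From almost sure conditions to the variance bound *)

Section ae_sign.
Context d (T : measurableType d) (R : realType) (P : probability T R).
Variable (G : set_system T).
Hypotheses (sG : sigma_algebra setT G) (GT : G `<=` measurable).

Lemma Rintegral_ae_eq (D : set T) (f g : T -> R) : measurable D ->
  measurable_fun setT f -> measurable_fun setT g ->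
  {ae P, forall w, f w = g w} -> \int[P]_(w in D) f w = \int[P]_(w in D) g w.
Proof.
move=> mD mf mg fg; rewrite /Rintegral; congr fine.
apply: ae_eq_integral => //.
- by apply/measurable_EFinP; exact: measurable_funTS.
- by apply/measurable_EFinP; exact: measurable_funTS.
- by apply: filterS fg => w /= -> _.
Qed.

Lemma integrable_ae_eq (f g : T -> R) : measurable_fun setT g ->
  {ae P, forall w, f w = g w} -> P.-integrable setT (EFin \o f) ->
  P.-integrable setT (EFin \o g).
Proof.
move=> mg fg iF; apply/integrableP; split; first exact/measurable_EFinP.
have mf : measurable_fun setT f by apply/measurable_EFinP; exact: measurable_int iF.
have /integrableP[_] := iF; apply: le_lt_trans.
rewrite le_eqVlt; apply/orP; left; apply/eqP.
apply: ge0_ae_eq_integral => //.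
- by do 2 apply: measurableT_comp => //; exact/measurable_EFinP.
- by do 2 apply: measurableT_comp => //; exact/measurable_EFinP.
- by apply: filterS fg => w /= -> _.
Qed.

Lemma ae_le_Rintegral (D : set T) (f g : T -> R) : measurable D ->
  P.-integrable setT (EFin \o f) -> P.-integrable setT (EFin \o g) ->
  {ae P, forall w, D w -> f w <= g w} -> \int[P]_(w in D) f w <= \int[P]_(w in D) g w.
Proof.
move=> mD iF ig fg.
have mf : measurable_fun setT f by apply/measurable_EFinP; exact: measurable_int iF.
have mg : measurable_fun setT g by apply/measurable_EFinP; exact: measurable_int ig.
have mh : measurable_fun setT (fun w => f w - Num.max 0 (f w - g w)).
  apply: measurable_funB => //; apply: measurable_maxr => //; exact: measurable_funB.
have ih : P.-integrable D (EFin \o (fun w => f w - Num.max 0 (f w - g w))).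
  apply: (@eq_integrable _ _ _ _ D mD (EFin \o (fun w => Num.min (f w) (g w)))).
    move=> w _; congr EFin; case: (lerP (f w) (g w)) => h.
      by rewrite max_l ?subr0// subr_le0.
    by rewrite max_r ?subKr// subr_ge0 ltW.
  apply: integrableS (measurableT) _ _ _ => //.
  have iFg : P.-integrable setT (EFin \o (fun w => `|f w| + `|g w|)).
    have iaf : P.-integrable setT (EFin \o (fun w => `|f w|)) by apply: integrable_norm.
    have iag : P.-integrable setT (EFin \o (fun w => `|g w|)) by apply: integrable_norm.
    by apply: eq_integrable (integrableD _ iaf iag).
  apply: le_integrable iFg => //.
    by apply/measurable_EFinP; exact: measurable_minr.
  move=> w _; rewrite lee_fin [leRHS]ger0_norm ?addr_ge0//.
  by case: (lerP (f w) (g w)) => _; rewrite ?lerDl ?lerDr.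
apply: (@le_trans _ _ (\int[P]_(w in D) (f w - Num.max 0 (f w - g w)))).
  rewrite le_eqVlt; apply/orP; left; apply/eqP; rewrite /Rintegral; congr fine.
  apply: ae_eq_integral => //.
  - by apply/measurable_EFinP; exact: measurable_funTS.
  - by apply/measurable_EFinP; exact: measurable_funTS.
  - by apply: filterS fg => w /= h Dw; rewrite max_l ?subr0// subr_le0 h.
apply: le_Rintegral => //; first exact: integrableS ig.
move=> w _; case: (lerP (f w) (g w)) => h.
  by rewrite max_l ?subr0// subr_le0.
by rewrite max_r ?subKr// subr_ge0 ltW.
Qed.

Lemma ae_eq0_integral_abs (A : set T) (V : T -> \bar R) : measurable A -> measurable_fun setT V ->
  (\int[P]_(w in A) `|V w| <= 0)%E -> {ae P, forall w, A w -> V w = 0%E}.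
Proof.
move=> mA mV V0; apply: (iffLR (ae_eq_integral_abs _ mA _)).
- exact: measurable_funTS.
- by apply/eqP; rewrite eq_le V0/= integral_ge0.
Qed.

Lemma ae_ge0_sub (V : T -> \bar R) : sub_measurable G V ->
  (forall A, G A -> (0 <= \int[P]_(w in A) V w)%E) -> {ae P, forall w, (0 <= V w)%E}.
Proof.
move=> GV V0; have mV := sub_measurable_fun _ _ _ GT _ _ _ GV.
pose A := V @^-1` `]-oo, 0%E[%classic.
have GA : G A.
  by rewrite -[A]setTI; apply: GV; exists `]-oo, 0%E[%classic => //; exact: emeasurable_itv.
have V0A : (\int[P]_(w in A) `|V w| <= 0)%E.
  have := V0 A GA.
  rewrite (_ : \int[P]_(w in A) V w = - \int[P]_(w in A) `|V w|)%E ?oppe_ge0//.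
  rewrite -integral_ge0N//; apply: eq_integral => w; rewrite inE /A/= in_itv/= => Vw.
  by rewrite lee0_abs ?oppeK// ltW.
apply: filterS (ae_eq0_integral_abs _ _ (GT _ GA) mV V0A) => w h.
rewrite leNgt; apply/negP => Vw.
by move: (Vw); rewrite h ?ltxx// /A/= in_itv/= Vw.
Qed.

Lemma ae_le0_sub (V : T -> \bar R) : sub_measurable G V ->
  (forall A, G A -> (\int[P]_(w in A) V w <= 0)%E) -> {ae P, forall w, (V w <= 0)%E}.
Proof.
move=> GV V0; have mV := sub_measurable_fun _ _ _ GT _ _ _ GV.
pose A := V @^-1` `]0%E, +oo[%classic.
have GA : G A.
  by rewrite -[A]setTI; apply: GV; exists `]0%E, +oo[%classic => //; exact: emeasurable_itv.
have V0A : (\int[P]_(w in A) `|V w| <= 0)%E.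
  apply: le_trans (V0 A GA); rewrite le_eqVlt; apply/orP; left; apply/eqP.
  by apply: eq_integral => w; rewrite inE /A/= in_itv/= andbT => Vw; rewrite gee0_abs// ltW.
apply: filterS (ae_eq0_integral_abs _ _ (GT _ GA) mV V0A) => w h.
rewrite leNgt; apply/negP => Vw.
by move: (Vw); rewrite h ?ltxx// /A/= in_itv/= Vw.
Qed.

(** On the event [C > 0], which lies in [G], the variable [X] is positive almost surely and has
    integral zero; so the event is null. *)
Lemma ae_le0_cond (X C : T -> R) : P.-integrable setT (EFin \o X) ->
  (forall A, G A -> \int[P]_(w in A) X w = 0) -> sub_measurable G C ->
  {ae P, forall w, C w <= X w} -> {ae P, forall w, C w <= 0}.
Proof.
move=> iX X0 GC CX; pose A := C @^-1` `]0, +oo[%classic.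
have GA : G A by exact: sub_measurable_preimage.
have mA := GT _ GA.
have mX : measurable_fun setT (EFin \o X) by exact: measurable_int iX.
have X0A : (\int[P]_(w in A) `|(EFin \o X) w| <= 0)%E.
  have -> : (\int[P]_(w in A) `|(EFin \o X) w| = \int[P]_(w in A) (X w)%:E)%E.
    apply: ae_eq_integral => //.
    - by apply: measurable_funTS; exact: measurableT_comp.
    - exact: measurable_funTS.
    - apply: filterS CX => w Cw; rewrite /A/= in_itv/= andbT => C0.
      by rewrite ger0_norm// (le_trans _ Cw)// ltW.
  have iA : P.-integrable A (EFin \o X) by apply: integrableS iX.
  by rewrite -(fineK (integrable_fin_num mA iA)) lee_fin -/(Rintegral P A X) X0.
apply: filterS2 CX (ae_eq0_integral_abs _ _ mA mX X0A) => w Cw h.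
rewrite leNgt; apply/negP => C0.
have /= [Xw] : (EFin \o X) w = 0%E by apply: h; rewrite /A/= in_itv/= andbT.
by move: (lt_le_trans C0 Cw); rewrite Xw ltxx.
Qed.

(* Common consequence of the two alternatives: [D * (2 * s - D)] is the variance
   of the mean-zero law on the points [D] and [D - 2 * s]. *)
Definition step_bound (X : T -> R) (s : R) := exists D : T -> R,
  [/\ sub_measurable G D, forall w, 0 < D w <= 2 * s, {ae P, forall w, X w <= D w},
    P.-integrable setT (EFin \o (fun w => X w ^+ 2))
  & forall A, G A ->
    \int[P]_(w in A) X w ^+ 2 <= \int[P]_(w in A) (D w * (2 * s - D w))].

Lemma integrable_two_point_var (D : T -> R) (s : R) : measurable_fun setT D ->
  (forall w, 0 < D w <= 2 * s) -> P.-integrable setT (EFin \o (fun w => D w * (2 * s - D w))).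
Proof.
move=> mD Ds; apply: (@integrable_bounded _ _ _ _ _ (2 * s * (2 * s))).
  by apply: measurable_funM => //; apply: measurable_funB.
move=> w; have /andP[d1 d2] := Ds w.
rewrite ger0_norm; last by apply: mulr_ge0; lra.
by apply: ler_pM; lra.
Qed.

(** Truncating [S] at [K] and [X] at [D] changes them on a null set only and makes the bounds of
    [one_step_le] hold at every point. *)
Lemma step_bound_pos5_le (S X : T -> R) (s K t : R) : 0 < s ->
  sub_measurable G S -> {ae P, forall w, S w <= K} ->
  P.-integrable setT (EFin \o X) -> (forall A, G A -> \int[P]_(w in A) X w = 0) ->
  step_bound X s ->
  (\int[P]_w (pos5 (S w + X w - t))%:E <= \int[P]_w (gG s (t - S w))%:E)%E.
Proof.
move=> s0 GS SK iX X0 [D [GD Ds XD iX2 X2]].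
pose S1 w := Num.min (S w) K; pose X1 w := Num.min (X w) (D w).
have mS := sub_measurable_fun _ _ _ GT _ _ _ GS.
have mD := sub_measurable_fun _ _ _ GT _ _ _ GD.
have mX : measurable_fun setT X by apply/measurable_EFinP; exact: measurable_int iX.
have GS1 : sub_measurable G S1.
  by apply/(sub_measurableP sG)/measurable_minr => //; exact/(sub_measurableP sG).
have mS1 := sub_measurable_fun _ _ _ GT _ _ _ GS1.
have mX1 : measurable_fun setT X1 by exact: measurable_minr.
have eS : {ae P, forall w, S w = S1 w} by apply: filterS SK => w h; rewrite /S1 min_l.
have eX : {ae P, forall w, X w = X1 w} by apply: filterS XD => w h; rewrite /X1 min_l.
have eX2 : {ae P, forall w, X w ^+ 2 = X1 w ^+ 2} by apply: filterS eX => w ->.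
have mX2 : measurable_fun setT (fun w => X w ^+ 2) by exact: measurable_funX.
have mX12 : measurable_fun setT (fun w => X1 w ^+ 2) by exact: measurable_funX.
have mp5 (f : T -> R) : measurable_fun setT f -> measurable_fun setT (fun w => (pos5 (f w))%:E).
  by move=> mf; apply/measurable_EFinP; exact: (measurableT_comp (measurable_pos5 R)).
have -> : (\int[P]_w (pos5 (S w + X w - t))%:E = \int[P]_w (pos5 (S1 w + X1 w - t))%:E)%E.
  apply: ge0_ae_eq_integral => //.
  - by apply: mp5; apply: measurable_funB => //; exact: measurable_funD.
  - by apply: mp5; apply: measurable_funB => //; exact: measurable_funD.
  - by move=> w _; rewrite lee_fin pos5_ge0.
  - by move=> w _; rewrite lee_fin pos5_ge0.
  - by apply: filterS2 eS eX => w /= <- <- _.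
have -> : (\int[P]_w (gG s (t - S w))%:E = \int[P]_w (gG s (t - S1 w))%:E)%E.
  apply: ge0_ae_eq_integral => //.
  - by apply: measurable_gG => //; exact: ltW.
  - by apply: measurable_gG => //; exact: ltW.
  - by move=> w _; rewrite lee_fin gG_ge0.
  - by move=> w _; rewrite lee_fin gG_ge0.
  - by apply: filterS eS => w /= <- _.
apply: (@one_step_le _ _ _ _ G sG GT S1 X1 D s K t) => //.
- by move=> w; rewrite /S1 ge_min lexx orbT.
- by move=> w; rewrite /X1 ge_min lexx orbT.
- exact: integrable_ae_eq eX iX.
- by move=> A GA; rewrite -(@Rintegral_ae_eq A X X1) ?X0//; exact: GT.
- exact: integrable_ae_eq eX2 iX2.
- move=> A GA; rewrite -(@Rintegral_ae_eq A (fun w => X w ^+ 2)) ?X2//; exact: GT.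
Qed.

(** From [(X - C) * (D - X) >= 0] one has [X ^ 2 <= (C + D) * X - C * D]. The linear term integrates
    to zero over sets of [G], and [- C <= 2 * s - D] with [D >= 0] bounds the rest by
    [D * (2 * s - D)]. *)
Lemma step_boundA (X C D : T -> R) (s : R) : 0 < s ->
  P.-integrable setT (EFin \o X) -> (forall A, G A -> \int[P]_(w in A) X w = 0) ->
  sub_measurable G C -> sub_measurable G D ->
  {ae P, forall w, [/\ C w <= X w, X w <= D w & D w - C w <= 2 * s]} ->
  step_bound X s.
Proof.
move=> s0 iX X0 GC GD CXD.
have mX : measurable_fun setT X by apply/measurable_EFinP; exact: measurable_int iX.
have C0 : {ae P, forall w, C w <= 0}.
  by apply: ae_le0_cond iX X0 GC _; apply: filterS CXD => w [].
have D0 : {ae P, forall w, 0 <= D w}.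
  have iXN : P.-integrable setT (EFin \o (fun w => - X w)) by exact: integrableN_EFin.
  have XN0 A : G A -> \int[P]_(w in A) (- X w) = 0.
    move=> GA; rewrite RintegralN_integrable ?X0 ?oppr0//; first exact: GT.
    by apply: integrableS iX => //; exact: GT.
  have GDN : sub_measurable G (fun w => - D w).
    by apply/(sub_measurableP sG)/measurableT_comp => //; exact/(sub_measurableP sG).
  have : {ae P, forall w, - D w <= 0}.
    by apply: ae_le0_cond iXN XN0 GDN _; apply: filterS CXD => w [_ h _]; rewrite lerN2.
  by apply: filterS => w; rewrite oppr_le0.
(* Clamping changes [C] and [D] on a null set only and makes the factors below bounded at every
   point. *)
pose C1 w := Num.max (Num.min (C w) 0) (- (2 * s)).
pose D2 w := Num.min (Num.max (D w) 0) (2 * s).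
(* [step_bound] wants a positive bound. Where [D2] is 0, the value [2 * s] keeps the two-point
   variance [D * (2 * s - D)] equal to 0. *)
pose D1 w := if D2 w <= 0 then 2 * s else D2 w.
have GC' : measurable_fun [set: g_sigma_algebraType G] (C : g_sigma_algebraType G -> R).
  exact/(sub_measurableP sG).
have GD' : measurable_fun [set: g_sigma_algebraType G] (D : g_sigma_algebraType G -> R).
  exact/(sub_measurableP sG).
have GC1 : sub_measurable G C1.
  by apply/(sub_measurableP sG); apply: measurable_maxr => //; exact: measurable_minr.
have GD2 : sub_measurable G D2.
  by apply/(sub_measurableP sG); apply: measurable_minr => //; exact: measurable_maxr.
have GD1 : sub_measurable G D1.
  apply/(sub_measurableP sG); apply: measurable_fun_ifT => //; last exact/(sub_measurableP sG).
  by apply: measurable_fun_ler => //; exact/(sub_measurableP sG).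
have mC1 := sub_measurable_fun _ _ _ GT _ _ _ GC1.
have mD2 := sub_measurable_fun _ _ _ GT _ _ _ GD2.
have mD1 := sub_measurable_fun _ _ _ GT _ _ _ GD1.
have C1b w : - (2 * s) <= C1 w <= 0.
  by rewrite /C1 le_max lexx orbT/= ge_max ge_min lexx orbT/=; lra.
have D2b w : 0 <= D2 w <= 2 * s.
  by rewrite /D2 ge_min lexx orbT andbT le_min le_max lexx orbT/=; lra.
have D1b w : 0 < D1 w <= 2 * s.
  by rewrite /D1; case: (leP (D2 w) 0) => h; [|have /andP[] := D2b w; rewrite h]; lra.
have aeall : {ae P, forall w, [/\ C1 w <= X w, X w <= D2 w, D2 w - C1 w <= 2 * s
    & X w <= D1 w]}.
  apply: filterS3 CXD C0 D0 => w [h1 h2 h3] h4 h5.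
  have eC : C1 w = C w by rewrite /C1 min_l// max_l//; lra.
  have eD : D2 w = D w by rewrite /D2 max_l// min_l//; lra.
  rewrite eC eD; split => //; rewrite /D1 eD.
  by case: (leP (D w) 0) => // _; lra.
pose be w := C1 w + D2 w; pose r w := - C1 w * D2 w.
have Gbe : sub_measurable G be.
  by apply/(sub_measurableP sG)/measurable_funD; exact/(sub_measurableP sG).
have mbe := sub_measurable_fun _ _ _ GT _ _ _ Gbe.
have mr : measurable_fun setT r.
  by apply: measurable_funM => //; exact: measurableT_comp.
have ir : P.-integrable setT (EFin \o r).
  apply: (@integrable_bounded _ _ _ _ _ (2 * s * (2 * s))) => // w.
  have /andP[? ?] := C1b w; have /andP[? ?] := D2b w.
  rewrite ger0_norm /r; last by apply: mulr_ge0; lra.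
  by apply: ler_pM; lra.
have beM w : `|be w| <= 2 * s.
  have /andP[? ?] := C1b w; have /andP[? ?] := D2b w.
  by rewrite ler_norml; apply/andP; split; rewrite /be; lra.
have ibX : P.-integrable setT (EFin \o (fun w => be w * X w)).
  exact: integrable_boundedM beM iX.
have iDB := integrable_two_point_var _ _ mD1 D1b.
have iX2 : P.-integrable setT (EFin \o (fun w => X w ^+ 2)).
  pose X1 w := Num.max (Num.min (X w) (2 * s)) (- (2 * s)).
  have mX1 : measurable_fun setT X1.
    by apply: measurable_maxr => //; exact: measurable_minr.
  apply: (@integrable_ae_eq (fun w => X1 w ^+ 2)).
  - exact: measurable_funX.
  - apply: filterS aeall => w [h1 h2 h3 h4].
    have /andP[? ?] := C1b w; have /andP[? ?] := D2b w.
    by rewrite /X1 min_l ?max_l//; lra.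
  - apply: (@integrable_bounded _ _ _ _ _ ((2 * s) ^+ 2)).
      exact: measurable_funX.
    move=> w; rewrite normrX; apply: lerXn2r; rewrite ?nnegrE//; first lra.
    rewrite ler_norml /X1 le_max lexx orbT/= ge_max ge_min lexx orbT/=; lra.
exists D1; split => //; first by apply: filterS aeall => w [].
move=> A GA; have mA := GT _ GA.
have iS (f : T -> R) : P.-integrable setT (EFin \o f) -> P.-integrable A (EFin \o f).
  by move=> iF; apply: integrableS iF.
have bX0 : \int[P]_(w in A) (be w * X w) = 0.
  rewrite Rintegral_mkcond.
  have GAbe : sub_measurable G (be \_ A).
    apply/(sub_measurableP sG)/(measurable_restrictT _ _).1.
      rewrite /measurable/= (sigma_algebra_id sG)//.
    by apply: measurable_funTS; exact/(sub_measurableP sG).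
  rewrite -(@cond_eq0 _ _ _ P G sG GT X (be \_ A) (2 * s) iX X0 GAbe).
    by apply: eq_Rintegral => w _; rewrite !patchE; case: ifPn; rewrite ?mul0r.
  by move=> w; rewrite patchE; case: ifPn => // _; rewrite normr0; lra.
have iR : P.-integrable setT (EFin \o (fun w => be w * X w + r w)).
  by apply: eq_integrable (integrableD _ ibX ir).
apply: (@le_trans _ _ (\int[P]_(w in A) (be w * X w + r w))).
  apply: ae_le_Rintegral => //; apply: filterS aeall => w [h1 h2 h3 h4] _.
  rewrite -subr_ge0 (_ : _ - _ = (X w - C1 w) * (D2 w - X w)); last by rewrite /be /r; ring.
  by apply: mulr_ge0; lra.
rewrite RintegralD ?bX0 ?add0r//; try exact: iS.
apply: ae_le_Rintegral => //; apply: filterS aeall => w [h1 h2 h3 h4] _.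
have /andP[? ?] := C1b w; have /andP[? ?] := D2b w.
rewrite /r /D1; case: (leP (D2 w) 0) => h.
  by rewrite (_ : D2 w = 0) ?mulr0 ?subrr ?mulr0//; lra.
by rewrite mulrC; apply: ler_wpM2l; lra.
Qed.

(** The condition says [V <= D * (2 * s - D)], and [V >= 0] then forces [D <= 2 * s]. The
    conditional mean vanishes almost surely, so [V] is a conditional second moment. Integrals are
    compared in [\bar R], so that integrability of [X ^ 2] comes out as a conclusion. *)
Lemma step_boundB (X D : T -> R) (V : T -> \bar R) (s : R) : 0 < s ->
  P.-integrable setT (EFin \o X) -> (forall A, G A -> \int[P]_(w in A) X w = 0) ->
  sub_measurable G D -> (forall w, 0 < D w) -> is_cond_var P G X V ->
  {ae P, forall w, X w <= D w /\
     ((2^-1)%:E * ((D w)%:E + V w / (D w)%:E) <= s%:E)%E} ->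
  step_bound X s.
Proof.
move=> s0 iX X0 GD D0 [Y [GY YX] [GV VX]] DV.
have mX : measurable_fun setT X by apply/measurable_EFinP; exact: measurable_int iX.
have mY : measurable_fun setT Y.
  by apply/measurable_EFinP; exact: sub_measurable_fun GY.
have mV : measurable_fun setT V by exact: sub_measurable_fun GV.
have Y0 A : G A -> (\int[P]_(w in A) (EFin \o Y) w = 0)%E.
  move=> GA; rewrite YX//; have mA := GT _ GA.
  have iA : P.-integrable A (EFin \o X) by apply: integrableS iX.
  by rewrite -(fineK (integrable_fin_num mA iA)) -/(Rintegral P A X) X0.
have aeY : {ae P, forall w, Y w = 0}.
  have h1 : {ae P, forall w, (0 <= (EFin \o Y) w)%E}.
    by apply: ae_ge0_sub GY _ => A GA; rewrite Y0.
  have h2 : {ae P, forall w, ((EFin \o Y) w <= 0)%E}.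
    by apply: ae_le0_sub GY _ => A GA; rewrite Y0.
  by apply: filterS2 h1 h2 => w; rewrite /= !lee_fin => p q; apply/eqP; rewrite eq_le p q.
have aeV : {ae P, forall w, (0 <= V w)%E}.
  apply: ae_ge0_sub GV _ => A GA; rewrite VX//; apply: integral_ge0 => w _.
  by rewrite lee_fin sqr_ge0.
pose D1 w := Num.min (D w) (2 * s).
have GD1 : sub_measurable G D1.
  by apply/(sub_measurableP sG)/measurable_minr => //; exact/(sub_measurableP sG).
have mD1 : measurable_fun setT D1 by exact: sub_measurable_fun GD1.
have D1b w : 0 < D1 w <= 2 * s.
  by rewrite /D1 lt_min D0 ge_min lexx orbT mulr_gt0.
have aeall : {ae P, forall w, X w <= D1 w /\
    (`|V w| <= (D1 w * (2 * s - D1 w))%:E)%E}.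
  apply: filterS2 DV aeV => w [h1 h2] h3; have Dw := D0 w.
  have DV' : (((D w)%:E)^-1 = ((D w)^-1)%:E)%E by rewrite inver gt_eqF.
  move: h2 h3; rewrite DV'; case: (V w) => [v| |]//.
    rewrite (_ : (_ * (_ + _) = (2^-1 * (D w + v / D w))%:E)%E)// !lee_fin => h2 v0.
    have v1 : v <= D w * (2 * s - D w).
      rewrite mulrC -ler_pdivrMr//; lra.
    have vD : 0 <= v / D w by rewrite divr_ge0// ltW.
    rewrite /D1 min_l; last by lra.
    by split => //; rewrite ger0_norm.
  (* An infinite [V] would make the left-hand side of the condition infinite. *)
  rewrite mulyr gtr0_sg ?invr_gt0// mul1e addey// mulry gtr0_sg ?invr_gt0// mul1e.
  by rewrite leye_eq.
have EX2 A : G A -> (\int[P]_(w in A) (X w ^+ 2)%:E <=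
    \int[P]_(w in A) (D1 w * (2 * s - D1 w))%:E)%E.
  move=> GA; have mA := GT _ GA.
  have -> : (\int[P]_(w in A) (X w ^+ 2)%:E = \int[P]_(w in A) `|V w|)%E.
    transitivity (\int[P]_(w in A) V w)%E.
      rewrite VX//; apply: ae_eq_integral => //.
      - by apply/measurable_EFinP/measurable_funTS/measurable_funX.
      - by apply/measurable_EFinP/measurable_funTS/measurable_funX/measurable_funB.
      - by apply: filterS aeY => w /= -> _; rewrite subr0.
    apply: ae_eq_integral => //.
    - exact: measurable_funTS.
    - by apply: measurableT_comp => //; exact: measurable_funTS.
    - by apply: filterS aeV => w /= h _; rewrite gee0_abs.
  apply: ae_ge0_le_integral => //.
  - by apply: measurableT_comp => //; exact: measurable_funTS.
  - move=> w _; have /andP[? ?] := D1b w.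
    by rewrite lee_fin; apply: mulr_ge0; lra.
  - by apply/measurable_EFinP/measurable_funTS/measurable_funM => //; exact: measurable_funB.
  - by apply: filterS aeall => w [].
have iDB := integrable_two_point_var _ _ mD1 D1b.
have iX2 : P.-integrable setT (EFin \o (fun w => X w ^+ 2)).
  apply/integrableP; split; first by apply/measurable_EFinP/measurable_funX.
  have -> : (\int[P]_w `|(EFin \o (fun w => (X w ^+ 2)%R)) w| = \int[P]_w (X w ^+ 2)%:E)%E.
    by apply: eq_integral => w _ /=; rewrite ger0_norm// sqr_ge0.
  have GTt : G setT by exact: sub_algebra_setT.
  apply: le_lt_trans (EX2 _ GTt) _.
  by rewrite -(fineK (integrable_fin_num measurableT iDB)) ltry.
exists D1; split => //; first by apply: filterS aeall => w [].
move=> A GA; have mA := GT _ GA.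
have iS (f : T -> R) : P.-integrable setT (EFin \o f) -> P.-integrable A (EFin \o f).
  by move=> iF; apply: integrableS iF.
rewrite /Rintegral fine_le ?EX2//.
- by apply: integrable_fin_num => //; exact: (iS (fun w => X w ^+ 2)).
- by apply: integrable_fin_num => //; exact: (iS (fun w => D1 w * (2 * s - D1 w))).
Qed.

End ae_sign.

(** * The martingale *)

Section martingale_bound.
Context d (T : measurableType d) (R : realType) (P : probability T R).
Context (H : nat -> set_system T) (S : nat -> T -> R) (sigma : nat -> R).
Hypotheses (filtH : filtration H) (martS : martingale P H S).
Hypothesis (S0 : {ae P, forall w, S 0%N w = 0}).
Hypothesis (sigma_gt0 : forall i, (0 < i)%N -> 0 < sigma i).
Hypothesis (hAB : condA P H S sigma \/ condB P H S sigma).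

Let sH i : sigma_algebra setT (H i). Proof. by have [] := filtH. Qed.
Let HT i : H i `<=` measurable. Proof. by have [_ + _] := filtH; exact. Qed.
Let HS i : sub_measurable (H i) (S i). Proof. by have [+ _ _] := martS; exact. Qed.
Let iS i : P.-integrable setT (EFin \o S i). Proof. by have [_ + _] := martS; exact. Qed.
Let mS i : measurable_fun setT (S i).
Proof. exact: sub_measurable_fun (HT i) _ _ _ (HS i). Qed.

Lemma integrable_increment i : P.-integrable setT (EFin \o increment S i.+1).
Proof. by apply: eq_integrable (integrableB _ (iS i.+1) (iS i)). Qed.

Lemma Rintegral_increment i A : H i A -> \int[P]_(w in A) increment S i.+1 w = 0.
Proof.
move=> HA; have mA := HT _ _ HA.
have iA j : P.-integrable A (EFin \o S j) by apply: integrableS (iS j).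
rewrite RintegralB//; apply/eqP; rewrite subr_eq0; apply/eqP.
have [_ _ /(_ i)[_ /(_ A HA) E]] := martS.
by rewrite /Rintegral; congr fine; rewrite -[LHS]E.
Qed.

Lemma step_bound_increment i :
  step_bound _ _ _ P (H i) (increment S i.+1) (sigma i.+1).
Proof.
have s0 := sigma_gt0 i.+1 isT.
have iX := integrable_increment i; have X0 := @Rintegral_increment i.
case: hAB => [/(_ i.+1 isT)[C [D [GC GD h]]]|/(_ i.+1 isT)[D [V [GD D0 GV h]]]].
- by apply: (step_boundA _ _ _ _ _ (sH i) (HT i) _ C D).
- by apply: (step_boundB _ _ _ _ _ (sH i) (HT i) _ D V).
Qed.

(** Each increment is at most twice its [sigma] almost surely. Under (B) nothing similar holds from
    below. *)
Lemma martingale_ae_bounded n : exists K, {ae P, forall w, S n w <= K}.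
Proof.
elim: n => [|n [K SK]]; first by exists 0; apply: filterS S0 => w ->.
have [D [_ Ds XD _ _]] := step_bound_increment n.
exists (K + 2 * sigma n.+1); apply: filterS2 SK XD => w h1.
by rewrite /increment/= => h2; have /andP[_ h3] := Ds w; lra.
Qed.

Let s n := Num.sqrt (\sum_(1 <= i < n.+1) sigma i ^+ 2).

Lemma sqrt_sum_recr n : s n.+1 = Num.sqrt (s n ^+ 2 + sigma n.+1 ^+ 2).
Proof.
rewrite /s big_nat_recr//= sqr_sqrtr// sumr_ge0// => i _; exact: sqr_ge0.
Qed.

Lemma normal_domination n t : (\int[P]_w (pos5 (S n w - t))%:E <= (gG (s n) t)%:E)%E.
Proof.
elim: n t => [|n IH] t.
  have -> : s 0 = 0 by rewrite /s big_geq// sqrtr0.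
  rewrite -gGE// gG0.
  have -> : (\int[P]_w (pos5 (S 0 w - t))%:E = \int[P]_w (pos5 (- t))%:E)%E.
    apply: ge0_ae_eq_integral => //.
    - apply/measurable_EFinP/(measurableT_comp (measurable_pos5 R)).
      exact: measurable_funB.
    - by move=> w _; rewrite lee_fin pos5_ge0.
    - by move=> w _; rewrite lee_fin pos5_ge0.
    - by apply: filterS S0 => w /= -> _; rewrite sub0r.
  have -> : (\int[P]__ (pos5 (- t))%:E = (pos5 (- t))%:E * P setT)%E.
    exact: (integral_cst P measurableT (pos5 (- t))%:E).
  by rewrite (@probability_setT _ _ _ P) mule1.
have s0 : 0 < sigma n.+1 by exact: sigma_gt0.
have [K SK] := martingale_ae_bounded n.
have := @step_bound_pos5_le _ _ _ P _ (sH n) (HT n) _ _ _ K t s0 (HS n) SK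
  (integrable_increment n) (@Rintegral_increment n) (step_bound_increment n).
have -> : (\int[P]_w (pos5 (S n w + increment S n.+1 w - t))%:E =
    \int[P]_w (pos5 (S n.+1 w - t))%:E)%E.
  by apply: eq_integral => w _; rewrite /increment/= subrKC.
move=> /le_trans; apply.
under eq_integral do rewrite -gGE ?ltW//.
pose f (p : T * R) := (pos5 (sigma n.+1 * p.2 - (t - S n p.1)) * gphi p.2)%:E.
have mg : measurable_fun [set: R] (@gphi R).
  by apply: measurable_continuous; exact: gphi_continuous.
have mf : measurable_fun setT f.
  apply/measurable_EFinP; apply: measurable_funM.
    apply: (measurableT_comp (measurable_pos5 R)); apply: measurable_funB.
      by apply: measurable_funM => //; exact: measurable_snd.
    by apply: measurable_funB => //; apply: (measurableT_comp (mS n)); exact: measurable_fst.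
  by apply: (measurableT_comp mg); exact: measurable_snd.
(* After the exchange of integrals the normal increment is frozen at [z], and the induction
   hypothesis is used at the shifted level [t - sigma z]; this is why the induction runs over all
   [t]. *)
have key (z : R) : (\int[P]_w (pos5 (sigma n.+1 * z - (t - S n w)) * gphi z)%:E <=
    (gG (s n) (t - sigma n.+1 * z) * gphi z)%:E)%E.
  have -> : (\int[P]_w (pos5 (sigma n.+1 * z - (t - S n w)) * gphi z)%:E =
      (\int[P]_w (pos5 (S n w - (t - sigma n.+1 * z)))%:E) * (gphi z)%:E)%E.
    rewrite -ge0_integralZr//.
    - apply: eq_integral => w _; rewrite -EFinM; congr (pos5 _ * _)%:E; ring.
    - apply/measurable_EFinP/(measurableT_comp (measurable_pos5 R)).
      exact: measurable_funB.
    - by move=> w _; rewrite lee_fin pos5_ge0.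
    - by rewrite lee_fin gphi_ge0.
  have p0 : (0 <= (gphi z)%:E)%E by rewrite lee_fin gphi_ge0.
  have := @lee_wpmul2r R (gphi z)%:E p0 _ _ (IH (t - sigma n.+1 * z)).
  by rewrite /= -EFinM.
rewrite (@fubini_tonelli _ _ _ _ R P lebesgue_measure f)//; last first.
  by move=> p; rewrite lee_fin mulr_ge0 ?pos5_ge0 ?gphi_ge0.
rewrite sqrt_sum_recr -gG_convolution; [|exact: sqrtr_ge0|exact: ltW].
apply: ge0_le_integral => //=.
- by move=> z _; apply: integral_ge0 => w _; rewrite lee_fin mulr_ge0 ?pos5_ge0 ?gphi_ge0.
- apply: (@measurable_fun_fubini_tonelli_G _ _ _ _ R P f) => //.
  by move=> p; rewrite lee_fin mulr_ge0 ?pos5_ge0 ?gphi_ge0.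
- apply/measurable_EFinP/measurable_funM => //; apply/measurable_EFinP.
  apply: measurable_gG; first exact: sqrtr_ge0.
  by apply: measurable_funM.
- by move=> z _; exact: key.
Qed.

(** The submartingale property from the tangent line at [S n]: its slope times the indicator of [A]
    is bounded and [H n]-measurable once [S n] is truncated from above, so its product with the
    increment has integral zero. *)
Lemma le_pos5_increment n t A : H n A ->
  (\int[P]_(w in A) (pos5 (S n w - t))%:E <= \int[P]_(w in A) (pos5 (S n.+1 w - t))%:E)%E.
Proof.
move=> HA; have mA := HT _ _ HA.
have [K SK] := martingale_ae_bounded n.
have [K' SK'] := martingale_ae_bounded n.+1.
pose S1 w := Num.min (S n w) K; pose S2 w := Num.min (S n.+1 w) K'.
have HS1 : sub_measurable (H n) S1.
  by apply/(sub_measurableP (sH n))/measurable_minr => //; exact/(sub_measurableP (sH n)).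
have mS1 : measurable_fun setT S1 by exact: measurable_minr.
have mS2 : measurable_fun setT S2 by exact: measurable_minr.
have eS1 : {ae P, forall w, S n w = S1 w} by apply: filterS SK => w h; rewrite /S1 min_l.
have eS2 : {ae P, forall w, S n.+1 w = S2 w} by apply: filterS SK' => w h; rewrite /S2 min_l.
have mp5 (f : T -> R) : measurable_fun setT f -> measurable_fun setT (fun w => pos5 (f w - t)).
  by move=> mf; apply: (measurableT_comp (measurable_pos5 R)); exact: measurable_funB.
have ip5 (f : T -> R) k : measurable_fun setT f -> (forall w, f w <= k) ->
    P.-integrable setT (EFin \o (fun w => pos5 (f w - t))).
  move=> mf fk; apply: (@integrable_bounded _ _ _ _ _ ((Num.max 0 (k - t)) ^+ 5)).
    exact: mp5.
  move=> w; rewrite ger0_norm ?pos5_ge0//; apply: max0X_le; first by rewrite le_max lexx.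
  by rewrite le_max; apply/orP; right; rewrite lerD2r.
have S1K w : S1 w <= K by rewrite /S1 ge_min lexx orbT.
have S2K w : S2 w <= K' by rewrite /S2 ge_min lexx orbT.
have i1 := ip5 S1 K mS1 S1K.
have i2 := ip5 S2 K' mS2 S2K.
have E (f g : T -> R) : measurable_fun setT f -> measurable_fun setT g ->
    {ae P, forall w, f w = g w} -> P.-integrable setT (EFin \o (fun w => pos5 (g w - t))) ->
    (\int[P]_(w in A) (pos5 (f w - t))%:E = (\int[P]_(w in A) pos5 (g w - t))%:E)%E.
  move=> mf mg fg ig; rewrite /Rintegral fineK; last first.
    by apply: integrable_fin_num => //; apply: integrableS ig.
  apply: ae_eq_integral => //.
  - by apply/measurable_EFinP/measurable_funTS; exact: mp5.
  - by apply/measurable_EFinP/measurable_funTS; exact: mp5.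
  - by apply: filterS fg => w /= -> _.
rewrite (E _ _ (mS n) mS1 eS1 i1) (E _ _ (mS n.+1) mS2 eS2 i2) lee_fin.
pose be : T -> R := (fun w => 5 * pos4 R (S1 w - t)) \_ A.
pose M : R := 5 * (Num.max 0 (K - t)) ^+ 4.
have M0 : 0 <= M by rewrite mulr_ge0// exprn_ge0// le_max lexx.
have beM w : `|be w| <= M.
  rewrite /be patchE; case: ifPn => _; last by rewrite normr0.
  rewrite ger0_norm; last by apply: mulr_ge0 => //; exact: pos4_ge0.
  apply: ler_wpM2l => //.
  apply: max0X_le; first by rewrite le_max lexx.
  by rewrite le_max; apply/orP; right; rewrite lerD2r.
have Hbe : sub_measurable (H n) be.
  apply/(sub_measurableP (sH n)); apply: (iffLR (measurable_restrictT _ _)).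
    by rewrite /measurable/= (sigma_algebra_id (sH n)).
  apply: measurable_funTS; apply: measurable_funM => //.
  apply: (measurableT_comp (measurable_pos4 R)); apply: measurable_funB => //.
  exact/(sub_measurableP (sH n)).
have iX := integrable_increment n.
have bX := @cond_eq0 _ _ _ P _ (sH n) (HT n) _ be M iX (@Rintegral_increment n) Hbe beM.
have ibX : P.-integrable setT (EFin \o (fun w => be w * increment S n.+1 w)).
  by apply: integrable_boundedM beM iX; exact: sub_measurable_fun (HT n) _ _ _ Hbe.
have iA (f : T -> R) : P.-integrable setT (EFin \o f) -> P.-integrable A (EFin \o f).
  by move=> iF; apply: integrableS iF.
have bXA : \int[P]_(w in A) (be w * increment S n.+1 w) = 0.
  rewrite -[RHS]bX Rintegral_mkcond; apply: eq_Rintegral => w _.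
  by rewrite patchE; case: ifPn => // wA; rewrite /be patchE (negbTE wA) mul0r.
rewrite -[leLHS]addr0 -bXA -RintegralD//; try exact: iA.
apply: ae_le_Rintegral => //.
  by apply: eq_integrable (integrableD _ i1 ibX).
apply: filterS2 eS1 eS2 => w h1 h2 Aw.
rewrite /be patchE mem_set//.
have -> : S2 w - t = S1 w - t + increment S n.+1 w by rewrite -h1 -h2 /increment/=; ring.
exact: pos5_tangent.
Qed.

Lemma running_max_geP n x w :
  (x <= running_max S n w) <-> exists2 k, (k <= n)%N & x <= S k w.
Proof.
rewrite /running_max big_mkord; split.
  case/bigmax_geP => [h|[k _ h]]; first by exists 0%N.
  by exists k => //; rewrite -ltnS.
move=> [k kn h]; apply/bigmax_geP; right.
by exists (Ordinal (kn : (k < n.+1)%N)).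
Qed.

Lemma running_max_set0 x : [set w | x <= running_max S 0 w] = [set w | x <= S 0%N w].
Proof.
apply/seteqP; split => w /=; rewrite running_max_geP.
  by move=> [k]; rewrite leqn0 => /eqP ->.
by exists 0%N.
Qed.

Lemma running_max_setS n x : [set w | x <= running_max S n.+1 w] =
  [set w | x <= running_max S n w] `|` [set w | x <= S n.+1 w].
Proof.
apply/seteqP; split => w /=; rewrite !running_max_geP.
  move=> [k]; rewrite leq_eqVlt => /predU1P[->|kn] h; first by right.
  by left; exists k.
by move=> [[k kn h]|h]; [exists k => //; exact: leqW|exists n.+1].
Qed.

Lemma H_super_level n x : H n [set w | x <= S n w].
Proof.
have -> : [set w | x <= S n w] = S n @^-1` `[x, +oo[%classic.
  by apply/seteqP; split => w /=; rewrite in_itv/= andbT.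
exact: sub_measurable_preimage (HS n).
Qed.

Lemma H_running_max n x : H n [set w | x <= running_max S n w].
Proof.
elim: n => [|n IH]; first by rewrite running_max_set0; exact: H_super_level.
rewrite running_max_setS -(sigma_algebra_id (sH n.+1)).
have HE : <<s H n.+1 >> = H n.+1 by exact: sigma_algebra_id.
have h1 : (@measurable _ (g_sigma_algebraType (H n.+1))) [set w | x <= running_max S n w].
  by rewrite /measurable/= HE; have [_ _ /(_ n n.+1 (leqnSn n))] := filtH; exact.
have h2 : (@measurable _ (g_sigma_algebraType (H n.+1))) [set w | x <= S n.+1 w].
  by rewrite /measurable/= HE; exact: H_super_level.
exact: (measurableU _ _ h1 h2).
Qed.

(** At each step the event gains only paths that first reach [x] at time [n + 1], where Markov's
    inequality applies; on the old event the submartingale property moves the bound forward in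
    time. *)
Lemma doob_pos5 n t x : t < x ->
  ((pos5 (x - t))%:E * P [set w | (x <= running_max S n w)%R] <=
   \int[P]_(w in [set w | (x <= running_max S n w)%R]) (pos5 (S n w - t))%:E)%E.
Proof.
move=> tx.
have mp5 k : measurable_fun setT (fun w => (pos5 (S k w - t))%:E).
  apply/measurable_EFinP/(measurableT_comp (measurable_pos5 R)).
  exact: measurable_funB.
have markov k A : measurable A -> A `<=` [set w | x <= S k w] ->
    ((pos5 (x - t))%:E * P A <= \int[P]_(w in A) (pos5 (S k w - t))%:E)%E.
  move=> mA AS; rewrite -integral_cst//; apply: ge0_le_integral => //=.
  - by move=> w _; rewrite lee_fin pos5_ge0.
  - by apply: measurable_funTS.
  - by move=> w Aw; rewrite lee_fin; apply: pos5_mono; rewrite lerD2r; exact: AS.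
elim: n => [|n IH].
  rewrite running_max_set0; apply: markov => //; exact/HT/H_super_level.
rewrite running_max_setS.
set E := [set w | x <= running_max S n w]; set B := [set w | x <= S n.+1 w].
have mE : measurable E by exact: HT (H_running_max n x).
have mB : measurable B by exact: HT (H_super_level n.+1 x).
have mBE : measurable (B `\` E) by exact: measurableD.
have dEB : [disjoint E & B `\` E] by apply/disj_setPS => w [? [_]].
have -> : E `|` B = E `|` (B `\` E).
  apply/seteqP; split => w /=; last by move=> [h|[h _]]; [left|right].
  by move=> [h|h]; [left|have [h'|h'] := pselect (E w); [left|right]].
rewrite measureU//; last by apply/seteqP; split => w // [? [_]].
rewrite ge0_integral_setU//=; last 2 first.
- by apply: measurable_funTS.
- by move=> w _; rewrite lee_fin pos5_ge0.
rewrite ge0_muleDr//; apply: leeD; last by apply: markov => // w [].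
apply: le_trans IH _; apply: le_pos5_increment; exact: H_running_max.
Qed.

Lemma maximal_bound n t x : t < x ->
  (P [set w | (x <= running_max S n w)%R] <=
   (gG (s n) t)%:E / ((x - t) ^+ 5)%:E)%E.
Proof.
move=> tx; have xt0 : 0 < (x - t) ^+ 5 by rewrite exprn_gt0// subr_gt0.
rewrite inver gt_eqF// lee_pdivlMr//.
have := doob_pos5 n _ _ tx; rewrite pos5_id; last by rewrite subr_ge0 ltW.
rewrite muleC => /le_trans; apply.
apply: le_trans (normal_domination n t).
apply: ge0_subset_integral => //.
- exact: HT (H_running_max n x).
- apply/measurable_EFinP/(measurableT_comp (measurable_pos5 R)).
  exact: measurable_funB.
- by move=> w _; rewrite lee_fin pos5_ge0.
Qed.

End martingale_bound.

(** * Comparison of the bounds *)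

Lemma mule_invEFin (R : realType) (y : \bar R) (r : R) : 0 < r ->
  (y / r%:E = y * (r^-1)%:E)%E.
Proof. by move=> r0; rewrite inver gt_eqF. Qed.

Lemma expR1_ge_5_2 (R : realType) : 5 / 2 <= expR 1 :> R.
Proof.
have h : 9 / 8 <= expR (8^-1) :> R.
  by apply: le_trans (expR_ge1Dx _); rewrite le_eqVlt; apply/orP; left; apply/eqP; field.
have -> : 1 = 8%:R * 8^-1 :> R by rewrite divff.
rewrite expRM_natl; apply: (@le_trans _ _ ((9 / 8 : R) ^+ 8)); first by lra.
by apply: lerXn2r; rewrite ?nnegrE ?expR_ge0//; lra.
Qed.

(** Amounts to [24 e^4 >= 5^4]. It serves the scale [s = 0] with [x < 0], where the tail probability
    is 1 and the exponential bound at [h = - 1 / x] equals [e]. *)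
Lemma expR1_le_c50 (R : realType) : expR 1 <= c50 R.
Proof.
have e0 := expR1_ge_5_2 R.
rewrite /c50 (_ : 5`! = 120%N)//.
have e4 : (5 / 2 : R) ^+ 4 <= expR 1 ^+ 4.
  by apply: lerXn2r; rewrite ?nnegrE ?expR_ge0//; lra.
have -> : 120%:R * (expR 1 / 5) ^+ 5 = expR 1 * (24 / 5 ^+ 4 * expR 1 ^+ 4) :> R by field.
rewrite ler_peMr ?expR_ge0//; lra.
Qed.

Section normal_variable.
Context (R : realType) (d' : measure_display) (U : measurableType d')
  (Q : probability U R) (Z : {RV Q >-> R}).
Hypothesis hZ : forall A : set R, measurable A ->
  distribution Q Z A = normal_prob (0 : R) 1 A.
Local Notation mu := (@lebesgue_measure R).

Lemma expectation_normal (g : R -> R) : measurable_fun [set: R] g ->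
  (forall z, 0 <= g z) ->
  ('E_Q[fun u => g (Z u)] = \int[mu]_z (g z * gphi z)%:E)%E.
Proof.
move=> mg g0; rewrite unlock.
have mE : measurable_fun [set: R] (EFin \o g) by apply/measurable_EFinP.
have gE0 z : (0 <= (EFin \o g) z)%E by rewrite lee_fin.
pose Y : U -> measurableTypeR R := Z.
have mY : measurable_fun [set: U] Y by exact: (measurable_funP Z).
pose mY_mixin := isMeasurableFun.Build _ _ _ _ Y mY.
pose Yf : {mfun U >-> measurableTypeR R} := HB.pack Y mY_mixin.
have := @ge0_integral_pushforward _ _ U (measurableTypeR R) R Y mY Q setT (EFin \o g) measurableT mE (fun z _ => gE0 z).
rewrite preimage_setT /comp/= => <-.
rewrite (@eq_measure_integral _ _ _ setT (normal_prob (0:R) 1) (pushforward Q Yf) (EFin \o g)); last first.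
  by move=> A mA _; exact: hZ.
rewrite (integral_density _ gE0 mE).
by apply: eq_integral => z _; rewrite /= EFinM.
Qed.

Lemma prob_normal (A : set R) : measurable A ->
  Q [set u | A (Z u)] = (\int[mu]_(z in A) (gphi z)%:E)%E.
Proof. by move=> mA; rewrite -gphiE -[RHS]hZ. Qed.

Section fixed_scale.
Context (s x : R).
Hypothesis s_ge0 : 0 <= s.

Lemma expectation_pos5 (t : R) : ('E_Q[fun u => pos5 (s * Z u - t)] = (gG s t)%:E)%E.
Proof.
rewrite (@expectation_normal (fun z => pos5 (s * z - t))) ?gGE//.
  apply: measurable_continuous => z.
  have := @continuous_comp_affine R (@pos5 R) s (- t) (@pos5_continuous R) z; exact.
by move=> z; exact: pos5_ge0.
Qed.

Lemma expectation_exp (h : R) :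
  ('E_Q[fun u => expR (h * s * Z u)] = (expR ((h * s) ^+ 2 / 2))%:E)%E.
Proof.
rewrite (@expectation_normal (fun z => expR (h * s * z))) ?mgf_gphi//.
by apply: measurableT_comp => //; exact: measurable_funM.
Qed.

Let B1 := ereal_inf
  [set ('E_Q[fun u => f (s * Z u)%R] / (f x)%:E)%E
    | f in @F5plus R `&` [set f | 0 < f x]].
Let B2 := ereal_inf
  [set ('E_Q[fun u => pos5 (s * Z u - t)%R] / ((x - t) ^+ 5)%:E)%E
    | t in [set t : R | t < x]].

Lemma pos5_inf_le (t : R) : t < x -> (B2 <= ((gG s t) / (x - t) ^+ 5)%:E)%E.
Proof.
move=> tx; apply: ereal_inf_lbound; exists t => //.
by rewrite expectation_pos5 mule_invEFin ?exprn_gt0 ?subr_gt0.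
Qed.

Lemma pos5_inf_ge0 : (0 <= B2)%E.
Proof.
apply: le_ereal_inf_tmp => _ [t tx <-].
have xt : 0 < (x - t) ^+ 5 by rewrite exprn_gt0 ?subr_gt0.
by rewrite expectation_pos5 mule_invEFin// -EFinM lee_fin divr_ge0 ?gG_ge0// ltW.
Qed.

Lemma F5plus_pos5 (t : R) : @F5plus R (fun y => pos5 (y - t)).
Proof.
exists (@dirac _ (measurableTypeR R) t R) => y.
rewrite integral_dirac//= ?diracT ?mul1e//.
apply: (@measurable_EFin_continuous R (fun u => pos5 (y - u))) => u.
apply: (@continuous_comp _ _ _ (fun u => y - u)); last exact: pos5_continuous.
by apply: cvgB; [exact: cvg_cst|exact: cvg_id].
Qed.

Lemma F5plus_inf_le_pos5_inf : (B1 <= B2)%E.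
Proof.
apply: le_ereal_inf_tmp => _ [t tx <-].
apply: ereal_inf_lbound; exists (fun y => pos5 (y - t)).
  split; first exact: F5plus_pos5.
  by rewrite /= pos5_id ?exprn_gt0 ?subr_gt0// subr_ge0 ltW.
by rewrite pos5_id// subr_ge0 ltW.
Qed.

(** If [r] is the infimum over [t], then [r * pos5 (x - t) <= gG s t] for every [t], trivially so
    when [t >= x]. Integrating against the mixing measure gives [r * f x] on the left and E f(sZ) on
    the right; the exchange needs a sigma-finite measure, which finiteness of [f] provides. *)
Lemma pos5_inf_le_F5plus_inf : (B2 <= B1)%E.
Proof.
apply: le_ereal_inf_tmp => _ [f [[m fE] /= fx0] <-].
have mpos5 : measurable_fun [set: R] (@pos5 R) by exact: measurable_pos5.
have mposB (y : R) : measurable_fun [set: measurableTypeR R] (fun t => (pos5 (y - t))%:E).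
  apply/measurable_EFinP/(measurableT_comp mpos5); exact: measurable_funB.
(* [m `]-oo, k] <= f (k + 1)], since [pos5 (k + 1 - t) >= 1] for [t <= k]. *)
have sfm : sigma_finite setT m.
  exists (fun k => `]-oo, k%:R]%classic).
    apply/esym/seteqP; split => // y _.
    exists (Num.truncn `|y|).+1 => //=; rewrite in_itv/=.
    by apply: le_trans (ler_norm y) _; apply: ltW; exact: truncnS_gt.
  move=> k; split; first exact: measurable_itv.
  apply: (@le_lt_trans _ _ (f (k%:R + 1))%:E); last exact: ltry.
  have mk : measurable (`]-oo, k%:R]%classic : set (measurableTypeR R)) by exact: measurable_itv.
  rewrite fE -[leLHS]mul1e -(integral_cst m mk 1).
  apply: (@le_trans _ _ (\int[m]_(t in `]-oo, k%:R]) (pos5 (k%:R + 1 - t))%:E)%E).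
    apply: ge0_le_integral => //=.
    - by apply: measurable_funTS; exact: mposB.
    - move=> t; rewrite in_itv/= => tk; rewrite lee_fin.
      rewrite pos5_id; last lra.
      by apply: exprn_ege1; lra.
  apply: ge0_subset_integral => //.
  by move=> t _; rewrite lee_fin pos5_ge0.
pose msf : {sigma_finite_measure set (measurableTypeR R) -> \bar R} :=
  HB.pack (Measure.sort m) (isSFinite.Build _ _ _ (Measure.sort m) (sfinite_measure_sigma_finite sfm)) (isSigmaFinite.Build _ _ _ (Measure.sort m) sfm).
have mmsf : m = msf :> (set _ -> \bar R) by [].
have Efm (g : R -> \bar R) : (\int[m]_y g y = \int[msf]_y g y)%E by [].
have mp2 : measurable_fun [set: measurableTypeR R * measurableTypeR R]
    (fun p => (pos5 (s * p.1 - p.2) * gphi p.1)%:E).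
  apply/measurable_EFinP; apply: measurable_funM.
    apply: (measurableT_comp mpos5); apply: measurable_funB.
      by apply: measurable_funM => //; exact: measurable_fst.
    exact: measurable_snd.
  have mg : measurable_fun [set: R] (@gphi R).
    by apply: measurable_continuous; exact: gphi_continuous.
  by apply: (measurableT_comp mg); exact: measurable_fst.
have f0 y : 0 <= f y.
  by rewrite -lee_fin fE; apply: integral_ge0 => t _; rewrite lee_fin pos5_ge0.
have mf : measurable_fun [set: R] f.
  apply/measurable_EFinP.
  pose k (p : measurableTypeR R * measurableTypeR R) := (pos5 (p.1 - p.2))%:E.
  have mk : measurable_fun setT k.
    apply/measurable_EFinP/(measurableT_comp mpos5); apply: measurable_funB.
      exact: measurable_fst.
    exact: measurable_snd.
  have k0 p : (0 <= k p)%E by rewrite lee_fin pos5_ge0.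
  have := @measurable_fun_fubini_tonelli_F _ _ _ _ R msf k mk k0.
  apply: eq_measurable_fun => y _ /=; rewrite fE Efm; reflexivity.
have B2fin : B2 \is a fin_num.
  rewrite ge0_fin_numE ?pos5_inf_ge0//; apply: le_lt_trans (pos5_inf_le (x - 1) _) (ltry _).
  by rewrite ltrBlDr ltrDl.
have rE := fineK B2fin; set r := fine B2 in rE.
have r0 : 0 <= r by rewrite -lee_fin rE pos5_inf_ge0.
have rle t : r * pos5 (x - t) <= gG s t.
  have [tx|tx] := ltP t x; last by rewrite pos5_eq0 ?subr_le0// mulr0 gG_ge0.
  have := pos5_inf_le _ tx; rewrite -rE lee_fin ler_pdivlMr ?exprn_gt0 ?subr_gt0//.
  by rewrite pos5_id// subr_ge0 ltW.
rewrite -rE mule_invEFin// lee_pdivlMr// -EFinM.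
have -> : ('E_Q[fun u => f (s * Z u)%R] = \int[m]_t (gG s t)%:E)%E.
  rewrite (@expectation_normal (fun z => f (s * z)))//; last first.
    by apply: (measurableT_comp mf); exact: measurable_funM.
  transitivity (\int[mu]_z \int[msf]_t (pos5 (s * z - t) * gphi z)%:E)%E.
    apply: eq_integral => z _; rewrite EFinM fE -ge0_integralZr//; last 2 first.
    - by move=> t _; rewrite lee_fin pos5_ge0.
    - by rewrite lee_fin gphi_ge0.
  rewrite (@fubini_tonelli _ _ _ _ R mu msf (fun p => (pos5 (s * p.1 - p.2) * gphi p.1)%:E))//=; last first.
    by move=> p; rewrite lee_fin mulr_ge0 ?pos5_ge0 ?gphi_ge0.
  by rewrite -Efm; apply: eq_integral => t _; rewrite gGE.
rewrite EFinM fE -ge0_integralZl//; last by move=> t _; rewrite lee_fin pos5_ge0.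
apply: ge0_le_integral => //=.
- by move=> t _; rewrite -EFinM lee_fin mulr_ge0 ?pos5_ge0.
- by apply: emeasurable_funM => //.
- have := @measurable_gG _ (measurableTypeR R) R -%R s 0 s_ge0.
  under eq_fun do rewrite sub0r opprK; apply.
  by apply: measurable_funN; exact: measurable_id.
- by move=> t _; rewrite -EFinM lee_fin.
Qed.

Lemma F5plus_inf_eq_pos5_inf : B1 = B2.
Proof. by apply/eqP; rewrite eq_le F5plus_inf_le_pos5_inf pos5_inf_le_F5plus_inf. Qed.

Lemma pos5_inf_le_exp (h : R) : 0 < h ->
  (B2 <= (expR (- h * x))%:E * 'E_Q[fun u => expR (h * s * Z u)%R])%E.
Proof.
move=> h0; rewrite expectation_exp.
(* For this [t], [pos5 (y - t) <= (x - t)^5 * expR (h * (y - x))] holds for every [y],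
   with contact at [y = x]. *)
pose t := x - 5 / h.
have xt : x - t = 5 / h by rewrite /t; ring.
have xt0 : 0 < x - t by rewrite xt divr_gt0.
have tx : t < x by rewrite -subr_gt0.
apply: le_trans (pos5_inf_le _ tx) _; rewrite -EFinM lee_fin.
rewrite ler_pdivrMr ?exprn_gt0// -lee_fin -gGE//.
pose c := expR (- h * x) * (x - t) ^+ 5.
have ce : continuous (fun z : R => expR (h * s * z) * gphi z).
  apply: continuous_Mgphi => z.
  apply: continuous_comp; last exact: continuous_expR.
  by apply: cvgM; [exact: cvg_cst|exact: cvg_id].
have c0 : 0 <= c by rewrite mulr_ge0 ?expR_ge0 ?exprn_ge0// ltW.
have key (z : R) : pos5 (s * z - t) * gphi z <= c * (expR (h * s * z) * gphi z).
  rewrite mulrA; apply: ler_wpM2r; first exact: gphi_ge0.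
  have [y0|y0] := leP (s * z - t) 0.
    by rewrite pos5_eq0// mulr_ge0 ?expR_ge0.
  rewrite pos5_id; last exact: ltW.
  have e1 : h / 5 * (s * z - t) <= expR (h / 5 * (s * z - x)).
    apply: le_trans (expR_ge1Dx _); rewrite le_eqVlt; apply/orP; left; apply/eqP.
    by rewrite /t; field; rewrite gt_eqF.
  have -> : c * expR (h * s * z) = ((x - t) * expR (h / 5 * (s * z - x))) ^+ 5.
    rewrite exprMn -expRM_natl /c mulrAC mulrC; congr (_ * _).
    by rewrite -expRD; congr expR; field.
  apply: lerXn2r; rewrite ?nnegrE; first exact: ltW.
    by rewrite mulr_ge0 ?expR_ge0// ltW.
  have -> : s * z - t = (x - t) * (h / 5 * (s * z - t)).
    by rewrite xt; field; rewrite gt_eqF.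
  by apply: ler_wpM2l => //; exact: ltW.
apply: (@le_trans _ _ (\int[mu]_z (c%:E * (expR (h * s * z) * gphi z)%:E))%E); last first.
  rewrite ge0_integralZl//=.
  - by rewrite mgf_gphi -EFinM lee_fin /c; lra.
  - exact: (measurable_EFin_continuous _ _ setT ce).
  - by move=> z _; rewrite lee_fin mulr_ge0 ?expR_ge0 ?gphi_ge0.
apply: ge0_le_integral => //=.
- by move=> z _; rewrite lee_fin mulr_ge0 ?pos5_ge0 ?gphi_ge0.
- apply: measurable_EFin_continuous; apply: continuous_Mgphi => z.
  have := @continuous_comp_affine R (@pos5 R) s (- t) (@pos5_continuous R) z; exact.
- apply: measurable_EFin_continuous => z; apply: cvgM; first exact: cvg_cst.
  exact: ce.
- by move=> z _; rewrite -EFinM lee_fin; exact: key.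
Qed.

Lemma pos5_inf_le_tail : (B2 <= (c50 R)%:E * Q [set u | (x <= s * Z u)%R])%E.
Proof.
have c1 := expR1_ge_5_2 R; have c2 := expR1_le_c50 R.
have [s0|s0] := ltP 0 s.
  have [t0 t0x /= tle] := gF_le_tail (x / s).
  have -> : [set u | x <= s * Z u] = [set u | `[x / s, +oo[%classic (Z u)].
    by apply/seteqP; split => u /=; rewrite in_itv/= andbT ler_pdivrMr// mulrC.
  rewrite prob_normal//.
  have tx : s * t0 < x by rewrite mulrC -ltr_pdivlMr.
  apply: le_trans (pos5_inf_le _ tx) _.
  have xt0 : 0 < (x - s * t0) ^+ 5 by rewrite exprn_gt0 ?subr_gt0.
  have q0 : (0 <= \int[mu]_(z in `[(x / s)%R, +oo[) (gphi z)%:E)%E.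
    by apply: integral_ge0 => z _; rewrite lee_fin gphi_ge0.
  rewrite EFinM lee_pdivrMr//.
  rewrite gGE_pos// (mulrC s) mulfK ?gt_eqF//.
  apply: (@le_trans _ _ ((s ^+ 5)%:E * (gF t0)%:E)%E); first by rewrite EFinM.
  apply: (@le_trans _ _ ((s ^+ 5)%:E * ((c50 R * (x / s - t0) ^+ 5)%:E *
     \int[mu]_(z in `[(x / s)%R, +oo[) (gphi z)%:E))%E).
    by apply: lee_wpmul2l => //; rewrite lee_fin exprn_ge0.
  rewrite muleA -EFinM [leRHS]muleAC -EFinM.
  have -> : s ^+ 5 * (c50 R * (x / s - t0) ^+ 5) = c50 R * (x - t0 * s) ^+ 5.
    rewrite mulrCA -exprMn; congr (_ * _ ^+ 5); field; by rewrite gt_eqF.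
  exact: lexx.
(* Here [s * Z] is the constant 0 and the tail probability is 0 or 1. For [x > 0] the choice [t = 0]
   already gives the bound 0. *)
have {}s0 : s = 0 by apply/eqP; rewrite eq_le s0.
have [x0|x0] := ltP 0 x.
  apply: (@le_trans _ _ 0%E); last by rewrite mule_ge0// lee_fin; lra.
  apply: le_trans (pos5_inf_le _ x0) _; rewrite lee_fin.
  have : (gG s 0)%:E = 0%E by rewrite s0 -gGE// gG0 oppr0 pos5_eq0.
  by move=> [->]; rewrite mul0r.
have -> : [set u | x <= s * Z u] = setT.
  by apply/seteqP; split => // u _ /=; rewrite s0 mul0r.
rewrite probability_setT mule1.
apply: (@le_trans _ _ (expR 1)%:E); last by rewrite lee_fin.
have [x00|xn0] := eqVneq x 0.
  apply: le_trans (pos5_inf_le_exp _ ltr01) _.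
  rewrite expectation_exp -EFinM lee_fin -expRD ler_expR x00 s0.
  by rewrite mulr0 mulr0 expr0n/= mul0r addr0.
have {}x0 : x < 0 by rewrite lt_neqAle xn0.
have h0 : 0 < - x^-1 by rewrite oppr_gt0 invr_lt0.
apply: le_trans (pos5_inf_le_exp _ h0) _.
rewrite expectation_exp -EFinM lee_fin -expRD ler_expR s0.
by rewrite mulr0 expr0n/= mul0r addr0 opprK mulVf.
Qed.

End fixed_scale.
End normal_variable.

(** * Closed forms, including the degenerate scale *)

Section closed_form.
Context (R : realType) (d' : measure_display) (U : measurableType d')
  (Q : probability U R) (Z : {RV Q >-> R}).
Hypothesis hZ : forall A : set R, measurable A ->
  distribution Q Z A = normal_prob (0 : R) 1 A.
Context (s x : R).
Hypotheses (s_ge0 : 0 <= s) (x_ge0 : 0 <= x).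
Let chernoff := ereal_inf
  [set ((expR (- h * x))%:E * 'E_Q[fun u => expR (h * s * Z u)%R])%E
    | h in [set h : R | 0 < h]].

(** The exponent [- h x + (h s)^2 / 2] exceeds [- x^2 / (2 s^2)] by [(h s - x / s)^2 / 2], which
    vanishes at [h = x / s^2]. *)
Lemma chernoff_gt0 : 0 < s -> chernoff = (expR (- (x ^+ 2 / (2 * s ^+ 2))))%:E.
Proof.
move=> s0; have sn0 : s != 0 by rewrite gt_eqF.
apply/eqP; rewrite eq_le; apply/andP; split; last first.
  apply: le_ereal_inf_tmp => _ [h h0 <-].
  rewrite expectation_exp// -EFinM lee_fin -expRD ler_expR.
  have := sqr_ge0 (h * s - x / s).
  have -> : (h * s - x / s) ^+ 2 =
    2 * ((- h * x + (h * s) ^+ 2 / 2) - (- (x ^+ 2 / (2 * s ^+ 2)))) by field.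
  by rewrite pmulr_rge0// subr_ge0.
(* At [x = 0] the minimizer [h = 0] is excluded and the infimum 1 is not attained; the witness below
   is the [h] at which the expectation equals [1 + e]. *)
have [xn0|xn0] := eqVneq x 0.
  rewrite xn0 expr0n/= mul0r oppr0 expR0; apply/lee_addgt0Pr => e e0.
  have l0 : 0 < ln (1 + e) by rewrite ln_gt0// ltrDl.
  apply: ereal_inf_lbound; exists (Num.sqrt (2 * ln (1 + e)) / s).
    by rewrite /= divr_gt0// sqrtr_gt0 mulr_gt0.
  rewrite expectation_exp// xn0 mulr0 expR0 mul1e divfK// sqr_sqrtr; last first.
    by rewrite mulr_ge0// ltW.
  by rewrite mulrC mulKf// lnK// posrE; lra.
apply: ereal_inf_lbound; exists (x / s ^+ 2).
  by rewrite /= divr_gt0 ?exprn_gt0// lt0r xn0.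
rewrite expectation_exp// -EFinM -expRD; congr (expR _)%:E; by field.
Qed.

Lemma chernoff_ge0 : (0 <= chernoff)%E.
Proof.
apply: le_ereal_inf_tmp => _ [h h0 <-].
by rewrite expectation_exp// -EFinM lee_fin mulr_ge0 ?expR_ge0.
Qed.

Lemma chernoff0 : s = 0 -> x = 0 -> chernoff = 1%E.
Proof.
move=> s0 x0; have E h : ((expR (- h * x))%:E * 'E_Q[fun u => expR (h * s * Z u)%R] = 1)%E.
  by rewrite expectation_exp// s0 x0 !mulr0 expR0 expr0n/= mul0r expR0 mul1e.
rewrite /chernoff; have -> : [set ((expR (- h * x))%:E * 'E_Q[fun u => expR (h * s * Z u)%R])%E
    | h in [set h : R | 0 < h]] = [set 1%E].
  apply/seteqP; split => [_ [h _ <-]|_ ->]; first by rewrite E.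
  by exists 1; [exact: ltr01|rewrite E].
by rewrite ereal_inf1.
Qed.

Lemma scaled_tailE : 0 < s -> Q [set u | x <= s * Z u] = normal_tail (x%:E / s%:E)%E.
Proof.
move=> s0; rewrite mule_invEFin// -EFinM /normal_tail.
have E : [set z | ((x / s)%:E <= z%:E)%E] = `[x / s, +oo[%classic.
  by apply/seteqP; split => z /=; rewrite lee_fin in_itv/= andbT.
rewrite E -hZ; last exact: measurable_itv.
rewrite /distribution/pushforward; congr (Q _).
by apply/seteqP; split => u /=; rewrite in_itv/= andbT ler_pdivrMr// mulrC.
Qed.

Lemma normal_tail_pinfty : normal_tail +oo%E = 0%E :> \bar R.
Proof.
rewrite /normal_tail (_ : [set z | (+oo <= z%:E)%E] = set0) ?measure0//.
by apply/seteqP; split => // z /=; rewrite leye_eq.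
Qed.

Lemma normal_tail0 : normal_tail 0 = (2^-1)%:E :> \bar R.
Proof.
rewrite /normal_tail (_ : [set z | (0 <= z%:E)%E] = `[0, +oo[%classic); last first.
  by apply/seteqP; split => z /=; rewrite lee_fin in_itv/= andbT.
by rewrite -half_moment0 -gphiE.
Qed.

Lemma tail_chernoff_closed_form :
  Order.min ((c50 R)%:E * Q [set u | (x <= s * Z u)%R])%E chernoff =
  Order.min ((c50 R)%:E * normal_tail (x%:E / s%:E))%E
    (expeR (- ((x ^+ 2)%:E / (2 * s ^+ 2)%:E)))%E.
Proof.
have c1 := expR1_ge_5_2 R; have c2 := expR1_le_c50 R.
have [s0|s0] := ltP 0 s.
  rewrite scaled_tailE// chernoff_gt0//; congr Order.min.
  by rewrite mule_invEFin// mulr_gt0 ?exprn_gt0.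
have {}s0 : s = 0 by apply/eqP; rewrite eq_le s0.
(* At [s = x = 0] both minima are 1: the quotient [0 / 0 = 0] turns the tail into 1/2, but [c50 / 2]
   is still at least 1. *)
have [x0|x0] := eqVneq x 0.
  rewrite chernoff0// s0 x0 expr0n/= !mul0e oppe0 expeR0 normal_tail0.
  have -> : [set u | 0 <= 0 * Z u] = setT.
    by apply/seteqP; split => // u _ /=; rewrite mul0r.
  rewrite probability_setT mule1 -EFinM !min_r// lee_fin; lra.
have {}x0 : 0 < x by rewrite lt0r x0.
have -> : [set u | x <= s * Z u] = set0.
  by apply/seteqP; split => // u /=; rewrite s0 mul0r leNgt x0.
(* For [s = 0 < x] both minima are 0; on the right the two quotients are [+oo]. *)
rewrite measure0 mule0 min_l; last exact: chernoff_ge0.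
rewrite s0 expr0n/= mulr0 inver eqxx !gt0_muley ?lte_fin ?exprn_gt0//.
by rewrite normal_tail_pinfty mule0 min_l.
Qed.

End closed_form.

(* For n = 0 one has s = 0: the quotients in the last expression are taken in
   \bar R, where r / 0 = +oo for r > 0, 0 / 0 = 0 and expeR -oo = 0.
   The last equality is false for x < 0, where its left-hand side is 1 and its
   right-hand side is smaller than 1. *)
Theorem theorem3p1 (R : realType)
  (d : measure_display) (T : measurableType d) (P : probability T R)
  (H : nat -> set_system T) (S : nat -> T -> R) (sigma : nat -> R)
  (d' : measure_display) (U : measurableType d') (Q : probability U R)
  (Z : {RV Q >-> R})
  (filtH : filtration H)
  (martS : martingale P H S)
  (S0 : {ae P, forall w, S 0%N w = 0})
  (sigma_gt0 : forall i, (0 < i)%N -> 0 < sigma i)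
  (hAB : condA P H S sigma \/ condB P H S sigma)
  (hZ : forall A : set R, measurable A ->
      distribution Q Z A = normal_prob (0 : R) 1 A)
  (n : nat) (x : R) :
  let s := Num.sqrt (\sum_(1 <= i < n.+1) sigma i ^+ 2) in
  let B1 := ereal_inf
    [set ('E_Q[fun u => f (s * Z u)%R] / (f x)%:E)%E
      | f in @F5plus R `&` [set f | 0 < f x]] in
  let B2 := ereal_inf
    [set ('E_Q[fun u => pos5 (s * Z u - t)%R] / ((x - t) ^+ 5)%:E)%E
      | t in [set t : R | t < x]] in
  let B3 := Order.min
    ((c50 R)%:E * Q [set u | (x <= s * Z u)%R])%E
    (ereal_inf
      [set ((expR (- h * x))%:E * 'E_Q[fun u => expR (h * s * Z u)%R])%E
        | h in [set h : R | 0 < h]]) in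
  let B4 := Order.min
    ((c50 R)%:E * normal_tail (x%:E / s%:E))%E
    (expeR (- ((x ^+ 2)%:E / (2 * s ^+ 2)%:E)))%E in
  [/\ (P [set w | (x <= running_max S n w)%R] <= B1)%E,
      B1 = B2,
      (B2 <= B3)%E
    & 0 <= x -> B3 = B4].

Proof.
move=> s B1 B2 B3 B4; have s0 : 0 <= s by exact: sqrtr_ge0.
have B12 : B1 = B2 by exact: (F5plus_inf_eq_pos5_inf _ _ _ _ _ hZ _ _ s0).
split=> //.
- rewrite B12; apply: le_ereal_inf_tmp => _ [t tx <-].
  rewrite (expectation_pos5 _ _ _ _ _ hZ _ s0).
  exact: (maximal_bound _ _ _ _ _ _ _ filtH martS S0 sigma_gt0 hAB n t x tx).
- rewrite le_min (pos5_inf_le_tail _ _ _ _ _ hZ _ _ s0) /=.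
  apply: le_ereal_inf_tmp => _ [h h0 <-].
  exact: (pos5_inf_le_exp _ _ _ _ _ hZ _ _ s0).
- by move=> x0; exact: (tail_chernoff_closed_form _ _ _ _ _ hZ _ _ s0 x0).
Qed.
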